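(* Let $N\ge1$ be an integer, $1<p<m$ and $\sigma>0$. Then there exists $K^*\in(0,\infty]$ such that, for any $K\in(0,K^* )$, there are self-similar profiles $f$ such that $$\lim_{\xi\to0}\xi^{-(\sigma+2)/(m-p)}f(\xi)=K \qquad\text{and}\qquad \lim_{\xi\to\infty}\xi^{\sigma/(p-1)}f(\xi)=\left(\frac{1}{p-1}\right)^{1/(p-1)}.$$ Furthermore, $K^*>K_0$, where $$K_0:=\left[\frac{(m-p)^2}{m(\sigma+2)[m(N+\sigma)-p(N-2)]}\right]^{1/(m-p)},$$ and any self-similar profile $f$ satisfying both $\lim_{\xi\to0}\xi^{-(\sigma+2)/(m-p)}f(\xi)=K$ (for some $K\in(0,\infty)$) and $\lim_{\xi\to\infty}\xi^{\sigma/(p-1)}f(\xi)=\left(\frac{1}{p-1}\right)^{1/(p-1)}$ has a single maximum point.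
   Context: Consider the equation $\partial_t u=\Delta u^m-|x|^{\sigma}u^p$ for $(x,t)\in\mathbb{R}^N\times(0,\infty)$, with $N\ge1$, $1<p<m$, $\sigma>0$, and its nonnegative self-similar solutions $u(x,t)=t^{-\alpha}f(|x|t^{\beta})$, where $$\alpha=\frac{\sigma+2}{\sigma(m-1)+2(p-1)},\qquad \beta=\frac{m-p}{\sigma(m-1)+2(p-1)}.$$ The profile $f=f(\xi)$, $\xi=|x|t^{\beta}\ge0$, solves $$(f^m)''(\xi)+\frac{N-1}{\xi}(f^m)'(\xi)+\alpha f(\xi)-\beta\xi f'(\xi)-\xi^{\sigma}f^p(\xi)=0. \qquad ( * )$$ A self-similar profile is a continuous function $f:[0,\infty)\to[0,\infty)$ such that $f^m\in C^1([0,\infty))$, $(f^m)'(0)=0$, $(f^m)'(\xi)=0$ at every zero $\xi$ of $f$, and $f$ satisfies $( * )$ classically on $\{\xi>0: f(\xi)>0\}$. The constant $K_0$ is the one for which $S(x)=K_0|x|^{(\sigma+2)/(m-p)}$ is a stationary solution of the equation. *)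

(* Defs.v *)
(* Built on the real numbers of Stdlib together with Coquelicot. *)
From Stdlib Require Import Reals Lra.
From Coquelicot Require Import Coquelicot.

Open Scope R_scope.

(* [Rpower 0 a = 1], so it is used below only on positive bases; for a base
   that may vanish, [nnpow] has the value [0 ^ a = 0] expected for a > 0. *)
Definition nnpow (x a : R) : R :=
  if Rlt_dec 0 x then Rpower x a else 0.

Definition halfline (x : R) : Prop := 0 <= x.

(* This is [is_derive F x (dF x)] with [locally x] restricted to the half-line,
   so the derivative is two-sided for x > 0 and the right one at x = 0. *)
Definition is_C1_derivative_halfline (F dF : R -> R) : Prop :=
  (forall x, 0 <= x ->
     filterdiff F (within halfline (locally x)) (fun y => scal y (dF x))) /\
  continuous_on halfline dF.

Definition alpha (m p sigma : R) : R :=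
  (sigma + 2) / (sigma * (m - 1) + 2 * (p - 1)).

Definition beta (m p sigma : R) : R :=
  (m - p) / (sigma * (m - 1) + 2 * (p - 1)).

Definition profile_ode_at (N : nat) (m p sigma : R) (f : R -> R) (xi : R)
  : Prop :=
  let F := fun x => nnpow (f x) m in
  ex_derive f xi /\ ex_derive_n F 2 xi /\
  Derive_n F 2 xi + (INR N - 1) / xi * Derive F xi
    + alpha m p sigma * f xi - beta m p sigma * xi * Derive f xi
    - Rpower xi sigma * Rpower (f xi) p = 0.

(* A function on [0, oo) is represented by a function on R whose values at
   negative arguments are never used. *)
Definition self_similar_profile (N : nat) (m p sigma : R) (f : R -> R)
  : Prop :=
  (forall xi, 0 <= xi -> 0 <= f xi) /\
  continuous_on halfline f /\
  (exists dF : R -> R,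
     is_C1_derivative_halfline (fun x => nnpow (f x) m) dF /\
     dF 0 = 0 /\
     (forall xi, 0 <= xi -> f xi = 0 -> dF xi = 0)) /\
  (forall xi, 0 < xi -> 0 < f xi -> profile_ode_at N m p sigma f xi).

Definition behavior_at_zero (m p sigma : R) (f : R -> R) (K : R) : Prop :=
  filterlim (fun xi => Rpower xi (- ((sigma + 2) / (m - p))) * f xi)
    (at_right 0) (locally K).

Definition behavior_at_infinity (p sigma : R) (f : R -> R) : Prop :=
  is_lim (fun xi => Rpower xi (sigma / (p - 1)) * f xi) p_infty
    (Rpower (1 / (p - 1)) (1 / (p - 1))).

Definition K0 (N : nat) (m p sigma : R) : R :=
  Rpower ((m - p) ^ 2 /
          (m * (sigma + 2) * (m * (INR N + sigma) - p * (INR N - 2))))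
         (1 / (m - p)).

Definition local_max_halfline (f : R -> R) (xi : R) : Prop :=
  0 <= xi /\ within halfline (locally xi) (fun y => f y <= f xi).

(* The maximum over [0, oo) is attained, and its location is the only local
   maximum point, hence also the only global one. *)
Definition single_maximum_point (f : R -> R) : Prop :=
  exists xi0, 0 <= xi0 /\
    (forall xi, 0 <= xi -> f xi <= f xi0) /\
    (forall xi1, local_max_halfline f xi1 -> xi1 = xi0).

(* Main.v *)
Require Import Defs.
From Stdlib Require Import Reals.
From Coquelicot Require Import Coquelicot.
From Stdlib Require Import Lra Lia ClassicalEpsilon.
Open Scope R_scope.

(* Write f(xi) = xi^theta h(z)^(1/m) with theta = (sigma+2)/(m-p) and
   z = xi^(1/beta).  The profile equation becomes
     z^2 h'' + a z h' - B (h^(1/m))' + B (b h - h^(p/m)) = 0,  K0^m = b^(-m/(m-p)),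
   and the two prescribed behaviours become h -> K^m at z = 0 and
   z^(m/(p-1)) h -> (1/(p-1))^(m/(p-1)) at infinity.  There are explicit sub- and
   supersolutions with exactly these two limits: both end with a tail
   ((1 + M z^-g)^(-+1) / ((p-1) z))^(m/(p-1)); the lower one starts with a
   decreasing line K^m - k z, the upper one with an increasing line, followed by
   a wave K2 - D exp(-L/z).  The wave may start slightly above K0^m, which gives
   Kstar > K0.  Between them the equation, as a first-order system in h and the
   momentum z^(a-2) (z^2 h' - B h^(1/m)), is Lipschitz; if the coefficients are
   frozen outside the strip, a solution that leaves the strip never returns.
   Hence shooting from z = 1/n yields a solution that stays in the strip, and a
   cluster point of the data at z = 1 yields one on (0, oo).
   Uniqueness of the maximum: xi^sigma f^(p-1) is at most alpha at a maximum and
   at least alpha at a minimum, so a minimum cannot precede a maximum. *)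

(** What helps is that the transport term -B (h^(1/m))' governs both ends. Near 0 it makes every
    steep enough line a super- or subsolution, whatever the reaction does. At infinity its balance
    with h^(p/m) reads v' = -v^p for v = h^(1/m), which gives v = ((p-1) z)^(-1/(p-1)) and hence the
    prescribed limit. In between, the wave P solves z^2 P'' + 2 z P' = L P' exactly. Since a > 2, a
    negative surplus (a-2) z P' remains, and it pays for the positive reaction where the wave
    exceeds K0^m; this is the room that lifts Kstar above K0. The momentum serves to compare without
    monotonicity: against a frozen barrier the two right-hand sides share their nonlinear terms, so
    the difference of momenta has a derivative of one sign. *)

Ltac pos := repeat match goal with
  | |- 0 < _ * _ => apply Rmult_lt_0_compat
  | |- 0 < _ / _ => apply Rdiv_lt_0_compat
  | |- 0 < / _ => apply Rinv_0_lt_compat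
  | |- 0 < Rpower _ _ => apply exp_pos
  | |- 0 < ?x => is_var x; first [assumption | progress unfold x]
  end; lra.

Ltac scale := first [apply Rmult_le_compat_l; lra | apply Rmult_le_compat_r; lra].

(** * Elementary calculus: continuity, zeros, mean values, integrals *)

Lemma continuous_Rplus (u v : R -> R) t :
  continuous u t -> continuous v t -> continuous (fun s => u s + v s) t.
Proof. exact (continuous_plus (V := R_NormedModule) u v t). Qed.

Lemma continuous_Rminus (u v : R -> R) t :
  continuous u t -> continuous v t -> continuous (fun s => u s - v s) t.
Proof. exact (continuous_minus (V := R_NormedModule) u v t). Qed.

Lemma continuous_Rmult (u v : R -> R) t :
  continuous u t -> continuous v t -> continuous (fun s => u s * v s) t.
Proof. exact (continuous_mult (K := R_AbsRing) u v t). Qed.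
Lemma continuous_Ropp (u : R -> R) t : continuous u t -> continuous (fun s => - u s) t.
Proof. exact (continuous_opp (V := R_NormedModule) u t). Qed.

Lemma is_derive_Rminus (u v : R -> R) t l l' :
  is_derive u t l -> is_derive v t l' -> is_derive (fun s => u s - v s) t (l - l').
Proof. exact (is_derive_minus (K := R_AbsRing) (V := R_NormedModule) u v t l l'). Qed.

Lemma is_derive_Ropp (u : R -> R) t l : is_derive u t l -> is_derive (fun s => - u s) t (- l).
Proof. exact (is_derive_opp (K := R_AbsRing) (V := R_NormedModule) u t l). Qed.

Lemma locally_pos (x : R) : 0 < x -> locally x (fun y => 0 < y).
Proof.
intros Hx; exists (mkposreal _ Hx); intros y Hy; change (Rabs (y - x) < x) in Hy; apply Rabs_def2 in Hy; lra.
Qed.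

Lemma is_derive_ext_pos (u v : R -> R) x l :
  0 < x -> (forall y, 0 < y -> v y = u y) -> is_derive u x l -> is_derive v x l.
Proof.
intros Hx E; apply is_derive_ext_loc; generalize (locally_pos x Hx); apply filter_imp.
intros y Hy; symmetry; apply E, Hy.
Qed.

Lemma common_lower_bound (l : list R) :
  (forall x, List.In x l -> 0 < x) -> exists z, 0 < z /\ forall x, List.In x l -> z <= x.
Proof.
induction l as [| y l IH]; intros H; [exists 1; split; [lra | intros x []] |].
destruct IH as (z & Hz & Hl); [intros x Hx; apply H; right; exact Hx |].
exists (Rmin y z); split; [apply Rmin_glb_lt; [apply H; left; reflexivity | exact Hz] |].
intros x [<- | Hx]; [apply Rmin_l | eapply Rle_trans; [apply Rmin_r | apply Hl, Hx]].
Qed.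

Lemma function_choice (X Y : Type) (P : X -> Y -> Prop) :
  (forall x, exists y, P x y) -> exists g, forall x, P x (g x).
Proof.
intros H; exists (fun x => proj1_sig (constructive_indefinite_description _ (H x))).
intros x; apply proj2_sig.
Qed.

Lemma continuous_eps (u : R -> R) (t e : R) :
  continuous u t -> 0 < e -> exists d, 0 < d /\ forall s, Rabs (s - t) < d -> Rabs (u s - u t) < e.
Proof.
intros Hu He; destruct (proj1 (filterlim_locally _ _) Hu (mkposreal _ He)) as [d Hd].
exists d; split; [apply cond_pos | exact Hd].
Qed.

Lemma at_right_eps (u : R -> R) (l e : R) :
  filterlim u (at_right 0) (locally l) -> 0 < e ->
  exists d, 0 < d /\ forall x, 0 < x -> x < d -> Rabs (u x - l) < e.
Proof.
intros Hu He; destruct (proj1 (filterlim_locally _ _) Hu (mkposreal _ He)) as [d Hd].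
exists d; split; [apply cond_pos |]; intros x Hx Hxd; apply (Hd x); [| exact Hx].
change (Rabs (x - 0) < d); rewrite Rminus_0_r, Rabs_pos_eq; lra.
Qed.

Lemma first_zero (u : R -> R) (a b : R) :
  a <= b -> (forall t, a <= t <= b -> continuous u t) -> 0 < u a -> u b <= 0 ->
  exists c, a < c <= b /\ u c = 0 /\ forall t, a <= t < c -> 0 < u t.
Proof.
intros Hab Hc Ha Hb.
set (E := fun t => a <= t <= b /\ forall s, a <= s <= t -> 0 < u s).
assert (HEa : E a).
{ split; [lra |]; intros s Hs; replace s with a by lra; exact Ha. }
destruct (completeness E) as [c [Hc1 Hc2]].
{ exists b; intros t [Ht _]; lra. }
{ exists a; exact HEa. }
assert (Hac : a <= c) by (apply Hc1; exact HEa).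
assert (Hcb : c <= b) by (apply Hc2; intros t [Ht _]; lra).
assert (Hpos : forall t, a <= t < c -> 0 < u t).
{ intros t Ht; apply Rnot_le_lt; intros Hn.
  assert (c <= t); [| lra].
  apply Hc2; intros s [Hs1 Hs2]; apply Rnot_lt_le; intros Hts.
  specialize (Hs2 t ltac:(lra)); lra. }
assert (Hle : u c <= 0).
{ apply Rnot_lt_le; intros Huc.
  destruct (continuous_eps u c (u c) (Hc c (conj Hac Hcb)) Huc) as [d [Hd Hs]].
  destruct (Rle_lt_dec b c) as [Hbc | Hbc]; [replace c with b in Huc by lra; lra |].
  set (t := Rmin b (c + d / 2)).
  assert (Ht : c < t <= b /\ t <= c + d / 2).
  { unfold t; split; [split |]; [apply Rmin_glb_lt; lra | apply Rmin_l | apply Rmin_r]. }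
  assert (E t); [| assert (t <= c) by (apply Hc1; assumption); lra].
  split; [lra |]; intros s Hst.
  destruct (Rlt_le_dec s c) as [Hsc | Hsc]; [apply Hpos; lra |].
  specialize (Hs s ltac:(rewrite Rabs_pos_eq; lra)); apply Rabs_def2 in Hs; lra. }
assert (Hac' : a < c) by (destruct Hac as [Hac | Hac]; [exact Hac | subst c; lra]).
exists c; split; [lra | split; [| exact Hpos]].
apply Rle_antisym; [exact Hle |].
apply Rnot_lt_le; intros Hneg.
destruct (continuous_eps u c (- u c) (Hc c (conj Hac Hcb)) ltac:(lra)) as [d [Hd Hs]].
set (s := Rmax a (c - d / 2)).
assert (Has : a <= s < c /\ c - d / 2 <= s).
{ unfold s; split; [split |]; [apply Rmax_l | apply Rmax_lub_lt; lra | apply Rmax_r]. }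
specialize (Hpos s ltac:(lra)).
specialize (Hs s ltac:(apply Rabs_def1; lra)); apply Rabs_def2 in Hs; lra.
Qed.

Lemma is_derive_cont (u : R -> R) (t l : R) : is_derive u t l -> continuous u t.
Proof. intros H; apply (ex_derive_continuous (K := R_AbsRing) (V := R_NormedModule)); exists l; exact H. Qed.
Lemma continuous_cpt (u : R -> R) t : continuous u t -> continuity_pt u t.
Proof. intros H; apply continuity_pt_filterlim; exact H. Qed.

Lemma derive_nonneg_le (u du : R -> R) (a b : R) :
  a <= b -> (forall t, a < t < b -> is_derive u t (du t)) ->
  (forall t, a <= t <= b -> continuous u t) ->
  (forall t, a < t < b -> 0 <= du t) -> u a <= u b.
Proof.
intros Hab Hd Hc Hp.
destruct Hab as [Hab | ->]; [| lra].
(* [MVT_gen] may return an endpoint, where nothing is assumed of [du]; the extension by 0 keeps the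
   sign there. *)
set (dv := fun t => if Rlt_dec a t then if Rlt_dec t b then du t else 0 else 0).
destruct (MVT_gen u a b dv) as [c [Hc1 Hc2]].
- rewrite Rmin_left, Rmax_right by lra; intros t Ht; unfold dv.
  destruct (Rlt_dec a t); [| lra]; destruct (Rlt_dec t b); [| lra]; apply Hd; lra.
- rewrite Rmin_left, Rmax_right by lra; intros t Ht; apply continuous_cpt, Hc; lra.
- assert (0 <= dv c).
  { unfold dv; destruct (Rlt_dec a c); [| lra]; destruct (Rlt_dec c b); [| lra]; apply Hp; lra. }
  nra.
Qed.

Lemma mvt_closed (u du : R -> R) (a b : R) :
  a < b -> (forall t, a <= t <= b -> is_derive u t (du t)) ->
  exists c, a <= c <= b /\ u b - u a = du c * (b - a).
Proof.
intros Hab Hd.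
destruct (MVT_gen u a b du) as [c [Hc1 Hc2]].
- rewrite Rmin_left, Rmax_right by lra; intros t Ht; apply Hd; lra.
- rewrite Rmin_left, Rmax_right by lra; intros t Ht.
  apply continuous_cpt, is_derive_cont with (du t), Hd; lra.
- rewrite Rmin_left, Rmax_right in Hc1 by lra; exists c; split; assumption.
Qed.

Lemma continuous_bounded (u : R -> R) (a b : R) :
  a <= b -> (forall t, a <= t <= b -> continuous u t) ->
  exists M, 0 < M /\ forall t, a <= t <= b -> Rabs (u t) <= M.
Proof.
intros Hab Hc.
destruct (continuity_ab_maj (fun t => Rabs (u t)) a b Hab) as [c [Hc1 Hc2]].
{ intros t Ht; apply continuous_cpt, continuous_comp; [apply Hc; lra | apply continuous_Rabs]. }
exists (Rabs (u c) + 1); split; [pose proof (Rabs_pos (u c)); lra |].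
intros t Ht; specialize (Hc1 t Ht); lra.
Qed.

Lemma continuous_pos_lower (u : R -> R) (a b : R) :
  a <= b -> (forall t, a <= t <= b -> continuous u t) ->
  (forall t, a <= t <= b -> 0 < u t) ->
  exists e, 0 < e /\ forall t, a <= t <= b -> e <= u t.
Proof.
intros Hab Hc Hp.
destruct (continuity_ab_min u a b Hab) as [c [Hc1 Hc2]].
{ intros t Ht; apply continuous_cpt, Hc; lra. }
exists (u c); split; [apply Hp; exact Hc2 |]; exact Hc1.
Qed.

Lemma is_derive_RInt_pos (f : R -> R) (t0 t : R) :
  0 < t0 -> 0 < t -> (forall s, 0 < s -> continuous f s) ->
  is_derive (fun s => RInt f t0 s) t (f t).
Proof.
intros H0 Ht Hf.
apply is_derive_RInt with t0; [| apply Hf; exact Ht].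
exists (mkposreal _ Ht); intros s Hs; apply RInt_correct, ex_RInt_continuous.
change (Rabs (s - t) < t) in Hs; apply Rabs_def2 in Hs.
intros r Hr; apply Hf; pose proof (Rmin_glb_lt t0 s 0 H0 ltac:(lra)); lra.
Qed.

Lemma exp_le_mono (x y : R) : x <= y -> exp x <= exp y.
Proof. intros [H | ->]; [left; apply exp_increasing; exact H | right; reflexivity]. Qed.

(** Integrating the weight exp(lam (s - t0)) gains a factor 1/lam. Taking lam large makes the Picard
    map a contraction on any compact interval, however long. *)
Lemma RInt_exp_bound_right (f : R -> R) (C lam t0 t : R) :
  0 < lam -> 0 <= C -> t0 <= t -> (forall s, t0 <= s <= t -> continuous f s) ->
  (forall s, t0 <= s <= t -> Rabs (f s) <= C * exp (lam * (s - t0))) ->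
  Rabs (RInt f t0 t) <= C / lam * exp (lam * (t - t0)).
Proof.
intros Hl HC Ht Hc Hb.
assert (Hex : forall g : R -> R, (forall s, t0 <= s <= t -> continuous g s) -> ex_RInt g t0 t).
{ intros g Hg; apply (ex_RInt_continuous (V := R_CompleteNormedModule)); rewrite Rmin_left, Rmax_right by lra; exact Hg. }
assert (Hi : is_RInt (fun s => C * exp (lam * (s - t0))) t0 t
   (C / lam * exp (lam * (t - t0)) - C / lam * exp (lam * (t0 - t0)))).
{ apply (is_RInt_derive (fun s => C / lam * exp (lam * (s - t0)))).
  - intros s _; auto_derive; [exact I |]; unfold Rminus; field; lra.
  - intros s _; apply (ex_derive_continuous (K := R_AbsRing) (V := R_NormedModule)); auto_derive; exact I. }
eapply Rle_trans; [apply abs_RInt_le; [exact Ht | apply Hex, Hc] |].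
eapply Rle_trans.
{ apply (RInt_le (fun s => Rabs (f s)) (fun s => C * exp (lam * (s - t0)))); [exact Ht | | eexists; exact Hi |].
  - apply Hex; intros s Hs; apply continuous_comp; [apply Hc; lra | apply continuous_Rabs].
  - intros s Hs; apply Hb; lra. }
rewrite (is_RInt_unique _ _ _ _ Hi).
assert (0 <= C / lam) by (apply Rmult_le_pos; [lra | left; pos]).
pose proof (exp_pos (lam * (t0 - t0))); nra.
Qed.

Lemma RInt_exp_bound (f : R -> R) (C lam t0 t : R) :
  0 < lam -> 0 <= C -> (forall s, Rmin t0 t <= s <= Rmax t0 t -> continuous f s) ->
  (forall s, Rmin t0 t <= s <= Rmax t0 t -> Rabs (f s) <= C * exp (lam * Rabs (s - t0))) ->
  Rabs (RInt f t0 t) <= C / lam * exp (lam * Rabs (t - t0)).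
Proof.
intros Hl HC Hc Hb; destruct (Rle_lt_dec t0 t) as [Ht | Ht].
- rewrite Rmin_left, Rmax_right in * by lra; rewrite (Rabs_pos_eq (t - t0)) by lra.
  apply RInt_exp_bound_right; try assumption.
  intros s Hs; rewrite <- (Rabs_pos_eq (s - t0)) by lra; apply Hb, Hs.
(* To the left of t0 the reflection s -> -s reduces to the previous estimate. *)
- rewrite Rmin_right, Rmax_left in * by lra; rewrite (Rabs_left1 (t - t0)) by lra.
  assert (Hc' : forall s, - t0 <= s <= - t -> continuous (fun s => - f (- s)) s).
  { intros s Hs; apply continuous_Ropp, continuous_comp; [apply continuous_Ropp, continuous_id | apply Hc; lra]. }
  replace (RInt f t0 t) with (RInt (fun s => - f (- s)) (- t0) (- t)).
  + replace (- (t - t0)) with (- t - - t0) by ring; apply RInt_exp_bound_right; try assumption; [lra |].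
    intros s Hs; rewrite Rabs_Ropp; replace (s - - t0) with (Rabs (- s - t0)); [apply Hb; lra |].
    rewrite Rabs_left1 by lra; ring.
  + apply is_RInt_unique, (is_RInt_comp_opp f); rewrite !Ropp_involutive.
    apply (RInt_correct (V := R_CompleteNormedModule)), (ex_RInt_continuous (V := R_CompleteNormedModule)).
    intros s Hs; apply Hc; rewrite Rmin_right, Rmax_left in Hs by lra; exact Hs.
Qed.
Lemma Derive_eq (u : R -> R) (t l : R) : is_derive u t l -> Derive (fun r : R => u r) t = l.
Proof. intros H; apply is_derive_unique; exact H. Qed.

(** * Solutions of planar systems on the half-line *)

(** Continuity tested along continuous curves: the integral equation only needs the integrand s -> F
    s (x s) (y s) to be continuous. *)
Definition continuous_field (F : R -> R -> R -> R) : Prop :=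
  forall (x y : R -> R) t, 0 < t -> continuous x t -> continuous y t ->
    continuous (fun s => F s (x s) (y s)) t.

(** Local in time but global in (x, y): solutions then live on all of (0, oo) and shooting never
    meets blow-up. The truncation by [clip] below provides this property. *)
Definition lipschitz_field (F : R -> R -> R -> R) : Prop :=
  forall a b, 0 < a -> a <= b -> exists L, 0 < L /\
    forall t x y x' y', a <= t <= b ->
      Rabs (F t x y - F t x' y') <= L * (Rabs (x - x') + Rabs (y - y')).

Definition is_solution (F1 F2 : R -> R -> R -> R) (x y : R -> R) : Prop :=
  forall t, 0 < t -> is_derive x t (F1 t (x t) (y t)) /\ is_derive y t (F2 t (x t) (y t)).

Lemma common_lipschitz (F1 F2 : R -> R -> R -> R) a b :
  lipschitz_field F1 -> lipschitz_field F2 -> 0 < a -> a <= b -> exists L, 0 < L /\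
  (forall t x y x' y', a <= t <= b ->
      Rabs (F1 t x y - F1 t x' y') <= L * (Rabs (x - x') + Rabs (y - y'))) /\
  (forall t x y x' y', a <= t <= b ->
      Rabs (F2 t x y - F2 t x' y') <= L * (Rabs (x - x') + Rabs (y - y'))).
Proof.
intros L1 L2 Ha Hab.
destruct (L1 a b Ha Hab) as [La [HLa Ha']]; destruct (L2 a b Ha Hab) as [Lb [HLb Hb']].
exists (La + Lb); split; [lra |].
split; intros t x y x' y' Ht; pose proof (Rabs_pos (x - x')); pose proof (Rabs_pos (y - y')).
- specialize (Ha' t x y x' y' Ht); nra.
- specialize (Hb' t x y x' y' Ht); nra.
Qed.

Lemma half_pow_small (M e : R) : 0 < M -> 0 < e -> exists k, M * (1 / 2) ^ k < e.
Proof.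
intros HM He; destruct (pow_lt_1_zero (1 / 2) ltac:(rewrite Rabs_pos_eq; lra) (e / M) ltac:(pos)) as [k Hk].
exists k; specialize (Hk k (le_n k)); rewrite Rabs_pos_eq in Hk by (apply pow_le; lra).
apply Rmult_lt_compat_l with (r := M) in Hk; [| exact HM].
replace (M * (e / M)) with e in Hk by (field; lra); exact Hk.
Qed.

Lemma cauchy_tail_limit (u : nat -> R) (M : R) :
  0 < M -> (forall k l, (k <= l)%nat -> Rabs (u l - u k) <= M * (1 / 2) ^ k) ->
  forall k, Rabs (real (Lim_seq u) - u k) <= M * (1 / 2) ^ k.
Proof.
intros HM Hu.
assert (Hex : ex_finite_lim_seq u).
{ apply ex_lim_seq_cauchy_corr; intros e; destruct (half_pow_small M (e / 2) HM) as [k Hk].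
  { pose proof (cond_pos e); lra. }
  exists k; intros n n' Hn Hn'.
  pose proof (Hu k n Hn); pose proof (Hu k n' Hn').
  replace (u n - u n') with ((u n - u k) - (u n' - u k)) by ring.
  eapply Rle_lt_trans; [apply Rabs_triang |]; rewrite Rabs_Ropp; lra. }
destruct Hex as [l Hl]; rewrite (is_lim_seq_unique _ _ Hl); simpl.
intros k; apply Rnot_lt_le; intros Hlt.
apply is_lim_seq_spec in Hl.
assert (He : 0 < Rabs (l - u k) - M * (1 / 2) ^ k) by lra.
destruct (Hl (mkposreal _ He)) as [n Hn]; simpl in Hn.
specialize (Hn (Nat.max n k) (Nat.le_max_l n k)); specialize (Hu k (Nat.max n k) (Nat.le_max_r n k)).
pose proof (Rabs_triang (l - u (Nat.max n k)) (u (Nat.max n k) - u k)) as T.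
replace (l - u (Nat.max n k) + (u (Nat.max n k) - u k)) with (l - u k) in T by ring.
rewrite (Rabs_minus_sym l (u (Nat.max n k))) in T; lra.
Qed.

Lemma uniform_limit_continuous (u : nat -> R -> R) (v : R -> R) (a b M t : R) :
  a < t < b -> 0 < M ->
  (forall k s, a <= s <= b -> Rabs (v s - u k s) <= M * (1 / 2) ^ k) ->
  (forall k, continuous (u k) t) -> continuous v t.
Proof.
intros Ht HM Hu Hc; apply filterlim_locally; intros e; pose proof (cond_pos e) as He0.
destruct (half_pow_small M (e / 3) HM) as [k Hk]; [lra |].
destruct (continuous_eps _ _ (e / 3) (Hc k) ltac:(lra)) as (d & Hd & H1).
assert (Hm : 0 < Rmin d (Rmin (t - a) (b - t))) by (repeat apply Rmin_glb_lt; lra).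
pose proof (Rmin_l d (Rmin (t - a) (b - t))); pose proof (Rmin_r d (Rmin (t - a) (b - t))).
pose proof (Rmin_l (t - a) (b - t)); pose proof (Rmin_r (t - a) (b - t)).
exists (mkposreal _ Hm); intros s Hs; change (Rabs (s - t) < Rmin d (Rmin (t - a) (b - t))) in Hs.
specialize (H1 s ltac:(lra)); apply Rabs_def2 in Hs.
change (Rabs (v s - v t) < e).
pose proof (Hu k s ltac:(lra)); pose proof (Hu k t ltac:(lra)).
replace (v s - v t) with ((v s - u k s) + ((u k s - u k t) + - (v t - u k t))) by ring.
eapply Rle_lt_trans; [apply Rabs_triang |].
pose proof (Rabs_triang (u k s - u k t) (- (v t - u k t))) as T; rewrite Rabs_Ropp in T; lra.
Qed.

(** * Picard iteration in an exponentially weighted norm *)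

Section Picard.

Variables (F : bool -> R -> R -> R -> R) (t0 : R) (c : bool -> R).
Hypothesis F_cont : forall i, continuous_field (F i).
Hypothesis F_lip : forall i, lipschitz_field (F i).
Hypothesis t0pos : 0 < t0.

(** The two components are indexed by [bool], so that most statements treat both at once. *)
Fixpoint picard (k : nat) (i : bool) : R -> R :=
  match k with
  | O => fun _ => c i
  | S k => fun t => c i + RInt (fun s => F i s (picard k true s) (picard k false s)) t0 t
  end.

Lemma picard_continuous (k : nat) i t : 0 < t -> continuous (picard k i) t.
Proof.
revert i t; induction k as [| k IH]; intros i t Ht; simpl; [apply continuous_const |].
apply (continuous_Rplus); [apply continuous_const |].
apply (is_derive_cont _ t _ (is_derive_RInt_pos _ t0 t t0pos Ht
  (fun s Hs => F_cont i _ _ s Hs (IH true s Hs) (IH false s Hs)))).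
Qed.

Lemma between_pos a b t s :
  a <= t0 <= b -> a <= t <= b -> Rmin t0 t <= s <= Rmax t0 t -> a <= s <= b.
Proof.
intros H0 Ht Hs.
pose proof (Rmin_glb t0 t a ltac:(lra) ltac:(lra)).
pose proof (Rmax_lub t0 t b ltac:(lra) ltac:(lra)); lra.
Qed.

Definition dist2 (x y : bool -> R -> R) (t : R) : R :=
  Rabs (x true t - y true t) + Rabs (x false t - y false t).

Lemma RInt_minus_bound i a b L lam C (x y : bool -> R -> R) t :
  0 < a -> a <= t0 <= b -> a <= t <= b -> 0 < lam -> 0 <= C -> 0 < L ->
  (forall t x y x' y', a <= t <= b ->
      Rabs (F i t x y - F i t x' y') <= L * (Rabs (x - x') + Rabs (y - y'))) ->
  (forall j s, 0 < s -> continuous (x j) s) -> (forall j s, 0 < s -> continuous (y j) s) ->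
  (forall s, a <= s <= b -> dist2 x y s <= C * exp (lam * Rabs (s - t0))) ->
  Rabs (RInt (fun s => F i s (x true s) (x false s)) t0 t - RInt (fun s => F i s (y true s) (y false s)) t0 t)
   <= L * C / lam * exp (lam * Rabs (t - t0)).
Proof.
intros Ha H0 Ht Hlam HC HL HF Hx Hy Hb.
assert (CF : forall z, (forall j s, 0 < s -> continuous (z j) s) -> forall s, Rmin t0 t <= s <= Rmax t0 t ->
  continuous (fun s => F i s (z true s) (z false s)) s).
{ intros z Hz s Hs; pose proof (between_pos a b t s H0 Ht Hs); assert (Hsp : 0 < s) by lra.
  exact (F_cont i _ _ s Hsp (Hz true s Hsp) (Hz false s Hsp)). }
rewrite <- (RInt_minus (V := R_CompleteNormedModule) (fun s => F i s (x true s) (x false s))).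
2: exact (ex_RInt_continuous (V := R_CompleteNormedModule) _ _ _ (CF x Hx)).
2: exact (ex_RInt_continuous (V := R_CompleteNormedModule) _ _ _ (CF y Hy)).
apply RInt_exp_bound; [exact Hlam | nra | |].
- intros s Hs; exact (continuous_Rminus _ _ s (CF x Hx s Hs) (CF y Hy s Hs)).
- intros s Hs; pose proof (between_pos a b t s H0 Ht Hs) as Hs'.
  eapply Rle_trans; [apply HF; exact Hs' |].
  rewrite Rmult_assoc; apply Rmult_le_compat_l; [lra | apply Hb; exact Hs'].
Qed.

(* The weight [exp (4 L |t - t0|)] makes the iteration a contraction with
   factor 1/2. *)
Lemma picard_step a b : 0 < a -> a <= t0 <= b -> exists M lam, 0 < M /\ 0 < lam /\
  forall k t, a <= t <= b -> dist2 (picard (S k)) (picard k) t <= M * (1 / 2) ^ k * exp (lam * Rabs (t - t0)).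
Proof.
intros Ha H0.
destruct (common_lipschitz _ _ a b (F_lip true) (F_lip false) Ha ltac:(lra)) as [L [HL [HL1 HL2]]].
destruct (continuous_bounded (dist2 (picard 1) (picard 0)) a b ltac:(lra)) as [M [HM Hb]].
{ intros t Ht; assert (Htp : 0 < t) by lra.
  apply (continuous_Rplus); (apply continuous_comp; [| apply continuous_Rabs]);
    exact (continuous_Rminus _ _ t (picard_continuous 1 _ t Htp) (picard_continuous 0 _ t Htp)). }
exists M, (4 * L); split; [exact HM |]; split; [lra |].
induction k as [| k IH]; intros t Ht.
- simpl pow; specialize (Hb t Ht); pose proof (Rle_abs (dist2 (picard 1) (picard 0) t)).
  pose proof (exp_le_mono 0 (4 * L * Rabs (t - t0))) as He; rewrite exp_0 in He.
  specialize (He ltac:(pose proof (Rabs_pos (t - t0)); nra)); nra.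
- set (q := (1 / 2) ^ k) in *.
  assert (Hq : 0 < q) by (apply pow_lt; lra).
  assert (HC : 0 <= M * q) by nra; assert (H4 : 0 < 4 * L) by lra.
  pose proof (RInt_minus_bound true a b L (4 * L) (M * q) _ _ t Ha H0 Ht H4 HC HL HL1
    (picard_continuous (S k)) (picard_continuous k) IH) as B1.
  pose proof (RInt_minus_bound false a b L (4 * L) (M * q) _ _ t Ha H0 Ht H4 HC HL HL2
    (picard_continuous (S k)) (picard_continuous k) IH) as B2.
  replace (L * (M * q) / (4 * L)) with (M * q / 4) in B1, B2 by (field; lra).
  assert (E : forall i, picard (S (S k)) i t - picard (S k) i t =
    RInt (fun s => F i s (picard (S k) true s) (picard (S k) false s)) t0 t
    - RInt (fun s => F i s (picard k true s) (picard k false s)) t0 t) by (intros; simpl; ring).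
  unfold dist2; rewrite !E; change ((1 / 2) ^ S k) with (1 / 2 * q); lra.
Qed.

Lemma picard_tail a b : 0 < a -> a <= t0 <= b -> exists M, 0 < M /\
  forall k l t, a <= t <= b -> (k <= l)%nat -> dist2 (picard l) (picard k) t <= M * (1 / 2) ^ k.
Proof.
intros Ha H0; destruct (picard_step a b Ha H0) as [M [lam [HM [Hlam Hs]]]].
set (E := exp (lam * (b - a))); assert (HE : 0 < E) by apply exp_pos.
exists (2 * M * E); split; [nra |]; intros k l t Ht Hkl.
assert (Hstep : forall k, dist2 (picard (S k)) (picard k) t <= M * E * (1 / 2) ^ k).
{ intros j; eapply Rle_trans; [apply Hs; exact Ht |].
  rewrite (Rmult_assoc M E), (Rmult_comm E), <- Rmult_assoc.
  apply Rmult_le_compat_l; [apply Rmult_le_pos; [lra | apply pow_le; lra] |].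
  apply exp_le_mono, Rmult_le_compat_l; [lra | apply Rabs_le; lra]. }
assert (Htri : forall x y z, dist2 x z t <= dist2 x y t + dist2 y z t).
{ intros x y z; unfold dist2.
  pose proof (Rabs_triang (x true t - y true t) (y true t - z true t)) as T1.
  pose proof (Rabs_triang (x false t - y false t) (y false t - z false t)) as T2.
  replace (x true t - y true t + (y true t - z true t)) with (x true t - z true t) in T1 by ring.
  replace (x false t - y false t + (y false t - z false t)) with (x false t - z false t) in T2 by ring; lra. }
(* The partial geometric sum keeps its negative term (1/2)^(k+j); without it the induction on j
   would not close. *)
assert (Hgen : forall j, dist2 (picard (k + j)) (picard k) t <= 2 * M * E * ((1 / 2) ^ k - (1 / 2) ^ (k + j))).
{ induction j as [| j IH].
  - rewrite Nat.add_0_r; unfold dist2; rewrite !Rminus_diag, Rabs_R0; lra.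
  - rewrite <- plus_n_Sm; specialize (Hstep (k + j)%nat).
    pose proof (Htri (picard (S (k + j))) (picard (k + j)) (picard k)).
    change ((1 / 2) ^ S (k + j)) with (1 / 2 * (1 / 2) ^ (k + j)); lra. }
specialize (Hgen (l - k)%nat); replace (k + (l - k))%nat with l in Hgen by lia.
assert (0 < (1 / 2) ^ l) by (apply pow_lt; lra).
assert (0 < M * E) by nra; nra.
Qed.

Definition picard_lim (i : bool) (t : R) : R := real (Lim_seq (fun k => picard k i t)).

Lemma picard_limit a b : 0 < a -> a <= t0 <= b -> exists M, 0 < M /\
  forall k i t, a <= t <= b -> Rabs (picard_lim i t - picard k i t) <= M * (1 / 2) ^ k.
Proof.
intros Ha H0; destruct (picard_tail a b Ha H0) as [M [HM Hs]].
exists M; split; [exact HM |]; intros k i t Ht.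
apply cauchy_tail_limit with (u := fun k => picard k i t); [exact HM |]; intros j l Hjl.
eapply Rle_trans; [| apply Hs; [exact Ht | exact Hjl]].
unfold dist2; destruct i; match goal with |- _ <= ?u + ?v => assert (0 <= u /\ 0 <= v) by (split; apply Rabs_pos) end; lra.
Qed.

Lemma picard_lim_continuous i t : 0 < t -> continuous (picard_lim i) t.
Proof.
intros Ht; set (a := Rmin t t0 / 2); set (b := Rmax t t0 + 1).
assert (Hm : 0 < Rmin t t0) by (apply Rmin_glb_lt; lra).
pose proof (Rmin_l t t0); pose proof (Rmin_r t t0); pose proof (Rmax_l t t0); pose proof (Rmax_r t t0).
destruct (picard_limit a b) as [M [HM HL]]; [unfold a; lra | unfold a, b; lra |].
apply uniform_limit_continuous with (u := fun k => picard k i) (a := a) (b := b) (M := M);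
  [unfold a, b; lra | exact HM | exact (fun k s Hs => HL k i s Hs) | exact (fun k => picard_continuous k i t Ht)].
Qed.

Lemma picard_lim_integral i t : 0 < t ->
  picard_lim i t = c i + RInt (fun s => F i s (picard_lim true s) (picard_lim false s)) t0 t.
Proof.
intros Ht; set (a := Rmin t t0); set (b := Rmax t t0).
assert (Hm : 0 < a) by (apply Rmin_glb_lt; lra).
assert (Hab0 : a <= t0 <= b) by (split; [apply Rmin_r | apply Rmax_r]).
assert (Hab : a <= t <= b) by (split; [apply Rmin_l | apply Rmax_l]).
destruct (picard_limit a b Hm Hab0) as [M [HM HL]].
destruct (F_lip i a b Hm ltac:(lra)) as [L [HL0 HL1]].
set (E := exp (1 * Rabs (t - t0))); assert (HE : 0 < E) by apply exp_pos.
set (C := M + L * (2 * M) / 1 * E).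
assert (HC : 0 < C).
{ unfold C; assert (0 < L * (2 * M)) by nra; assert (0 < L * (2 * M) / 1 * E); [| lra].
  pos. }
assert (Hk : forall k, Rabs (RInt (fun s => F i s (picard_lim true s) (picard_lim false s)) t0 t -
    RInt (fun s => F i s (picard k true s) (picard k false s)) t0 t) <= L * (2 * M) / 1 * E * (1 / 2) ^ k).
{ intros k; assert (Hq : 0 < (1 / 2) ^ k) by (apply pow_lt; lra).
  replace (L * (2 * M) / 1 * E * (1 / 2) ^ k) with (L * (2 * M * (1 / 2) ^ k) / 1 * E) by field.
  refine (RInt_minus_bound i a b L 1 (2 * M * (1 / 2) ^ k) picard_lim (picard k) t
    Hm Hab0 Hab Rlt_0_1 _ HL0 HL1 picard_lim_continuous (picard_continuous k) _); [nra |].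
  intros s Hs; pose proof (HL k true s Hs); pose proof (HL k false s Hs).
  pose proof (exp_le_mono 0 (1 * Rabs (s - t0)) ltac:(pose proof (Rabs_pos (s - t0)); lra)) as He; rewrite exp_0 in He.
  unfold dist2; assert (0 < M * (1 / 2) ^ k) by nra; nra. }
(* The two sides differ from their k-th iterates by at most a multiple of (1/2)^k, so |d| <= C
   (1/2)^k for every k, which is impossible for a nonzero d. *)
apply Rminus_diag_uniq; set (d := _ - _); destruct (Req_dec d 0) as [E0 | Hd0]; [exact E0 |].
destruct (half_pow_small C (Rabs d) HC (Rabs_pos_lt d Hd0)) as [k Hk'].
specialize (Hk k); pose proof (HL (S k) i t Hab) as HX; assert (Hq : 0 < (1 / 2) ^ k) by (apply pow_lt; lra).
change (picard (S k) i t) with (c i + RInt (fun s => F i s (picard k true s) (picard k false s)) t0 t) in HX.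
change ((1 / 2) ^ S k) with (1 / 2 * (1 / 2) ^ k) in HX.
exfalso; revert HX Hk Hk'; unfold d; set (I1 := RInt _ _ _); set (I2 := RInt _ _ _); intros HX Hk Hk'.
pose proof (Rabs_triang (picard_lim i t - (c i + I1)) (- (I2 - I1))) as T; rewrite Rabs_Ropp in T.
replace (picard_lim i t - (c i + I1) + - (I2 - I1)) with (picard_lim i t - (c i + I2)) in T by ring.
unfold C in Hk'; rewrite Rmult_plus_distr_r in Hk'; assert (0 < M * (1 / 2) ^ k) by nra; lra.
Qed.

Lemma picard_lim_derive i t : 0 < t -> is_derive (picard_lim i) t (F i t (picard_lim true t) (picard_lim false t)).
Proof.
intros Ht; apply (is_derive_ext_pos (fun t => c i + RInt (fun s => F i s (picard_lim true s) (picard_lim false s)) t0 t));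
  [exact Ht | apply picard_lim_integral |].
rewrite <- (Rplus_0_l (F i t _ _)).
apply (is_derive_plus (V := R_NormedModule)); [apply (is_derive_const (V := R_NormedModule)) |].
apply (is_derive_RInt_pos (fun s => F i s (picard_lim true s) (picard_lim false s))); [exact t0pos | exact Ht |].
exact (fun s Hs => F_cont i _ _ s Hs (picard_lim_continuous true s Hs) (picard_lim_continuous false s Hs)).
Qed.

Lemma picard_lim_initial i : picard_lim i t0 = c i.
Proof. rewrite (picard_lim_integral i t0 t0pos), RInt_point; apply Rplus_0_r. Qed.

End Picard.

Theorem picard_lindelof (F1 F2 : R -> R -> R -> R) (t0 x0 y0 : R) :
  continuous_field F1 -> continuous_field F2 -> lipschitz_field F1 -> lipschitz_field F2 -> 0 < t0 ->
  exists x y, is_solution F1 F2 x y /\ x t0 = x0 /\ y t0 = y0.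
Proof.
intros C1 C2 L1 L2 H0; set (F := fun i : bool => if i then F1 else F2); set (c := fun i : bool => if i then x0 else y0).
assert (HC : forall i, continuous_field (F i)) by (intros []; assumption).
assert (HL : forall i, lipschitz_field (F i)) by (intros []; assumption).
exists (picard_lim F t0 c true), (picard_lim F t0 c false); split; [| split].
- intros t Ht; split; [exact (picard_lim_derive F t0 c HC HL H0 true t Ht) | exact (picard_lim_derive F t0 c HC HL H0 false t Ht)].
- exact (picard_lim_initial F t0 c HC HL H0 true).
- exact (picard_lim_initial F t0 c HC HL H0 false).
Qed.

(** * Gronwall estimate and continuous dependence on the data *)

Lemma exp_move (u v k s t : R) :
  u * exp (k * t) <= v * exp (k * s) -> u <= exp (k * (s - t)) * v.
Proof.
intros H; apply Rmult_le_reg_r with (exp (k * t)); [apply exp_pos |].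
rewrite (Rmult_comm _ v), Rmult_assoc, <- exp_plus.
replace (k * (s - t) + k * t) with (k * s) by ring; exact H.
Qed.

(** Gronwall for the squared distance [e], which is differentiable even where the distance vanishes:
    |e'| <= 2 L (X + Y)^2 <= 4 L e, with X and Y the distances of the components. The time t may lie
    on either side of s, because the limit solution is later compared on all of (0, oo) from its
    data at 1. *)
Lemma solution_distance (F1 F2 : R -> R -> R -> R) (a b : R) :
  lipschitz_field F1 -> lipschitz_field F2 -> 0 < a -> a <= b ->
  exists C, 0 < C /\ forall x y x' y', is_solution F1 F2 x y -> is_solution F1 F2 x' y' ->
    forall s t, a <= s <= b -> a <= t <= b ->
      (x t - x' t) ^ 2 + (y t - y' t) ^ 2 <= C * ((x s - x' s) ^ 2 + (y s - y' s) ^ 2).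
Proof.
intros L1 L2 Ha Hab; destruct (common_lipschitz F1 F2 a b L1 L2 Ha Hab) as [L [HL [H1 H2]]].
exists (exp (4 * L * (b - a))); split; [apply exp_pos |].
intros x y x' y' HS HS' s t Hs Ht.
set (e := fun t => (x t - x' t) ^ 2 + (y t - y' t) ^ 2).
set (de := fun t => 2 * (x t - x' t) * (F1 t (x t) (y t) - F1 t (x' t) (y' t))
                  + 2 * (y t - y' t) * (F2 t (x t) (y t) - F2 t (x' t) (y' t))).
assert (Hde : forall r, 0 < r -> is_derive e r (de r)).
{ intros r Hr; destruct (HS r Hr) as [D1 D2]; destruct (HS' r Hr) as [D3 D4].
  unfold e, de; auto_derive.
  - repeat split; eexists; eassumption.
  - rewrite (Derive_eq _ _ _ D1), (Derive_eq _ _ _ D2),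
      (Derive_eq _ _ _ D3), (Derive_eq _ _ _ D4); ring. }
assert (Hbound : forall r, a <= r <= b -> Rabs (de r) <= 4 * L * e r).
{ intros r Hr; specialize (H1 r (x r) (y r) (x' r) (y' r) Hr); specialize (H2 r (x r) (y r) (x' r) (y' r) Hr).
  unfold de, e.
  rewrite <- (pow2_abs (x r - x' r)), <- (pow2_abs (y r - y' r)).
  eapply Rle_trans; [apply Rabs_triang |]; rewrite !Rabs_mult, (Rabs_pos_eq 2) by lra.
  revert H1 H2; generalize (Rabs_pos (x r - x' r)) (Rabs_pos (y r - y' r)).
  set (X := Rabs (x r - x' r)); set (Y := Rabs (y r - y' r)).
  set (U := Rabs (F1 _ _ _ - _)); set (V := Rabs (F2 _ _ _ - _)); intros HX HY HU HV.
  assert (2 * X * U <= 2 * X * (L * (X + Y))) by scale.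
  assert (2 * Y * V <= 2 * Y * (L * (X + Y))) by scale.
  assert (0 <= L * (X - Y) ^ 2) by (apply Rmult_le_pos; [lra | apply pow2_ge_0]); nra. }
(* For sg = 1 this says that e exp(4 L r) increases (used when t < s), for sg = -1 that e exp(-4 L
   r) decreases (used when s <= t). *)
assert (Hmono : forall sg, sg = 1 \/ sg = -1 -> forall r1 r2, a <= r1 -> r1 <= r2 -> r2 <= b ->
  sg * (e r1 * exp (sg * (4 * L) * r1)) <= sg * (e r2 * exp (sg * (4 * L) * r2))).
{ intros sg Hsg r1 r2 Hr1 Hr Hr2.
  assert (Hd : forall r, a <= r <= b -> is_derive (fun r => sg * (e r * exp (sg * (4 * L) * r))) r
     (sg * exp (sg * (4 * L) * r) * (de r + sg * (4 * L) * e r))).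
  { intros r Hr'; specialize (Hde r ltac:(lra)); auto_derive; [eexists; eassumption |].
    rewrite (Derive_eq _ _ _ Hde); ring. }
  apply (derive_nonneg_le (fun r => sg * (e r * exp (sg * (4 * L) * r)))
    (fun r => sg * exp (sg * (4 * L) * r) * (de r + sg * (4 * L) * e r)) r1 r2 Hr).
  - intros r Hr'; apply Hd; lra.
  - intros r Hr'; eapply is_derive_cont; apply Hd; lra.
  - intros r Hr'; specialize (Hbound r ltac:(lra)); apply Rabs_le_between in Hbound.
    pose proof (exp_pos (sg * (4 * L) * r)) as He.
    replace (sg * exp (sg * (4 * L) * r) * (de r + sg * (4 * L) * e r))
      with (exp (sg * (4 * L) * r) * (sg * (de r + sg * (4 * L) * e r))) by ring.
    apply Rmult_le_pos; [lra |]; destruct Hsg as [-> | ->]; lra. }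
assert (He0 : forall r, 0 <= e r) by (intros r; unfold e; pose proof (pow2_ge_0 (x r - x' r)); pose proof (pow2_ge_0 (y r - y' r)); lra).
change (e t <= exp (4 * L * (b - a)) * e s).
destruct (Rle_lt_dec s t) as [Hst | Hst].
- specialize (Hmono (-1) (or_intror eq_refl) s t ltac:(lra) Hst ltac:(lra)).
  assert (Hm : e t * exp (- (4 * L) * t) <= e s * exp (- (4 * L) * s)).
  { replace (- (4 * L)) with (-1 * (4 * L)) by ring; lra. }
  apply exp_move in Hm; eapply Rle_trans; [exact Hm |].
  apply Rmult_le_compat_r; [apply He0 |]; apply exp_le_mono; nra.
- specialize (Hmono 1 (or_introl eq_refl) t s ltac:(lra) ltac:(lra) ltac:(lra)).
  assert (Hm : e t * exp ((4 * L) * t) <= e s * exp ((4 * L) * s)).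
  { replace (4 * L) with (1 * (4 * L)) by ring; lra. }
  apply exp_move in Hm; eapply Rle_trans; [exact Hm |].
  apply Rmult_le_compat_r; [apply He0 |]; apply exp_le_mono; nra.
Qed.

Lemma solution_dependence (F1 F2 : R -> R -> R -> R) (s t e : R) :
  lipschitz_field F1 -> lipschitz_field F2 -> 0 < s -> 0 < t -> 0 < e ->
  exists d, 0 < d /\ forall x y x' y', is_solution F1 F2 x y -> is_solution F1 F2 x' y' ->
    Rabs (x s - x' s) < d -> Rabs (y s - y' s) < d -> Rabs (x t - x' t) < e.
Proof.
intros L1 L2 Hs Ht He.
pose proof (Rmin_l s t); pose proof (Rmin_r s t); pose proof (Rmax_l s t); pose proof (Rmax_r s t).
destruct (solution_distance F1 F2 (Rmin s t) (Rmax s t) L1 L2) as [C [HC Hd]].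
{ apply Rmin_glb_lt; assumption. }
{ lra. }
set (d := e / (1 + 2 * C)).
assert (Hd0 : 0 < d) by pos.
exists d; split; [exact Hd0 |]; intros x y x' y' HS HS' Hx Hy.
specialize (Hd x y x' y' HS HS' s t ltac:(lra) ltac:(lra)).
assert (Hed : e = d * (1 + 2 * C)) by (unfold d; field; lra).
apply Rsqr_incrst_0; [| apply Rabs_pos | lra].
rewrite <- Rsqr_abs, Rsqr_pow2, Rsqr_pow2.
assert ((x s - x' s) ^ 2 < d ^ 2) by (rewrite <- (pow2_abs (x s - x' s)); pose proof (Rabs_pos (x s - x' s)); nra).
assert ((y s - y' s) ^ 2 < d ^ 2) by (rewrite <- (pow2_abs (y s - y' s)); pose proof (Rabs_pos (y s - y' s)); nra).
pose proof (pow2_ge_0 (y t - y' t)).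
rewrite Hed; assert (0 < d ^ 2) by nra.
assert (C * ((x s - x' s) ^ 2 + (y s - y' s) ^ 2) <= C * (2 * d ^ 2)) by scale.
assert (C * (2 * d ^ 2) < (d * (1 + 2 * C)) ^ 2) by nra; lra.
Qed.

Lemma cluster_point (u : nat -> R) (M : R) :
  (forall n, Rabs (u n) <= M) ->
  exists x, forall e N, 0 < e -> exists n, (N <= n)%nat /\ Rabs (u n - x) < e.
Proof.
intros Hb; destruct (Bolzano_Weierstrass u (fun r => - M <= r <= M)) as [x Hx].
- apply compact_P3.
- intros n; apply Rabs_le_between, Hb.
- exists x; intros e N He.
  destruct (Hx (fun r => Rabs (r - x) < e) N) as [n [Hn1 Hn2]].
  + exists (mkposreal e He); intros r Hr; exact Hr.
  + exists n; split; assumption.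
Qed.

(** Indices g k with u (g k) within 1/(k+1) of a cluster point x are fixed; then a cluster point of
    v along g is taken. It is enough that the pair (x, y) be approached at arbitrarily late
    indices. *)
Lemma cluster_pair (u v : nat -> R) (M : R) :
  (forall n, Rabs (u n) <= M) -> (forall n, Rabs (v n) <= M) ->
  exists x y, forall e N, 0 < e ->
    exists n, (N <= n)%nat /\ Rabs (u n - x) < e /\ Rabs (v n - y) < e.
Proof.
intros Hu Hv; destruct (cluster_point u M Hu) as [x Hx].
assert (Hc : forall k : nat, exists n, (k <= n)%nat /\ Rabs (u n - x) < / (INR k + 1)).
{ intros k; apply Hx, Rinv_0_lt_compat; pose proof (pos_INR k); lra. }
apply function_choice in Hc; destruct Hc as [g Hg].
destruct (cluster_point (fun k => v (g k)) M) as [y Hy]; [intros; apply Hv |].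
exists x, y; intros e N He.
destruct (nfloor_ex (/ e)) as [K HK]; [left; apply Rinv_0_lt_compat, He |].
destruct (Hy e (Nat.max N K) He) as [k [Hk1 Hk2]].
destruct (Hg k) as [Hg1 Hg2]; exists (g k); split; [lia | split; [| exact Hk2]].
eapply Rlt_le_trans; [exact Hg2 |].
rewrite <- (Rinv_inv e); apply Rinv_le_contravar; [apply Rinv_0_lt_compat, He |].
assert (INR K <= INR k) by (apply le_INR; lia); lra.
Qed.

(** * Shooting between two barriers *)

Definition clip (lo hi x : R) : R := Rmax lo (Rmin hi x).

Lemma clip_range lo hi x : lo <= hi -> lo <= clip lo hi x <= hi.
Proof.
intros H; unfold clip; split; [apply Rmax_l |].
apply Rmax_lub; [exact H | apply Rmin_l].
Qed.
Lemma clip_id lo hi x : lo <= x <= hi -> clip lo hi x = x.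
Proof. intros H; unfold clip; rewrite Rmin_right, Rmax_right; lra. Qed.

Lemma clip_above lo hi x : lo <= hi -> hi <= x -> clip lo hi x = hi.
Proof. intros H H'; unfold clip; rewrite Rmin_left, Rmax_right; lra. Qed.

Lemma clip_below lo hi x : lo <= hi -> x <= lo -> clip lo hi x = lo.
Proof. intros H H'; unfold clip; rewrite Rmin_right, Rmax_left; lra. Qed.

Lemma Rmax_Rmin_lipschitz a b a' b' :
  Rabs (Rmax a b - Rmax a' b') <= Rabs (a - a') + Rabs (b - b') /\
  Rabs (Rmin a b - Rmin a' b') <= Rabs (a - a') + Rabs (b - b').
Proof.
unfold Rmax, Rmin; destruct (Rle_dec a b); destruct (Rle_dec a' b'); split;
unfold Rabs; repeat match goal with |- context [Rcase_abs ?a] => destruct (Rcase_abs a) end; lra.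
Qed.

Lemma clip_lipschitz3 lo hi x lo' hi' x' :
  Rabs (clip lo hi x - clip lo' hi' x') <= Rabs (lo - lo') + Rabs (hi - hi') + Rabs (x - x').
Proof.
unfold clip.
pose proof (proj1 (Rmax_Rmin_lipschitz lo (Rmin hi x) lo' (Rmin hi' x'))).
pose proof (proj2 (Rmax_Rmin_lipschitz hi x hi' x')); lra.
Qed.

Lemma clip_lipschitz lo hi x y : Rabs (clip lo hi x - clip lo hi y) <= Rabs (x - y).
Proof. pose proof (clip_lipschitz3 lo hi x lo hi y) as H; rewrite !Rminus_diag, Rabs_R0 in H; lra. Qed.

Lemma clip_continuous (lo hi x : R -> R) t :
  continuous lo t -> continuous hi t -> continuous x t ->
  continuous (fun s => clip (lo s) (hi s) (x s)) t.
Proof.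
intros Hl Hh Hx; apply filterlim_locally; intros e.
assert (He : 0 < e / 3) by (pose proof (cond_pos e); lra).
pose proof (proj1 (filterlim_locally _ _) Hl (mkposreal _ He)) as H1.
pose proof (proj1 (filterlim_locally _ _) Hh (mkposreal _ He)) as H2.
pose proof (proj1 (filterlim_locally _ _) Hx (mkposreal _ He)) as H3.
generalize (filter_and _ _ H1 (filter_and _ _ H2 H3)); apply filter_imp.
intros s [K1 [K2 K3]].
change (Rabs (lo s - lo t) < e / 3) in K1; change (Rabs (hi s - hi t) < e / 3) in K2.
change (Rabs (x s - x t) < e / 3) in K3.
change (Rabs (clip (lo s) (hi s) (x s) - clip (lo t) (hi t) (x t)) < e).
pose proof (clip_lipschitz3 (lo s) (hi s) (x s) (lo t) (hi t) (x t)); lra.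
Qed.

(** Regularity is asked only inside the strip: the powers of h in the equation are regular only away
    from 0, and the strip will have a positive lower edge. *)
Definition continuous_between (lo hi : R -> R) (G : R -> R -> R) : Prop :=
  forall (x : R -> R) t, 0 < t -> continuous x t -> (forall s, 0 < s -> lo s <= x s <= hi s) ->
    continuous (fun s => G s (x s)) t.

Definition lipschitz_between (lo hi : R -> R) (G : R -> R -> R) : Prop :=
  forall a b, 0 < a -> a <= b -> exists L, 0 < L /\
    forall t x y, a <= t <= b -> lo t <= x <= hi t -> lo t <= y <= hi t ->
      Rabs (G t x - G t y) <= L * Rabs (x - y).

(** Only [x] is clipped. The system is linear in the momentum [y], so this already makes it globally
    Lipschitz, and large momenta keep their full effect, which shooting needs. *)
Definition trunc1 (lo hi phi : R -> R) (Gam : R -> R -> R) (t x y : R) : R :=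
  phi t * y + Gam t (clip (lo t) (hi t) x).

Definition trunc2 (lo hi : R -> R) (Psi : R -> R -> R) (t x _y : R) : R :=
  Psi t (clip (lo t) (hi t) x).

(** * Shooting for the truncated system, and passage to the whole half-line *)

Section Shooting.

Variables (lo hi phi : R -> R) (Gam Psi : R -> R -> R).
Hypothesis lohi : forall t, 0 < t -> lo t <= hi t.
Hypothesis lo_cont : forall t, 0 < t -> continuous lo t.
Hypothesis hi_cont : forall t, 0 < t -> continuous hi t.
Hypothesis phi_cont : forall t, 0 < t -> continuous phi t.
Hypothesis phi_pos : forall t, 0 < t -> 0 < phi t.
Hypotheses (Gam_cont : continuous_between lo hi Gam) (Psi_cont : continuous_between lo hi Psi).
Hypotheses (Gam_lip : lipschitz_between lo hi Gam) (Psi_lip : lipschitz_between lo hi Psi).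

Let F1 := trunc1 lo hi phi Gam.
Let F2 := trunc2 lo hi Psi.

Hypothesis exit_above : forall x y, is_solution F1 F2 x y ->
  forall t0 t1 t2, 0 < t0 -> t0 < t1 -> t1 <= t2 -> x t0 <= hi t0 -> hi t1 < x t1 -> hi t2 < x t2.
Hypothesis exit_below : forall x y, is_solution F1 F2 x y ->
  forall t0 t1 t2, 0 < t0 -> t0 < t1 -> t1 <= t2 -> lo t0 <= x t0 -> x t1 < lo t1 -> x t2 < lo t2.

Lemma clipped_continuous (G : R -> R -> R) (x : R -> R) t :
  continuous_between lo hi G -> 0 < t -> continuous x t ->
  continuous (fun s => G s (clip (lo s) (hi s) (x s))) t.
Proof.
intros HG Ht Hx; apply (HG (fun s => clip (lo s) (hi s) (x s)) t Ht).
- apply clip_continuous; [apply lo_cont, Ht | apply hi_cont, Ht | exact Hx].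
- intros s Hs; apply clip_range, lohi, Hs.
Qed.

Lemma clipped_bounded (G : R -> R -> R) a b :
  continuous_between lo hi G -> lipschitz_between lo hi G -> 0 < a -> a <= b ->
  exists M, 0 < M /\ forall t x, a <= t <= b -> Rabs (G t (clip (lo t) (hi t) x)) <= M.
Proof.
intros Gc Gl Ha Hab.
destruct (continuous_bounded (fun t => G t (clip (lo t) (hi t) (lo t))) a b Hab) as [M1 [HM1 B1]].
{ intros t Ht; apply clipped_continuous; [exact Gc | lra | apply lo_cont; lra]. }
destruct (continuous_bounded lo a b Hab) as [M2 [HM2 B2]]; [intros t Ht; apply lo_cont; lra |].
destruct (continuous_bounded hi a b Hab) as [M3 [HM3 B3]]; [intros t Ht; apply hi_cont; lra |].
destruct (Gl a b Ha Hab) as [L [HL BL]].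
exists (M1 + L * (M2 + M3)); split; [nra |]; intros t x Ht.
pose proof (lohi t ltac:(lra)) as Hlh.
pose proof (clip_range (lo t) (hi t) x Hlh) as R1; pose proof (clip_range (lo t) (hi t) (lo t) Hlh) as R2.
specialize (B1 t Ht); specialize (B2 t Ht); specialize (B3 t Ht); specialize (BL t _ _ Ht R1 R2).
set (u := G t (clip (lo t) (hi t) x)) in *; set (v := G t (clip (lo t) (hi t) (lo t))) in *.
assert (Hd : Rabs (clip (lo t) (hi t) x - clip (lo t) (hi t) (lo t)) <= M2 + M3).
{ apply Rabs_le_between in B2; apply Rabs_le_between in B3; apply Rabs_le; lra. }
replace u with ((u - v) + v) by ring; eapply Rle_trans; [apply Rabs_triang |].
assert (L * Rabs (clip (lo t) (hi t) x - clip (lo t) (hi t) (lo t)) <= L * (M2 + M3))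
  by scale; lra.
Qed.

Lemma trunc1_continuous : continuous_field F1.
Proof.
intros x y t Ht Hx Hy; unfold F1, trunc1.
apply (continuous_Rplus (fun s => phi s * y s)).
- apply (continuous_Rmult); [apply phi_cont, Ht | exact Hy].
- apply clipped_continuous; assumption.
Qed.
Lemma trunc2_continuous : continuous_field F2.
Proof. intros x y t Ht Hx Hy; apply clipped_continuous; assumption. Qed.

Lemma clipped_lipschitz (G : R -> R -> R) a b : lipschitz_between lo hi G -> 0 < a -> a <= b ->
  exists L, 0 < L /\ forall t x y, a <= t <= b ->
    Rabs (G t (clip (lo t) (hi t) x) - G t (clip (lo t) (hi t) y)) <= L * Rabs (x - y).
Proof.
intros Gl Ha Hab; destruct (Gl a b Ha Hab) as [L [HL BL]]; exists L; split; [exact HL |].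
intros t x y Ht; pose proof (lohi t ltac:(lra)) as Hlh.
eapply Rle_trans; [apply BL; [exact Ht | apply clip_range, Hlh | apply clip_range, Hlh] |].
apply Rmult_le_compat_l; [lra | apply clip_lipschitz].
Qed.

Lemma trunc1_lipschitz : lipschitz_field F1.
Proof.
intros a b Ha Hab; destruct (clipped_lipschitz Gam a b Gam_lip Ha Hab) as [L [HL BL]].
destruct (continuous_bounded phi a b Hab) as [M [HM B]]; [intros t Ht; apply phi_cont; lra |].
exists (L + M); split; [lra |]; intros t x y x' y' Ht; specialize (BL t x x' Ht); specialize (B t Ht).
unfold F1, trunc1; match goal with |- Rabs (?p * ?u + ?v - (?p * ?w + ?z)) <= _ =>
  replace (p * u + v - (p * w + z)) with (p * (u - w) + (v - z)) by ring end.
eapply Rle_trans; [apply Rabs_triang |]; rewrite Rabs_mult.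
pose proof (Rabs_pos (x - x')); pose proof (Rabs_pos (y - y')); nra.
Qed.

Lemma trunc2_lipschitz : lipschitz_field F2.
Proof.
intros a b Ha Hab; destruct (clipped_lipschitz Psi a b Psi_lip Ha Hab) as [L [HL BL]].
exists L; split; [lra |]; intros t x y x' y' Ht; specialize (BL t x x' Ht).
unfold F2, trunc2; pose proof (Rabs_pos (y - y')); nra.
Qed.

Lemma solution_through t0 x0 y0 : 0 < t0 ->
  exists x y, is_solution F1 F2 x y /\ x t0 = x0 /\ y t0 = y0.
Proof.
intros Ht; apply picard_lindelof; [apply trunc1_continuous | apply trunc2_continuous
  | apply trunc1_lipschitz | apply trunc2_lipschitz | exact Ht].
Qed.

(** Every term except phi y is bounded on [a, b], and y itself varies by a bounded amount. Hence
    x(b) = x(a) + y(a) c + O(1) with c the integral of phi over [a, b], uniformly over all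
    solutions. *)
Lemma shooting_growth a b : 0 < a -> a < b -> exists c C, 0 < c /\ 0 < C /\
  forall x y, is_solution F1 F2 x y -> Rabs (x b - x a - c * y a) <= C.
Proof.
intros Ha Hab.
destruct (clipped_bounded Gam a b Gam_cont Gam_lip Ha ltac:(lra)) as [M1 [HM1 B1]].
destruct (clipped_bounded Psi a b Psi_cont Psi_lip Ha ltac:(lra)) as [M2 [HM2 B2]].
destruct (continuous_bounded phi a b ltac:(lra)) as [M3 [HM3 B3]]; [intros t Ht; apply phi_cont; lra |].
set (Phi := (fun t => RInt phi a t) : R -> R).
assert (HPhi : forall t, a <= t -> is_derive Phi t (phi t)).
{ intros t Ht; apply is_derive_RInt_pos; [lra | lra | exact phi_cont]. }
assert (HPhia : Phi a = 0) by (apply (RInt_point (V := R_CompleteNormedModule))).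
destruct (mvt_closed Phi phi a b Hab) as [r [Hr1 Hr2]]; [intros t Ht; apply HPhi; lra |].
exists (Phi b), ((M3 * (M2 * (b - a)) + M1) * (b - a)).
assert (Hr : 0 < phi r) by (apply phi_pos; lra).
split; [nra |]; split.
{ apply Rmult_lt_0_compat; [| lra]; assert (0 < M2 * (b - a)) by nra; nra. }
intros x y HS.
assert (Hy : forall t, a <= t <= b -> Rabs (y t - y a) <= M2 * (b - a)).
{ intros t Ht; destruct (Req_dec a t) as [<- | Hne].
  { rewrite Rminus_diag, Rabs_R0; nra. }
  destruct (mvt_closed y (fun t => F2 t (x t) (y t)) a t) as [s [Hs1 Hs2]]; [lra | |].
  { intros u Hu; apply HS; lra. }
  rewrite Hs2, Rabs_mult, (Rabs_pos_eq (t - a)) by lra.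
  apply Rmult_le_compat; [apply Rabs_pos | lra | apply B2; lra | lra]. }
set (u := fun t => x t - y a * Phi t).
destruct (mvt_closed u (fun t => F1 t (x t) (y t) - y a * phi t) a b Hab) as [s [Hs1 Hs2]].
{ intros t Ht; destruct (HS t ltac:(lra)) as [D1 _]; pose proof (HPhi t ltac:(lra)) as D2.
  apply (is_derive_Rminus x (fun t => y a * Phi t)); [exact D1 |].
  apply (is_derive_scal Phi t (y a) (phi t)), D2. }
replace (x b - x a - Phi b * y a) with (u b - u a) by (unfold u; rewrite HPhia; ring).
rewrite Hs2, Rabs_mult, (Rabs_pos_eq (b - a)) by lra.
apply Rmult_le_compat_r; [lra |]; unfold F1, trunc1.
match goal with |- Rabs (?p * ?y1 + ?v - ?y2 * ?p) <= _ => replace (p * y1 + v - y2 * p) with (p * (y1 - y2) + v) by ring end.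
eapply Rle_trans; [apply Rabs_triang |]; rewrite Rabs_mult.
apply Rplus_le_compat; [| apply B1; exact Hs1].
apply Rmult_le_compat; [apply Rabs_pos | apply Rabs_pos | apply B3; exact Hs1 | apply Hy; exact Hs1].
Qed.

(** A large initial momentum forces an exit on the corresponding side. This bounds the set of
    shooting parameters, and, read backwards, bounds the momentum of every solution that stays in
    the strip, which gives compactness. *)
Lemma shooting_bound a b : 0 < a -> a < b -> exists C, 0 < C /\
  forall x y, is_solution F1 F2 x y -> lo a <= x a <= hi a ->
    (C < y a -> hi b < x b) /\ (y a < - C -> x b < lo b).
Proof.
intros Ha Hab; destruct (shooting_growth a b Ha Hab) as [c [C [Hc [HC HG]]]].
set (K := Rabs (hi b) + Rabs (lo b) + Rabs (hi a) + Rabs (lo a) + C).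
pose proof (Rabs_pos (hi b)); pose proof (Rabs_pos (lo b)); pose proof (Rabs_pos (hi a)); pose proof (Rabs_pos (lo a)).
assert (HK : 0 < K) by (unfold K; lra).
exists (K / c); split; [pos |].
intros x y HS Hx; specialize (HG x y HS); apply Rabs_le_between in HG.
pose proof (Rle_abs (hi b)); pose proof (Rle_abs (- lo a)) as A1; rewrite Rabs_Ropp in A1.
pose proof (Rle_abs (hi a)); pose proof (Rle_abs (- lo b)) as A2; rewrite Rabs_Ropp in A2.
split; intros Hy; apply (Rmult_lt_compat_l c) in Hy; try exact Hc.
- replace (c * (K / c)) with K in Hy by (field; lra); unfold K in Hy; lra.
- replace (c * - (K / c)) with (- K) in Hy by (field; lra); unfold K in Hy; lra.
Qed.

Lemma not_both_exits x y t0 t1 t2 : is_solution F1 F2 x y -> 0 < t0 -> t0 < t1 -> t0 < t2 ->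
  lo t0 <= x t0 <= hi t0 -> hi t1 < x t1 -> x t2 < lo t2 -> False.
Proof.
intros HS H0 H1 H2 Hx Ha Hb; destruct (Rle_lt_dec t1 t2) as [H | H].
- pose proof (exit_above x y HS t0 t1 t2 H0 H1 H ltac:(lra) Ha); pose proof (lohi t2 ltac:(lra)); lra.
- pose proof (exit_below x y HS t0 t2 t1 H0 H2 ltac:(lra) ltac:(lra) Hb); pose proof (lohi t1 ltac:(lra)); lra.
Qed.

Lemma solution_from t0 : 0 < t0 ->
  exists x y, is_solution F1 F2 x y /\ forall t, t0 <= t -> lo t <= x t <= hi t.
Proof.
intros H0; pose proof (lohi t0 H0) as Hlh.
destruct (shooting_bound t0 (t0 + 1) H0 ltac:(lra)) as [C [HC Hsh]].
(* E collects the initial momenta whose solution leaves through the lower barrier; the critical one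
   is its supremum q. Leaving is stable under small perturbations: if the solution for q left below,
   so would the one for q + d/2, against the upper bound; if it left above, so would one with
   momentum in E, which also leaves below, against [not_both_exits]. *)
set (E := fun q => exists x y t, is_solution F1 F2 x y /\ x t0 = lo t0 /\ y t0 = q /\ t0 < t /\ x t < lo t).
destruct (completeness E) as [q [Hq1 Hq2]].
{ exists C; intros r (x & y & t & HS & Hx & Hy & Ht & Hl).
  apply Rnot_lt_le; intros Hr.
  apply (not_both_exits x y t0 (t0 + 1) t HS); try lra.
  apply (Hsh x y HS); lra. }
{ exists (- C - 1); destruct (solution_through t0 (lo t0) (- C - 1) H0) as (x & y & HS & Hx & Hy).
  exists x, y, (t0 + 1); split; [exact HS |]; repeat split; try assumption; try lra.
  apply (Hsh x y HS); lra. }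
destruct (solution_through t0 (lo t0) q H0) as (x & y & HS & Hx & Hy).
assert (Hd : forall t e, t0 < t -> 0 < e -> exists d, 0 < d /\ forall x' y', is_solution F1 F2 x' y' ->
   x' t0 = lo t0 -> Rabs (q - y' t0) < d -> Rabs (x t - x' t) < e).
{ intros t e Ht He; destruct (solution_dependence F1 F2 t0 t e trunc1_lipschitz trunc2_lipschitz H0 ltac:(lra) He) as [d [Hd0 Hd]].
  exists d; split; [exact Hd0 |]; intros x' y' HS' Hx' Hy'; apply (Hd x y x' y' HS HS').
  - rewrite Hx, Hx', Rminus_diag, Rabs_R0; exact Hd0.
  - rewrite Hy; exact Hy'. }
exists x, y; split; [exact HS |]; intros t Ht.
destruct (Req_dec t0 t) as [<- | Hne]; [lra |].
split; apply Rnot_lt_le; intros Hout.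
- destruct (Hd t (lo t - x t) ltac:(lra) ltac:(lra)) as [d [Hd0 Hd1]].
  assert (E (q + d / 2)); [| assert (q + d / 2 <= q) by (apply Hq1; assumption); lra].
  destruct (solution_through t0 (lo t0) (q + d / 2) H0) as (x' & y' & HS' & Hx' & Hy').
  exists x', y', t; split; [exact HS' |]; repeat split; try assumption; try lra.
  specialize (Hd1 x' y' HS' Hx'); rewrite Hy' in Hd1.
  assert (Hq : Rabs (q - (q + d / 2)) < d) by (apply Rabs_def1; lra).
  specialize (Hd1 Hq); apply Rabs_def2 in Hd1; lra.
- destruct (Hd t (x t - hi t) ltac:(lra) ltac:(lra)) as [d [Hd0 Hd1]].
  assert (Hex : exists r, E r /\ q - d < r).
  { apply NNPP; intros Hn; assert (q <= q - d); [| lra].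
    apply Hq2; intros r Hr; apply Rnot_lt_le; intros Hlt; apply Hn; exists r; split; assumption. }
  destruct Hex as [r [Hr Hqr]].
  assert (r <= q) by (apply Hq1; exact Hr).
  destruct Hr as (x' & y' & t' & HS' & Hx' & Hy' & Ht' & Hl').
  specialize (Hd1 x' y' HS' Hx'); rewrite Hy' in Hd1.
  assert (Hq : Rabs (q - r) < d) by (apply Rabs_def1; lra).
  specialize (Hd1 Hq); apply Rabs_def2 in Hd1.
  apply (not_both_exits x' y' t0 t t' HS'); lra.
Qed.

Theorem solution_between :
  exists x y, (forall t, 0 < t -> lo t <= x t <= hi t) /\
    forall t, 0 < t -> is_derive x t (phi t * y t + Gam t (x t)) /\ is_derive y t (Psi t (x t)).
Proof.
assert (Hn : forall n : nat, exists p : (R -> R) * (R -> R), is_solution F1 F2 (fst p) (snd p) /\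
   forall t, / (INR n + 1) <= t -> lo t <= fst p t <= hi t).
{ intros n; destruct (solution_from (/ (INR n + 1))) as (x & y & H).
  { apply Rinv_0_lt_compat; pose proof (pos_INR n); lra. }
  exists (x, y); exact H. }
apply function_choice in Hn; destruct Hn as [S HS].
assert (Hone : forall n : nat, / (INR n + 1) <= 1).
{ intros n; rewrite <- Rinv_1 at 2; apply Rinv_le_contravar; pose proof (pos_INR n); lra. }
(* All approximate solutions are in the strip at times 1 and 2, since 1/(n+1) <= 1; their momenta at
   time 1 are therefore bounded independently of n. *)
destruct (shooting_bound 1 2 ltac:(lra) ltac:(lra)) as [C [HC Hsh]].
destruct (cluster_pair (fun n => fst (S n) 1) (fun n => snd (S n) 1) (C + Rabs (lo 1) + Rabs (hi 1))) as (x0 & y0 & Hcl).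
{ intros n; destruct (HS n) as [_ Hb]; specialize (Hb 1 (Hone n)).
  pose proof (Rle_abs (hi 1)); pose proof (Rle_abs (- lo 1)) as H2; rewrite Rabs_Ropp in H2.
  pose proof (Rabs_pos (lo 1)); pose proof (Rabs_pos (hi 1)).
  apply Rabs_le; lra. }
{ intros n; destruct (HS n) as [Hsol Hb]; pose proof (Hb 1 (Hone n)) as Hb1.
  specialize (Hone n); specialize (Hb 2 ltac:(lra)).
  destruct (Hsh _ _ Hsol Hb1) as [K1 K2].
  pose proof (Rabs_pos (lo 1)); pose proof (Rabs_pos (hi 1)).
  apply Rabs_le; split; apply Rnot_lt_le; intros Hlt; [specialize (K2 ltac:(lra)) | specialize (K1 ltac:(lra))]; lra. }
destruct (solution_through 1 x0 y0 ltac:(lra)) as (x & y & Hsol & Hx & Hy).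
assert (Hb : forall t, 0 < t -> lo t <= x t <= hi t).
{ intros t Ht.
  assert (Happ : forall e, 0 < e -> exists n, / (INR n + 1) <= t /\ Rabs (x t - fst (S n) t) < e).
  { intros e He.
    destruct (solution_dependence F1 F2 1 t e trunc1_lipschitz trunc2_lipschitz ltac:(lra) Ht He) as [d [Hd0 Hd]].
    destruct (nfloor_ex (/ t)) as [N HN]; [left; apply Rinv_0_lt_compat, Ht |].
    destruct (Hcl d N Hd0) as (n & Hn & K1 & K2).
    exists n; split.
    - rewrite <- (Rinv_inv t); apply Rinv_le_contravar; [apply Rinv_0_lt_compat, Ht |].
      apply le_INR in Hn; lra.
    - destruct (HS n) as [HSn _]; apply (Hd _ _ _ _ Hsol HSn).
      + rewrite Hx, Rabs_minus_sym; exact K1.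
      + rewrite Hy, Rabs_minus_sym; exact K2. }
  split; apply Rnot_lt_le; intros Hlt.
  - destruct (Happ (lo t - x t) ltac:(lra)) as (n & Hn & K); destruct (HS n) as [_ Hb]; specialize (Hb t Hn).
    apply Rabs_def2 in K; lra.
  - destruct (Happ (x t - hi t) ltac:(lra)) as (n & Hn & K); destruct (HS n) as [_ Hb]; specialize (Hb t Hn).
    apply Rabs_def2 in K; lra. }
exists x, y; split; [exact Hb |]; intros t Ht; destruct (Hsol t Ht) as [D1 D2].
(* Inside the strip [clip] is the identity, so the truncation disappears. *)
unfold F1, F2, trunc1, trunc2 in D1, D2; rewrite clip_id in D1, D2 by (apply Hb, Ht).
split; assumption.
Qed.

End Shooting.

(* A solution above the barrier whose momentum exceeds that of the barrier
   stays so, and crossing the barrier upwards forces this situation. *)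
Definition trap (A : R -> Prop) (G XG x y : R -> R) : Prop :=
  (forall t0 t2, A t0 -> A t2 -> t0 <= t2 -> G t0 < x t0 -> XG t0 < y t0 ->
     G t2 < x t2 /\ XG t2 < y t2) /\
  (forall t0 t1, A t0 -> A t1 -> t0 < t1 -> x t0 <= G t0 -> G t1 < x t1 -> XG t1 < y t1).

(** Where x >= G both curves obey the same law with the same frozen terms c and p. So v = x - G
    satisfies v' = phi D with D = y - XG, and D' = p - dX >= 0. Positive v and D therefore persist;
    and v can pass from nonpositive to positive only if D > 0 somewhere after its last zero, hence
    at the end too. *)
Lemma trap_piece (A : R -> Prop) (phi c p G XG dX x y : R -> R) :
  (forall a b t, A a -> A b -> a <= t <= b -> A t) ->
  (forall t, A t -> 0 < phi t) ->
  (forall t, A t -> is_derive G t (phi t * XG t + c t)) ->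
  (forall t, A t -> is_derive XG t (dX t) /\ dX t <= p t) ->
  (forall t, A t -> continuous x t) ->
  (forall t, A t -> G t <= x t -> is_derive x t (phi t * y t + c t) /\ is_derive y t (p t)) ->
  trap A G XG x y.
Proof.
intros HA Hphi HG HXG Hxc Hxy.
set (v := fun t => x t - G t); set (D := fun t => y t - XG t).
assert (Hv : forall t, A t -> 0 <= v t -> is_derive v t (phi t * D t)).
{ intros t Ht Hvt; destruct (Hxy t Ht ltac:(unfold v in Hvt; lra)) as [D1 _].
  replace (phi t * D t) with (minus (phi t * y t + c t) (phi t * XG t + c t)) by (unfold minus, plus, opp, D; simpl; ring).
  apply (is_derive_Rminus x G); [exact D1 | apply HG, Ht]. }
assert (HD : forall t, A t -> 0 <= v t -> is_derive D t (p t - dX t)).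
{ intros t Ht Hvt; destruct (Hxy t Ht ltac:(unfold v in Hvt; lra)) as [_ D2].
  apply (is_derive_Rminus y XG); [exact D2 | apply HXG, Ht]. }
assert (Hmono : forall a b, A a -> A b -> a <= b -> (forall t, a <= t <= b -> 0 <= v t) -> D a <= D b).
{ intros a b Ha Hb Hab Hpos; apply (derive_nonneg_le D (fun t => p t - dX t) a b Hab).
  - intros t Ht; apply HD; [apply (HA a b) | apply Hpos]; try assumption; lra.
  - intros t Ht; eapply is_derive_cont, HD; [apply (HA a b) | apply Hpos]; try assumption; lra.
  - intros t Ht; destruct (HXG t ltac:(apply (HA a b); try assumption; lra)); lra. }
assert (Hvc : forall t, A t -> continuous v t).
{ intros t Ht; apply (continuous_Rminus x G); [apply Hxc, Ht |].
  eapply is_derive_cont, HG, Ht. }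
assert (Hstay : forall t0 t2, A t0 -> A t2 -> t0 <= t2 -> 0 < v t0 -> 0 < D t0 -> 0 < v t2).
{ intros t0 t2 H0 H2 H02 Hv0 HD0; apply Rnot_le_lt; intros Hn.
  assert (HA' : forall t, t0 <= t <= t2 -> A t) by (intros t Ht; apply (HA t0 t2); assumption).
  destruct (first_zero v t0 t2 H02) as (z & Hz & Hvz & Hpos); [intros t Ht; apply Hvc, HA', Ht | exact Hv0 | exact Hn |].
  assert (Hpos' : forall t, t0 <= t <= z -> 0 <= v t).
  { intros t Ht; destruct (Req_dec t z) as [-> | Hne]; [lra | left; apply Hpos; lra]. }
  assert (v t0 <= v z); [| lra].
  apply (derive_nonneg_le v (fun t => phi t * D t) t0 z); [lra | | |].
  - intros t Ht; apply Hv; [apply HA' | apply Hpos']; lra.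
  - intros t Ht; apply Hvc, HA'; lra.
  - intros t Ht; apply Rmult_le_pos; [left; apply Hphi, HA'; lra |].
    assert (D t0 <= D t); [| lra]; apply Hmono; [exact H0 | apply HA'; lra | lra |].
    intros s Hs; apply Hpos'; lra. }
split.
- intros t0 t2 H0 H2 H02 Hv0 HD0.
  assert (Hpos : forall t, t0 <= t <= t2 -> 0 < v t).
  { intros t Ht; apply (Hstay t0 t); [exact H0 | apply (HA t0 t2); assumption | lra | unfold v; lra | unfold D; lra]. }
  split; [specialize (Hpos t2 ltac:(lra)); unfold v in Hpos; lra |].
  assert (D t0 <= D t2); [| unfold D in *; lra].
  apply Hmono; try assumption; intros t Ht; left; apply Hpos, Ht.
- intros t0 t1 H0 H1 H01 Hv0 Hv1.
  assert (HA' : forall t, t0 <= t <= t1 -> A t) by (intros t Ht; apply (HA t0 t1); assumption).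
  (* Time is reversed: the first zero of s -> v (-s) is minus the last zero of v before t1. *)
  destruct (first_zero (fun s => v (- s)) (- t1) (- t0)) as (z & Hz & Hvz & Hpos).
  + lra.
  + intros s Hs; apply continuous_comp; [apply (continuous_Ropp), continuous_id |].
    apply Hvc, HA'; lra.
  + rewrite Ropp_involutive; unfold v; lra.
  + rewrite Ropp_involutive; unfold v; lra.
  + assert (Hpos' : forall t, - z <= t <= t1 -> 0 <= v t).
    { intros t Ht; replace t with (- - t) by ring; destruct (Req_dec (- t) z) as [-> | Hne]; [lra | left; apply Hpos; lra]. }
    destruct (mvt_closed v (fun t => phi t * D t) (- z) t1) as (r & Hr1 & Hr2); [lra | |].
    { intros t Ht; apply Hv; [apply HA' | apply Hpos']; lra. }
    rewrite Hvz in Hr2; assert (Hvt1 : 0 < v t1) by (unfold v; lra).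
    assert (0 < phi r) by (apply Hphi, HA'; lra).
    assert (0 < D r).
    { apply Rnot_le_lt; intros Hn; assert (phi r * D r <= 0) by nra; nra. }
    assert (D r <= D t1); [| unfold D in *; lra].
    apply Hmono; [apply HA'; lra | apply HA'; lra | lra |]; intros t Ht; apply Hpos'; lra.
Qed.

(** * Gluing barriers along a kink *)

Definition glue (c : R) (u v : R -> R) (t : R) : R := if Rle_dec t c then u t else v t.

Lemma glue_left c u v t : t <= c -> glue c u v t = u t.
Proof. intros H; unfold glue; destruct (Rle_dec t c); [reflexivity | lra]. Qed.

Lemma glue_right c u v t : c < t -> glue c u v t = v t.
Proof. intros H; unfold glue; destruct (Rle_dec t c); [lra | reflexivity]. Qed.

Lemma glue_right_le c u v t : u c = v c -> c <= t -> glue c u v t = v t.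
Proof. intros E [H | <-]; [apply glue_right, H | rewrite glue_left by lra; exact E]. Qed.

Lemma continuous_ext_near (u v : R -> R) t d :
  0 < d -> (forall s, Rabs (s - t) < d -> u s = v s) -> continuous v t -> continuous u t.
Proof.
intros Hd He Hv; apply continuous_ext_loc with v; [| exact Hv].
exists (mkposreal d Hd); intros s Hs; symmetry; apply He, Hs.
Qed.

Lemma glue_continuous c u v t :
  u c = v c -> (t <= c -> continuous u t) -> (c <= t -> continuous v t) -> continuous (glue c u v) t.
Proof.
intros E Hu Hv; destruct (Rtotal_order t c) as [H | [-> | H]].
- apply continuous_ext_near with u (c - t); [lra | | apply Hu; lra].
  intros s Hs; apply Rabs_def2 in Hs; apply glue_left; lra.
- apply filterlim_locally; intros e.
  pose proof (proj1 (filterlim_locally _ _) (Hu (Rle_refl _)) e) as H1.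
  pose proof (proj1 (filterlim_locally _ _) (Hv (Rle_refl _)) e) as H2.
  generalize (filter_and _ _ H1 H2); apply filter_imp; intros s [K1 K2].
  rewrite (glue_left c u v c) by lra; unfold glue; destruct (Rle_dec s c); [exact K1 | rewrite E; exact K2].
- apply continuous_ext_near with v (t - c); [lra | | apply Hv; lra].
  intros s Hs; apply Rabs_def2 in Hs; apply glue_right; lra.
Qed.

(** At the junction the momentum of the barrier may only drop: a solution that was faster than the
    first piece is then also faster than the second. For an upper barrier this is a concave kink,
    for a lower one, taken with reversed signs, a convex kink. *)
Lemma trap_glue (A B : R -> Prop) (c : R) (G1 G2 X1 X2 x y : R -> R) :
  (forall t, A t -> t <= c) -> (forall t, B t -> c <= t) -> A c -> B c ->
  G1 c = G2 c -> X2 c <= X1 c ->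
  trap A G1 X1 x y -> trap B G2 X2 x y ->
  trap (fun t => A t \/ B t) (glue c G1 G2) (glue c X1 X2) x y.
Proof.
intros HA HB Ac Bc EG EX [S1 E1] [S2 E2].
assert (Hcase : forall t, A t \/ B t -> (A t /\ t <= c) \/ (B t /\ c < t)).
{ intros t [H | H]; [left; split; auto |].
  destruct (HB t H) as [H' | <-]; [right; split; assumption | left; split; [exact Ac | lra]]. }
split.
- intros t0 t2 H0 H2 H02.
  destruct (Hcase t0 H0) as [[K0 L0] | [K0 L0]]; destruct (Hcase t2 H2) as [[K2 L2] | [K2 L2]].
  + rewrite !glue_left by assumption; apply S1; assumption.
  + rewrite (glue_left _ _ _ t0), (glue_left _ _ _ t0) by assumption.
    rewrite !glue_right by assumption; intros Hv HD.
    destruct (S1 t0 c K0 Ac L0 Hv HD); apply (S2 c t2 Bc K2); lra.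
  + lra.
  + rewrite !glue_right by assumption; apply S2; assumption.
- intros t0 t1 H0 H1 H01.
  destruct (Hcase t0 H0) as [[K0 L0] | [K0 L0]]; destruct (Hcase t1 H1) as [[K1 L1] | [K1 L1]].
  + rewrite !glue_left by assumption; apply E1; assumption.
  + rewrite (glue_left _ _ _ t0) by assumption; rewrite !glue_right by assumption; intros Hv0 Hv1.
    (* If x is still below the barrier at c, the crossing belongs to the second piece; otherwise it
       happened in the first one, and its momentum inequality is carried over the kink. *)
    destruct (Rle_lt_dec (x c) (G2 c)) as [Hc | Hc]; [apply (E2 c t1); assumption |].
    destruct (Req_dec t0 c) as [-> | Hne]; [lra |].
    assert (X1 c < y c) by (apply (E1 t0 c); try assumption; lra).
    apply (S2 c t1 Bc K1); lra.
  + lra.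
  + rewrite !glue_right by assumption; apply E2; assumption.
Qed.

(** * The transformed equation and its barriers *)

Lemma Rpower_pos x a : 0 < Rpower x a.
Proof. apply exp_pos. Qed.

Lemma is_derive_Rpower (u : R -> R) (t a du : R) :
  0 < u t -> is_derive u t du -> is_derive (fun s => Rpower (u s) a) t (a * Rpower (u t) (a - 1) * du).
Proof.
intros Hu Hd; unfold Rpower at 1; auto_derive.
- split; [eexists; exact Hd | split; [exact Hu | exact I]].
- rewrite (Derive_eq _ _ _ Hd).
  change (exp (a * ln (u t))) with (Rpower (u t) a).
  replace (Rpower (u t) a) with (Rpower (u t) (a - 1) * u t).
  + field; lra.
  + rewrite <- (Rpower_1 (u t)) at 2 by exact Hu; rewrite <- Rpower_plus; f_equal; ring.
Qed.

Lemma is_derive_Rpower_id (t a : R) :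
  0 < t -> is_derive (fun s => Rpower s a) t (a * Rpower t (a - 1)).
Proof.
intros Ht; replace (a * Rpower t (a - 1)) with (a * Rpower t (a - 1) * 1) by ring.
apply (is_derive_Rpower (fun s => s)); [exact Ht | apply (is_derive_id (K := R_AbsRing))].
Qed.
Lemma Rpower_split x a b c : a = b + c -> Rpower x a = Rpower x b * Rpower x c.
Proof. intros ->; apply Rpower_plus. Qed.

Lemma Rpower_2 x : 0 < x -> Rpower x 2 = x * x.
Proof. intros H; replace 2 with (1 + 1) by ring; rewrite Rpower_plus, Rpower_1; auto. Qed.

Lemma Rpower_minus_2 x a : 0 < x -> Rpower x a = Rpower x (a - 2) * (x * x).
Proof. intros H; rewrite <- Rpower_2 by exact H; rewrite <- Rpower_plus; f_equal; ring. Qed.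

Lemma Rpower_m1 x : 0 < x -> Rpower x (-1) = / x.
Proof. intros H; replace (-1) with (Ropp 1) by lra; rewrite Rpower_Ropp, Rpower_1; auto. Qed.

(** * The momentum system and comparison with super- and subsolutions *)

Section Equation.

Variables (a1 B b m p : R).
Hypotheses (a1_gt : 2 < a1) (B_pos : 0 < B) (b_pos : 0 < b) (p_gt : 1 < p) (pm : p < m).

Definition diff_phi (t : R) : R := Rpower t (- a1).
Definition diff_Gam (t h : R) : R := B * Rpower h (1 / m) / (t * t).
Definition diff_Psi (t h : R) : R :=
  - B * Rpower t (a1 - 2) * ((a1 - 2) * Rpower h (1 / m) / t + b * h - Rpower h (p / m)).

Definition momentum (P dP : R -> R) (t : R) : R :=
  Rpower t a1 * dP t - B * Rpower t (a1 - 2) * Rpower (P t) (1 / m).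

(* Left-hand side of the equation for [h = (xi^-theta f)^m] in the variable
   [t = xi^(1/beta)]; [P], [dP], [ddP] are the values of [h], [h'], [h'']. *)
Definition oper (t P dP ddP : R) : R :=
  t * t * ddP + a1 * t * dP - B * (1 / m * Rpower P (1 / m - 1) * dP) + B * (b * P - Rpower P (p / m)).

(** The factor t^(a1-2) is the integrating factor that absorbs the drift, and the term B h^(1/m)
    absorbs the transport, so that no derivative of h is left on the right. For an arbitrary P the
    defect [oper] appears as an additive error of known sign in the second equation. *)
Lemma momentum_system (P dP : R -> R) (t ddP : R) :
  0 < t -> 0 < P t -> is_derive P t (dP t) -> is_derive dP t ddP ->
  is_derive P t (diff_phi t * momentum P dP t + diff_Gam t (P t)) /\
  is_derive (momentum P dP) t (diff_Psi t (P t) + Rpower t (a1 - 2) * oper t (P t) (dP t) ddP).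
Proof.
intros Ht HP D1 D2.
pose proof (Rpower_pos t (a1 - 2)) as HT.
pose proof (Rpower_minus_2 t a1 Ht) as E1.
assert (E2 : Rpower t (a1 - 1) = Rpower t (a1 - 2) * t).
{ rewrite <- (Rpower_1 t) at 3 by exact Ht; rewrite <- Rpower_plus; f_equal; ring. }
assert (E3 : Rpower t (a1 - 2 - 1) = Rpower t (a1 - 2) / t).
{ unfold Rdiv; rewrite <- Rpower_m1 by exact Ht; rewrite <- Rpower_plus; f_equal; ring. }
split.
- replace (diff_phi t * momentum P dP t + diff_Gam t (P t)) with (dP t); [exact D1 |].
  unfold diff_phi, diff_Gam, momentum; rewrite Rpower_Ropp, E1; field; split; lra.
- pose proof (is_derive_Rpower_id t a1 Ht) as K1.
  pose proof (is_derive_Rpower_id t (a1 - 2) Ht) as K2.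
  pose proof (is_derive_Rpower_id (P t) (1 / m) HP) as K3.
  unfold momentum; auto_derive.
  + repeat split; eexists; eassumption.
  + rewrite (Derive_eq _ _ _ K1), (Derive_eq _ _ _ K2), (Derive_eq _ _ _ K3), (Derive_eq _ _ _ D1), (Derive_eq _ _ _ D2).
    unfold diff_Psi, oper; rewrite E1, E2, E3; field; lra.
Qed.
Lemma diff_phi_pos t : 0 < diff_phi t.
Proof. apply Rpower_pos. Qed.

(* Where [x] lies above [G] (below [G], for [solves_below]) the truncated
   system reads the coefficients on [G]. *)
Definition solves_above (G x y : R -> R) : Prop :=
  (forall t, 0 < t -> continuous x t) /\
  forall t, 0 < t -> G t <= x t ->
    is_derive x t (diff_phi t * y t + diff_Gam t (G t)) /\ is_derive y t (diff_Psi t (G t)).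

Definition solves_below (G x y : R -> R) : Prop :=
  (forall t, 0 < t -> continuous x t) /\
  forall t, 0 < t -> x t <= G t ->
    is_derive x t (diff_phi t * y t + diff_Gam t (G t)) /\ is_derive y t (diff_Psi t (G t)).

Lemma barrier_above (A : R -> Prop) (G P dP x y : R -> R) :
  (forall a b t, A a -> A b -> a <= t <= b -> A t) ->
  (forall t, A t -> 0 < t /\ 0 < P t /\ G t = P t) ->
  (forall t, A t -> exists ddP, is_derive P t (dP t) /\ is_derive dP t ddP /\ oper t (P t) (dP t) ddP <= 0) ->
  solves_above G x y -> trap A P (momentum P dP) x y.
Proof.
intros HA HG HP [Hc Hxy].
destruct (function_choice _ _ (fun t d => A t -> is_derive P t (dP t) /\
  is_derive dP t d /\ oper t (P t) (dP t) d <= 0)) as [ddP HD].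
{ intros t; destruct (classic (A t)) as [H | H]; [destruct (HP t H) as [d Hd]; exists d; intros _; exact Hd | exists 0; tauto]. }
apply (trap_piece A diff_phi (fun t => diff_Gam t (P t)) (fun t => diff_Psi t (P t)) P (momentum P dP)
  (fun t => diff_Psi t (P t) + Rpower t (a1 - 2) * oper t (P t) (dP t) (ddP t))); try assumption.
- intros; apply diff_phi_pos.
- intros t Ht; destruct (HG t Ht) as (H1 & H2 & _); destruct (HD t Ht) as (H3 & H4 & _); apply (momentum_system P dP t (ddP t)); assumption.
- intros t Ht; destruct (HG t Ht) as (H1 & H2 & _); destruct (HD t Ht) as (H3 & H4 & H5).
  split; [apply (momentum_system P dP t (ddP t)); assumption |].
  pose proof (Rpower_pos t (a1 - 2)); nra.
- intros t Ht; apply Hc, HG, Ht.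
- intros t Ht Hle; destruct (HG t Ht) as (H1 & _ & E); rewrite <- E in *; apply Hxy; assumption.
Qed.

(** Changing the sign of the solution, of the barrier and of the momenta turns a subsolution
    approached from below into the situation of [trap], so [trap_piece] serves both sides. *)
Lemma barrier_below (A : R -> Prop) (G P dP x y : R -> R) :
  (forall a b t, A a -> A b -> a <= t <= b -> A t) ->
  (forall t, A t -> 0 < t /\ 0 < P t /\ G t = P t) ->
  (forall t, A t -> exists ddP, is_derive P t (dP t) /\ is_derive dP t ddP /\ 0 <= oper t (P t) (dP t) ddP) ->
  solves_below G x y ->
  trap A (fun t => - P t) (fun t => - momentum P dP t) (fun t => - x t) (fun t => - y t).
Proof.
intros HA HG HP [Hc Hxy].
destruct (function_choice _ _ (fun t d => A t -> is_derive P t (dP t) /\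
  is_derive dP t d /\ 0 <= oper t (P t) (dP t) d)) as [ddP HD].
{ intros t; destruct (classic (A t)) as [H | H]; [destruct (HP t H) as [d Hd]; exists d; intros _; exact Hd | exists 0; tauto]. }
assert (Hopp : forall u t l, is_derive u t l -> is_derive (fun t => - u t) t (- l)).
{ intros u t l; exact (is_derive_Ropp u t l). }
apply (trap_piece A diff_phi (fun t => - diff_Gam t (P t)) (fun t => - diff_Psi t (P t))
  (fun t => - P t) (fun t => - momentum P dP t)
  (fun t => - (diff_Psi t (P t) + Rpower t (a1 - 2) * oper t (P t) (dP t) (ddP t)))); try assumption.
- intros; apply diff_phi_pos.
- intros t Ht; destruct (HG t Ht) as (H1 & H2 & _); destruct (HD t Ht) as (H3 & H4 & _).
  replace (diff_phi t * - momentum P dP t + - diff_Gam t (P t)) with (- (diff_phi t * momentum P dP t + diff_Gam t (P t))) by ring.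
  apply Hopp, (momentum_system P dP t (ddP t)); assumption.
- intros t Ht; destruct (HG t Ht) as (H1 & H2 & _); destruct (HD t Ht) as (H3 & H4 & H5).
  split; [apply Hopp, (momentum_system P dP t (ddP t)); assumption |].
  pose proof (Rpower_pos t (a1 - 2)); nra.
- intros t Ht; apply (continuous_Ropp), Hc, HG, Ht.
- intros t Ht Hle; destruct (HG t Ht) as (H1 & _ & E); destruct (Hxy t H1 ltac:(lra)) as [D1 D2]; rewrite E in D1, D2.
  split; [| apply Hopp, D2].
  replace (diff_phi t * - y t + - diff_Gam t (P t)) with (- (diff_phi t * y t + diff_Gam t (P t))) by ring.
  apply Hopp, D1.
Qed.

(* [t^-kap] is the decay of [h] at infinity. *)
Definition q : R := p - 1.
Definition kap : R := m / q.
Definition del : R := (m - p) / q.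

(** * Power-like tails near infinity *)

Lemma q_pos : 0 < q. Proof. unfold q; lra. Qed.
Lemma kap_pos : 0 < kap. Proof. apply Rdiv_lt_0_compat; [lra | apply q_pos]. Qed.
Lemma del_pos : 0 < del. Proof. apply Rdiv_lt_0_compat; [lra | apply q_pos]. Qed.

(* [s] is the logarithmic slope of [w] with respect to [ln t]. *)
Lemma power_profile (w s : R -> R) (t ds : R) :
  0 < t -> is_derive s t ds ->
  (forall r, 0 < r -> 0 < w r) -> (forall r, 0 < r -> is_derive w r (w r * s r / r)) ->
  let P := fun r => Rpower (w r) kap in
  let dP := fun r => kap * P r * s r / r in
  let ddP := P t * (kap * kap * s t * s t + kap * (t * ds) - kap * s t) / (t * t) in
  is_derive P t (dP t) /\ is_derive dP t ddP /\
  oper t (P t) (dP t) ddP =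
    Rpower (P t) (1 / m) * (w t * Rpower (w t) del *
       (kap * kap * s t * s t + kap * (t * ds) + (a1 - 1) * kap * s t + B * b)
      - B * (s t / (q * t) + w t)).
Proof.
intros Ht Ds Hw' Dw' P dP ddP; pose proof (Hw' t Ht) as Hw; pose proof (Dw' t Ht) as Dw.
pose proof q_pos as Hq; pose proof kap_pos as Hk.
assert (DP : is_derive P t (dP t)).
{ unfold dP, P; replace (kap * Rpower (w t) kap * s t / t) with (kap * Rpower (w t) (kap - 1) * (w t * s t / t)).
  - apply is_derive_Rpower; assumption.
  - rewrite (Rpower_split (w t) kap (kap - 1) 1) by ring; rewrite Rpower_1 by exact Hw; field; lra. }
split; [exact DP | split].
- unfold dP; auto_derive.
  + split; [eexists; exact DP | split; [eexists; exact Ds | split; [lra | exact I]]].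
  + rewrite (Derive_eq _ _ _ DP), (Derive_eq _ _ _ Ds); unfold dP, ddP; field; lra.
- assert (HP : 0 < P t) by apply Rpower_pos.
  set (g := Rpower (P t) (1 / m)); assert (Hg : 0 < g) by apply Rpower_pos.
  assert (E1 : Rpower (P t) (1 / m - 1) = g / P t).
  { rewrite (Rpower_split (P t) _ (1 / m) (-1)) by ring; rewrite Rpower_m1 by exact HP; reflexivity. }
  (* After division by g = P^(1/m), absorption is w and transport is s/(q t), while diffusion, drift
     and linear reaction carry the smaller factor w^(1 + del). For w = 1/(q t) and s = -1 the two
     leading terms cancel: this is the exact decay. *)
  assert (E2 : Rpower (P t) (p / m) = g * w t).
  { rewrite (Rpower_split (P t) _ (1 / m) (q / m)) by (unfold q; field; lra).
    unfold P at 2; rewrite Rpower_mult; replace (kap * (q / m)) with 1 by (unfold kap; field; lra).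
    rewrite Rpower_1 by exact Hw; reflexivity. }
  assert (E3 : P t = g * (w t * Rpower (w t) del)).
  { replace (w t * Rpower (w t) del) with (Rpower (w t) (1 + del)) by (rewrite Rpower_plus, Rpower_1; auto).
    unfold g, P; rewrite Rpower_mult, <- Rpower_plus; f_equal; unfold kap, del, q; field; unfold q in Hq; lra. }
  unfold oper; rewrite E1, E2; unfold dP, ddP.
  assert (Ek : kap = m / q) by reflexivity.
  replace (t * t * (P t * (kap * kap * s t * s t + kap * (t * ds) - kap * s t) / (t * t)) + a1 * t * (kap * P t * s t / t)
      - B * (1 / m * (g / P t) * (kap * P t * s t / t)) + B * (b * P t - g * w t))
    with (P t * (kap * kap * s t * s t + kap * (t * ds) + (a1 - 1) * kap * s t + B * b)
       - g * (B * ((kap / m) * s t / t + w t))) by (field; lra).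
  rewrite E3 at 1; replace (kap / m * s t / t) with (s t / (q * t)) by (rewrite Ek; field; lra); ring.
Qed.

(* Rate at which the tails approach the exact decay; [gam <= del] keeps the
   second-order terms, of relative size [t^-del], negligible. *)
Definition gam : R := Rmin (1 / 2) del.

Lemma gam_bounds : 0 < gam /\ gam <= 1 / 2 /\ gam <= del.
Proof.
pose proof del_pos; unfold gam; split; [apply Rmin_glb_lt; lra | split; [apply Rmin_l | apply Rmin_r]].
Qed.

Definition tail_const : R :=
  kap * kap * (1 + gam) * (1 + gam) + kap * (gam * gam) + (a1 - 1) * kap * (1 + gam) + B * b.

Lemma tail_const_pos : 0 < tail_const.
Proof.
pose proof kap_pos; pose proof gam_bounds; unfold tail_const.
assert (0 < kap * kap * (1 + gam) * (1 + gam)) by pos.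
assert (0 < kap * (gam * gam)) by pos.
assert (0 < (a1 - 1) * kap * (1 + gam)) by pos.
assert (0 < B * b) by pos; lra.
Qed.

Lemma tail_const_bound s d : Rabs s <= 1 + gam -> Rabs d <= gam * gam ->
  Rabs (kap * kap * s * s + kap * d + (a1 - 1) * kap * s + B * b) <= tail_const.
Proof.
intros Hs Hd; pose proof kap_pos as Hk; pose proof gam_bounds as Hg.
apply Rabs_le_between in Hs; apply Rabs_le_between in Hd.
assert (Hs2 : 0 <= s * s <= (1 + gam) * (1 + gam)) by nra.
assert (0 <= kap * kap) by nra.
assert (0 <= kap * kap * (s * s) <= kap * kap * ((1 + gam) * (1 + gam))).
{ split; [apply Rmult_le_pos; lra | scale]. }
assert (- (kap * (gam * gam)) <= kap * d <= kap * (gam * gam)) by nra.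
assert (0 < (a1 - 1) * kap) by nra.
assert (- ((a1 - 1) * kap * (1 + gam)) <= (a1 - 1) * kap * s <= (a1 - 1) * kap * (1 + gam)) by nra.
assert (0 < B * b) by nra.
unfold tail_const; apply Rabs_le; split; lra.
Qed.

Definition decay (M t : R) : R := M * Rpower t (- gam).
(** -gam [frac] is the logarithmic slope of 1 + [decay]. *)
Definition frac (M t : R) : R := decay M t / (1 + decay M t).

Lemma decay_pos M t : 0 < M -> 0 < decay M t.
Proof. intros HM; apply Rmult_lt_0_compat; [exact HM | apply Rpower_pos]. Qed.

Lemma frac_bounds M t : 0 < M -> 0 < frac M t < 1.
Proof.
intros HM; pose proof (decay_pos M t HM); unfold frac; split.
- pos.
- apply Rmult_lt_reg_r with (1 + decay M t); [lra |]; unfold Rdiv; rewrite Rmult_assoc, Rinv_l; lra.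
Qed.

Lemma decay_derive M t : 0 < t -> is_derive (decay M) t (- gam * decay M t / t).
Proof.
intros Ht; unfold decay.
replace (- gam * (M * Rpower t (- gam)) / t) with (M * (- gam * Rpower t (- gam - 1))).
- apply (is_derive_scal (fun s => Rpower s (- gam))), is_derive_Rpower_id, Ht.
- rewrite (Rpower_split t (- gam - 1) (- gam) (-1)) by ring; rewrite Rpower_m1 by exact Ht; field; lra.
Qed.

Lemma frac_derive M t : 0 < M -> 0 < t -> is_derive (frac M) t (- gam * frac M t * (1 - frac M t) / t).
Proof.
intros HM Ht; pose proof (decay_pos M t HM); pose proof (decay_derive M t Ht) as D.
unfold frac; auto_derive.
- repeat split; try (eexists; exact D); lra.
- rewrite (Derive_eq _ _ _ D); field; split; lra.
Qed.

Definition sup_w (M t : R) : R := (1 + decay M t) / (q * t).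
Definition sub_w (M t : R) : R := / (q * t * (1 + decay M t)).
(** The factors 1 and -1 are kept so that both slopes are instances, by conversion, of the
    expression in [slope_bounds]. *)
Definition sup_slope (M t : R) : R := - (1 + 1 * gam * frac M t).
Definition sub_slope (M t : R) : R := - (1 + -1 * gam * frac M t).

Lemma sup_w_derive M t : 0 < M -> 0 < t ->
  0 < sup_w M t /\ is_derive (sup_w M) t (sup_w M t * sup_slope M t / t).
Proof.
intros HM Ht; pose proof q_pos as Hq; pose proof (decay_pos M t HM); pose proof (decay_derive M t Ht) as D.
assert (0 < q * t) by pos.
split; [unfold sup_w; pos |].
unfold sup_w, sup_slope, frac; auto_derive.
- repeat split; try (eexists; exact D); lra.
- rewrite (Derive_eq _ _ _ D); field; repeat split; lra.
Qed.

Lemma sub_w_derive M t : 0 < M -> 0 < t ->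
  0 < sub_w M t /\ is_derive (sub_w M) t (sub_w M t * sub_slope M t / t).
Proof.
intros HM Ht; pose proof q_pos as Hq; pose proof (decay_pos M t HM); pose proof (decay_derive M t Ht) as D.
assert (0 < q * t) by pos.
assert (0 < q * t * (1 + decay M t)) by pos.
split; [unfold sub_w; pos |].
unfold sub_w, sub_slope, frac; auto_derive.
- repeat split; try (eexists; exact D); lra.
- rewrite (Derive_eq _ _ _ D); field; repeat split; lra.
Qed.

Definition sup_tail (M t : R) : R := Rpower (sup_w M t) kap.
Definition sub_tail (M t : R) : R := Rpower (sub_w M t) kap.
Definition d_sup_tail (M t : R) : R := kap * sup_tail M t * sup_slope M t / t.
Definition d_sub_tail (M t : R) : R := kap * sub_tail M t * sub_slope M t / t.

(* The second and zeroth order terms are bounded by [tail_const] times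
   [w^(1 + del)]. *)
Lemma tail_oper (w s : R -> R) (t ds : R) :
  0 < t -> is_derive s t ds ->
  (forall r, 0 < r -> 0 < w r /\ is_derive w r (w r * s r / r)) ->
  Rabs (s t) <= 1 + gam -> Rabs (t * ds) <= gam * gam ->
  let P := fun r => Rpower (w r) kap in
  let dP := fun r => kap * P r * s r / r in
  exists ddP g d, 0 < g /\ is_derive P t (dP t) /\ is_derive dP t ddP /\
    - (w t * Rpower (w t) del * tail_const) <= d <= w t * Rpower (w t) del * tail_const /\
    oper t (P t) (dP t) ddP = g * (d - B * (s t / (q * t) + w t)).
Proof.
intros Ht Ds Hw Hs1 Hs2 P dP.
destruct (power_profile w s t ds Ht Ds (fun r Hr => proj1 (Hw r Hr)) (fun r Hr => proj2 (Hw r Hr))) as (H1 & H2 & H3).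
eexists; exists (Rpower (P t) (1 / m)); eexists; split; [apply Rpower_pos | split; [exact H1 | split; [exact H2 | split; [| exact H3]]]].
pose proof (tail_const_bound (s t) (t * ds) Hs1 Hs2) as HR; apply Rabs_le_between in HR.
assert (0 < w t * Rpower (w t) del) by (apply Rmult_lt_0_compat; [apply Hw, Ht | apply Rpower_pos]); nra.
Qed.

Lemma slope_bounds M t e : 0 < M -> 0 < t -> e = 1 \/ e = -1 ->
  is_derive (fun t => - (1 + e * gam * frac M t)) t (e * (gam * gam * frac M t * (1 - frac M t)) / t) /\
  Rabs (- (1 + e * gam * frac M t)) <= 1 + gam /\
  Rabs (t * (e * (gam * gam * frac M t * (1 - frac M t)) / t)) <= gam * gam.
Proof.
intros HM Ht He; pose proof (frac_derive M t HM Ht) as DY; pose proof (frac_bounds M t HM) as HY; pose proof gam_bounds as Hg.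
split; [auto_derive; [eexists; exact DY |]; rewrite (Derive_eq _ _ _ DY); field; lra | split].
- apply Rabs_le; assert (0 <= gam * frac M t <= gam) by nra; destruct He as [-> | ->]; lra.
- replace (t * (e * (gam * gam * frac M t * (1 - frac M t)) / t)) with (e * (gam * gam * (frac M t * (1 - frac M t)))) by (field; lra).
  assert (0 <= frac M t * (1 - frac M t) <= 1) by nra; assert (0 <= gam * gam) by nra.
  assert (0 <= gam * gam * (frac M t * (1 - frac M t)) <= gam * gam) by nra.
  apply Rabs_le; destruct He as [-> | ->]; lra.
Qed.

(** Multiplying the exact decay by 1 + [decay] raises the absorption by [decay] but flattens the
    transport by gam [frac] <= gam [decay] only. As gam < 1 a gain (1 - gam) [decay] remains, and
    the condition says that it beats the neglected terms. *)
Lemma sup_tail_oper M t : 0 < M -> 0 < t -> exists ddP,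
  is_derive (sup_tail M) t (d_sup_tail M t) /\ is_derive (d_sup_tail M) t ddP /\
  (tail_const * Rpower (sup_w M t) del * (1 + decay M t) <= B * (1 - gam) * decay M t ->
   oper t (sup_tail M t) (d_sup_tail M t) ddP <= 0).
Proof.
intros HM Ht; destruct (slope_bounds M t 1 HM Ht (or_introl eq_refl)) as (Ds & S1 & S2).
destruct (tail_oper (sup_w M) (sup_slope M) t _ Ht Ds (fun r Hr => sup_w_derive M r HM Hr) S1 S2)
  as (ddP & g & d & Hgp & D1 & D2 & Hd & HO).
exists ddP; split; [exact D1 | split; [exact D2 |]]; intros Hc.
unfold sup_tail, d_sup_tail, sup_tail; rewrite HO.
pose proof (frac_bounds M t HM); pose proof gam_bounds; pose proof q_pos; pose proof (decay_pos M t HM).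
set (W := Rpower (sup_w M t) del) in *.
assert (Hqt : 0 < q * t) by pos.
assert (E : sup_slope M t / (q * t) + sup_w M t = (decay M t - gam * frac M t) / (q * t)).
{ unfold sup_slope, sup_w; field; split; lra. }
rewrite E.
assert (HYy : frac M t <= decay M t).
{ unfold frac; apply Rmult_le_reg_r with (1 + decay M t); [lra |]; unfold Rdiv; rewrite Rmult_assoc, Rinv_l by lra; nra. }
assert (K : sup_w M t * W * tail_const <= B * ((decay M t - gam * frac M t) / (q * t))).
{ unfold sup_w; apply Rmult_le_reg_r with (q * t); [exact Hqt |].
  replace ((1 + decay M t) / (q * t) * W * tail_const * (q * t)) with (tail_const * W * (1 + decay M t)) by (field; split; lra).
  replace (B * ((decay M t - gam * frac M t) / (q * t)) * (q * t)) with (B * (decay M t - gam * frac M t)) by (field; split; lra).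
  eapply Rle_trans; [exact Hc |]; rewrite Rmult_assoc; apply Rmult_le_compat_l; [lra | nra]. }
nra.
Qed.

(** The mirror image of the supersolution; here the leading terms leave exactly (1 - gam) [frac]
    with the favourable sign, and the factor 1 + [decay] cancels from the condition. *)
Lemma sub_tail_oper M t : 0 < M -> 0 < t -> exists ddP,
  is_derive (sub_tail M) t (d_sub_tail M t) /\ is_derive (d_sub_tail M) t ddP /\
  (tail_const * Rpower (sub_w M t) del <= B * (1 - gam) * decay M t ->
   0 <= oper t (sub_tail M t) (d_sub_tail M t) ddP).
Proof.
intros HM Ht; destruct (slope_bounds M t (-1) HM Ht (or_intror eq_refl)) as (Ds & S1 & S2).
destruct (tail_oper (sub_w M) (sub_slope M) t _ Ht Ds (fun r Hr => sub_w_derive M r HM Hr) S1 S2)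
  as (ddP & g & d & Hgp & D1 & D2 & Hd & HO).
exists ddP; split; [exact D1 | split; [exact D2 |]]; intros Hc.
unfold sub_tail, d_sub_tail, sub_tail; rewrite HO.
pose proof (frac_bounds M t HM); pose proof gam_bounds; pose proof q_pos; pose proof (decay_pos M t HM).
set (W := Rpower (sub_w M t) del) in *.
assert (Hqt : 0 < q * t) by pos.
assert (E : sub_slope M t / (q * t) + sub_w M t = - ((1 - gam) * frac M t / (q * t))).
{ unfold sub_slope, sub_w, frac; field; repeat split; lra. }
rewrite E.
assert (K : sub_w M t * W * tail_const <= B * ((1 - gam) * frac M t / (q * t))).
{ unfold sub_w, frac; apply Rmult_le_reg_r with (q * t * (1 + decay M t)); [pos |].
  replace (/ (q * t * (1 + decay M t)) * W * tail_const * (q * t * (1 + decay M t))) with (tail_const * W) by (field; repeat split; lra).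
  replace (B * ((1 - gam) * (decay M t / (1 + decay M t)) / (q * t)) * (q * t * (1 + decay M t)))
    with (B * (1 - gam) * decay M t) by (field; repeat split; lra).
  exact Hc. }
apply Rmult_le_pos; lra.
Qed.
(* [K0^m], the positive zero of the reaction [b h - h^(p/m)]. *)
Definition K0m : R := Rpower b (- (m / (m - p))).

(** * The reaction term; lines and waves near the origin *)

Lemma K0m_pos : 0 < K0m. Proof. apply Rpower_pos. Qed.

Lemma K0m_pow : Rpower K0m (p / m) = b * K0m.
Proof.
unfold K0m; rewrite Rpower_mult; rewrite <- (Rpower_1 b) at 2 by exact b_pos.
rewrite <- Rpower_plus; f_equal; field; lra.
Qed.
Lemma Rpower_le_base x y a : 0 < x -> x <= y -> 0 <= a -> Rpower x a <= Rpower y a.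
Proof. intros Hx Hxy Ha; apply Rle_Rpower_l; lra. Qed.

Lemma Rpower_neg_le_base x y a : 0 < x -> x <= y -> a <= 0 -> Rpower y a <= Rpower x a.
Proof.
intros Hx Hxy Ha; replace a with (- - a) by ring; rewrite !(Rpower_Ropp _ (- a)).
apply Rinv_le_contravar; [apply Rpower_pos | apply Rpower_le_base; lra].
Qed.

Lemma inv_m_lt : 1 / m - 1 < 0.
Proof. apply Rlt_minus; apply Rmult_lt_reg_r with m; [lra |]; unfold Rdiv; rewrite Rmult_assoc, Rinv_l; lra. Qed.

Lemma p_over_m : 0 < p / m < 1.
Proof.
split; [pos |].
apply Rmult_lt_reg_r with m; [lra |]; unfold Rdiv; rewrite Rmult_assoc, Rinv_l; lra.
Qed.

Lemma reaction_above h : K0m <= h -> b * h - Rpower h (p / m) <= b * (h - K0m).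
Proof.
intros Hh; pose proof (Rpower_le_base K0m h (p / m) K0m_pos Hh ltac:(pose proof p_over_m; lra)) as H.
rewrite K0m_pow in H; lra.
Qed.

Lemma reaction_below h : 0 < h -> h <= K0m -> b * h - Rpower h (p / m) <= 0.
Proof.
intros H0 Hh; pose proof p_over_m as Hpm.
assert (E : forall x, 0 < x -> Rpower x (p / m) = x * Rpower x (p / m - 1)).
{ intros x Hx; rewrite <- (Rpower_1 x) at 2 by exact Hx; rewrite <- Rpower_plus; f_equal; ring. }
assert (Hb : Rpower K0m (p / m - 1) = b).
{ apply Rmult_eq_reg_l with K0m; [rewrite <- E by apply K0m_pos; rewrite K0m_pow; ring | pose proof K0m_pos; lra]. }
pose proof (Rpower_neg_le_base h K0m (p / m - 1) H0 Hh ltac:(lra)) as H.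
rewrite E by exact H0; rewrite Hb in H; nra.
Qed.

Lemma line_derive (k0 k t : R) :
  is_derive (fun t => k0 + k * t) t k /\ is_derive (fun _ : R => k) t 0.
Proof.
split; [auto_derive; [exact I | ring] | apply (is_derive_const (K := R_AbsRing) (V := R_NormedModule))].
Qed.

(** Up to height 2 K0^m the transport contributes at most -B lam k. One half of it absorbs the terms
    (a1 + B b) k t on the short interval t <= z, the other half the reaction B b e1 caused by
    starting as high as K0^m + e1. *)
Lemma line_oper_sup (k0 k e1 z t : R) :
  0 < k0 -> 0 < k -> k0 <= K0m + e1 -> 0 <= e1 ->
  0 < t -> t <= z -> k0 + k * z <= 2 * K0m ->
  let lam := 1 / m * Rpower (2 * K0m) (1 / m - 1) in
  2 * (a1 + B * b) * z <= B * lam -> 2 * (b * e1) <= k * lam ->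
  oper t (k0 + k * t) k 0 <= 0.
Proof.
intros Hk0 Hk Hk1 He Ht Htz Hz lam Hl1 Hl2; unfold oper.
assert (HP : 0 < k0 + k * t) by nra.
assert (HP2 : k0 + k * t <= 2 * K0m) by nra.
pose proof (Rpower_neg_le_base _ _ (1 / m - 1) HP HP2 ltac:(pose proof inv_m_lt; lra)) as HR.
assert (Hm : 0 < 1 / m) by pos.
assert (HL : lam <= 1 / m * Rpower (k0 + k * t) (1 / m - 1)) by scale.
set (L := 1 / m * Rpower (k0 + k * t) (1 / m - 1)) in *.
assert (Hr : b * (k0 + k * t) - Rpower (k0 + k * t) (p / m) <= b * (e1 + k * t)).
{ destruct (Rle_lt_dec (k0 + k * t) K0m) as [H | H].
  - pose proof (reaction_below _ HP H); assert (0 <= b * (e1 + k * t)) by (apply Rmult_le_pos; nra); lra.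
  - eapply Rle_trans; [apply reaction_above; lra |]; scale. }
assert (B * (b * (k0 + k * t) - Rpower (k0 + k * t) (p / m)) <= B * (b * (e1 + k * t))) by scale.
assert (B * (lam * k) <= B * (L * k)) by (apply Rmult_le_compat_l; [lra | scale]).
assert ((a1 + B * b) * t <= (a1 + B * b) * z) by (apply Rmult_le_compat_l; nra).
assert (k * (2 * ((a1 + B * b) * t)) <= k * (B * lam)) by scale.
assert (B * (2 * (b * e1)) <= B * (k * lam)) by scale.
nra.
Qed.

(** On a falling line the transport is at least B lam k; one half absorbs the drift, the other the
    absorption, which is at most k0^(p/m). The linear reaction is positive and is dropped. *)
Lemma line_oper_sub (k0 k z t : R) :
  0 < k0 -> 0 < k -> 0 < t -> t <= z -> 0 < k0 - k * t ->
  let lam := 1 / m * Rpower k0 (1 / m - 1) in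
  2 * a1 * z <= B * lam -> 2 * Rpower k0 (p / m) <= k * lam ->
  0 <= oper t (k0 + - k * t) (- k) 0.
Proof.
intros Hk0 Hk Ht Htz HP' lam Hl1 Hl2; unfold oper.
assert (HP : 0 < k0 + - k * t) by lra.
assert (HP2 : k0 + - k * t <= k0) by nra.
pose proof (Rpower_neg_le_base _ _ (1 / m - 1) HP HP2 ltac:(pose proof inv_m_lt; lra)) as HR.
assert (Hm : 0 < 1 / m) by pos.
assert (HL : lam <= 1 / m * Rpower (k0 + - k * t) (1 / m - 1)) by scale.
set (L := 1 / m * Rpower (k0 + - k * t) (1 / m - 1)) in *.
pose proof (Rpower_le_base _ _ (p / m) HP HP2 ltac:(pose proof p_over_m; lra)) as HRp.
assert (0 < b * (k0 + - k * t)) by nra.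
assert (B * (- Rpower k0 (p / m)) <= B * (b * (k0 + - k * t) - Rpower (k0 + - k * t) (p / m))) by scale.
assert (B * (lam * k) <= B * (L * k)) by (apply Rmult_le_compat_l; [lra | scale]).
assert (a1 * t <= a1 * z) by scale.
assert (k * (2 * (a1 * t)) <= k * (B * lam)) by scale.
assert (B * (2 * Rpower k0 (p / m)) <= B * (k * lam)) by scale.
nra.
Qed.

(** The exact solution of t^2 P'' + 2 t P' = La P' that starts from K2, flat to all orders at 0, and
    descends towards K2 - De. *)
Definition wave (K2 De La t : R) : R := K2 - De * exp (- (La / t)).
Definition d_wave (De La t : R) : R := - (De * La / (t * t) * exp (- (La / t))).
Definition dd_wave (De La t : R) : R :=
  - (De * La * (La / (t * t * t * t) - 2 / (t * t * t)) * exp (- (La / t))).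

Lemma wave_derive K2 De La t : 0 < t ->
  is_derive (wave K2 De La) t (d_wave De La t) /\ is_derive (d_wave De La) t (dd_wave De La t).
Proof.
intros Ht; unfold wave, d_wave, dd_wave; assert (t * t <> 0) by nra.
split; auto_derive; try (repeat split; lra); unfold Rdiv; field; lra.
Qed.

Lemma exp_neg_mono La s t : 0 < La -> 0 < s -> s <= t -> exp (- (La / s)) <= exp (- (La / t)).
Proof.
intros HL Hs Hst; apply exp_le_mono, Ropp_le_contravar, Rmult_le_compat_l; [lra |].
apply Rinv_le_contravar; assumption.
Qed.

(** The surplus La - B L of the transport and a1 - 2 of the drift both act downwards. Below K0^m the
    reaction has the good sign too. Above K0^m it is at most B b e2, and this happens only for z0 <=
    t < 1, where e2 <= 4 De exp(-La/t) and 1/t >= 1 let the drift surplus dominate. Since the wave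
    is exponentially flat at 0, this fails for t far below z0, which is why a line replaces it
    there. *)
Lemma wave_oper_sup (kp e2 La z0 t : R) :
  0 < kp -> kp < K0m -> 0 < z0 -> z0 <= t -> 0 < La ->
  let De := K0m - kp in
  e2 = 4 * De * exp (- (La / z0)) -> z0 <= 1 / 2 -> 2 <= La ->
  B * (1 / m * Rpower kp (1 / m - 1)) <= La -> 4 * (B * b) <= La * (a1 - 2) ->
  oper t (wave (K0m + e2) De La t) (d_wave De La t) (dd_wave De La t) <= 0.
Proof.
intros Hkp HkpK Hz0 Hz0t HLa De He2 Hz0' HLa2 Hlam Hb.
assert (Ht : 0 < t) by lra.
assert (HDe : 0 < De) by (unfold De; lra).
set (ps := exp (- (La / t))).
assert (Hps : 0 < ps) by apply exp_pos.
assert (Hps1 : ps < 1).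
{ unfold ps; rewrite <- exp_0; apply exp_increasing, Ropp_lt_gt_0_contravar, Rdiv_lt_0_compat; lra. }
assert (Hps0 : exp (- (La / z0)) <= ps) by (apply exp_neg_mono; lra).
assert (He2p : 0 < e2) by (rewrite He2; pose proof (exp_pos (- (La / z0))); nra).
set (P := wave (K0m + e2) De La t).
assert (HP : P = K0m + e2 - De * ps) by reflexivity.
assert (HPk : kp < P) by (rewrite HP; unfold De in *; nra).
pose proof (Rpower_neg_le_base kp P (1 / m - 1) Hkp ltac:(lra) ltac:(pose proof inv_m_lt; lra)) as HR.
assert (Hm : 0 < 1 / m) by pos.
set (L := 1 / m * Rpower P (1 / m - 1)).
assert (HL : B * L <= La).
{ eapply Rle_trans; [| exact Hlam]; unfold L; apply Rmult_le_compat_l; [lra |]; scale. }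
unfold oper; fold L.
assert (E : t * t * dd_wave De La t + a1 * t * d_wave De La t - B * (L * d_wave De La t)
   = - (De * ps * La * ((La - B * L) / (t * t) + (a1 - 2) / t))).
{ unfold dd_wave, d_wave; fold ps; field; lra. }
rewrite E.
assert (H1 : 0 <= (La - B * L) / (t * t)) by (apply Rmult_le_pos; [lra | left; apply Rinv_0_lt_compat; nra]).
assert (Hit : 0 < / t) by pos.
assert (Hdp : 0 < De * ps) by nra.
assert (H2 : De * ps * La * ((a1 - 2) / t) <= De * ps * La * ((La - B * L) / (t * t) + (a1 - 2) / t)).
{ apply Rmult_le_compat_l; [nra | lra]. }
destruct (Rle_lt_dec P K0m) as [Hc | Hc].
- pose proof (reaction_below P ltac:(lra) Hc) as Hr.
  assert (0 <= De * ps * La * ((a1 - 2) / t)).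
  { apply Rmult_le_pos; [nra |]; unfold Rdiv; apply Rmult_le_pos; lra. }
  assert (B * (b * P - Rpower P (p / m)) <= 0) by nra; lra.
- pose proof (reaction_above P ltac:(lra)) as Hr.
  assert (Hlt : De * ps < e2) by lra.
  (* For t >= 1 the wave has already dropped by De exp(-La), and La (1/z0 - 1) >= 2 together with 4
     <= exp 2 makes this at least e2. *)
  assert (Ht1 : t < 1).
  { apply Rnot_le_lt; intros H1t; assert (exp (- (La / 1)) <= ps) by (apply exp_neg_mono; lra).
    assert (4 * exp (- (La / z0)) <= exp (- (La / 1))); [| rewrite He2 in Hlt; nra].
    assert (H4 : 4 <= exp 2).
    { replace 2 with (1 + 1) by ring; rewrite exp_plus; pose proof (exp_ineq1 1 ltac:(lra)); nra. }
    apply Rle_trans with (exp 2 * exp (- (La / z0))); [apply Rmult_le_compat_r; [left; apply exp_pos | lra] |].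
    rewrite <- exp_plus; apply exp_le_mono.
    assert (2 <= / z0) by (replace 2 with (/ (1 / 2)) by field; apply Rinv_le_contravar; lra).
    unfold Rdiv; rewrite Rinv_1; nra. }
  assert (Hge : e2 <= 4 * (De * ps)) by (rewrite He2; nra).
  assert (Hit1 : 1 <= / t) by (rewrite <- Rinv_1; apply Rinv_le_contravar; lra).
  assert (K1 : De * ps * (4 * (B * b)) <= De * ps * La * ((a1 - 2) / t)).
  { rewrite (Rmult_assoc (De * ps)); apply Rmult_le_compat_l; [lra |]; unfold Rdiv.
    apply Rle_trans with (La * (a1 - 2) * 1); [lra |].
    rewrite <- Rmult_assoc; apply Rmult_le_compat_l; nra. }
  assert (K2 : B * (b * P - Rpower P (p / m)) <= B * (b * e2)) by (apply Rmult_le_compat_l; [lra |]; nra).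
  assert (K3 : (B * b) * e2 <= (B * b) * (4 * (De * ps))) by (apply Rmult_le_compat_l; nra).
  lra.
Qed.

(** * Construction of the upper barrier *)

Lemma decay_mono M s t : 0 < M -> 0 < s -> s <= t -> decay M t <= decay M s.
Proof.
intros HM Hs Hst; apply Rmult_le_compat_l; [lra |].
apply Rpower_neg_le_base; try assumption; pose proof gam_bounds; lra.
Qed.

Lemma sup_w_mono M s t : 0 < M -> 0 < s -> s <= t -> sup_w M t <= sup_w M s.
Proof.
intros HM Hs Hst; pose proof (decay_mono M s t HM Hs Hst); pose proof (decay_pos M t HM); pose proof q_pos.
unfold sup_w; apply Rmult_le_compat; [lra | left; apply Rinv_0_lt_compat; pos | lra |].
apply Rinv_le_contravar; [pos | scale].
Qed.

(** Two regimes. While [decay] >= 1 one has 1 + [decay] <= 2 [decay], and smallness of w at the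
    starting point z suffices, w being decreasing. Once [decay] < 1, w <= 2/(q t), and t^(-del) <=
    t^(-gam) for t >= 1 reduces the condition to M being large. *)
Lemma sup_tail_valid M z t :
  0 < M -> 1 <= z -> z <= t ->
  2 * tail_const * Rpower (sup_w M z) del <= B * (1 - gam) ->
  2 * tail_const * Rpower (2 / q) del <= B * (1 - gam) * M ->
  tail_const * Rpower (sup_w M t) del * (1 + decay M t) <= B * (1 - gam) * decay M t.
Proof.
intros HM Hz Hzt H1 H2; pose proof tail_const_pos; pose proof gam_bounds; pose proof del_pos; pose proof q_pos as Hq.
pose proof (decay_pos M t HM) as Hy; assert (Ht : 0 < t) by lra.
pose proof (sup_w_derive M t HM Ht) as [Hw _].
pose proof (Rpower_pos (sup_w M t) del) as HW.
assert (HB : 0 < B * (1 - gam)) by nra.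
destruct (Rle_lt_dec 1 (decay M t)) as [Hc | Hc].
- pose proof (Rpower_le_base (sup_w M t) (sup_w M z) del Hw (sup_w_mono M z t HM ltac:(lra) Hzt) ltac:(lra)) as HWz.
  set (W := Rpower (sup_w M t) del) in *; set (Wz := Rpower (sup_w M z) del) in *.
  apply Rle_trans with (2 * tail_const * Wz * decay M t); [| scale].
  assert (tail_const * W <= tail_const * Wz) by scale.
  assert (0 < tail_const * W) by nra; nra.
- assert (Hwt : sup_w M t <= 2 / q * / t).
  { unfold sup_w; replace (2 / q * / t) with (2 / (q * t)) by (field; lra).
    apply Rmult_le_compat_r; [left; apply Rinv_0_lt_compat; pos | lra]. }
  assert (H2q : 0 < 2 / q) by pos.
  assert (Hit : 0 < / t) by pos.
  pose proof (Rpower_le_base _ _ del Hw Hwt ltac:(lra)) as HWt.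
  rewrite <- Rpower_mult_distr in HWt by assumption.
  assert (Et : Rpower (/ t) del = Rpower t (- del)).
  { rewrite <- Rpower_m1 by exact Ht; rewrite Rpower_mult; f_equal; ring. }
  assert (Hle : Rpower t (- del) <= Rpower t (- gam)) by (apply Rle_Rpower; lra).
  rewrite Et in HWt; pose proof (Rpower_pos (2 / q) del) as HQ.
  set (W := Rpower (sup_w M t) del) in *; set (Q := Rpower (2 / q) del) in *.
  unfold decay at 2; set (T := Rpower t (- gam)) in *.
  assert (HT : 0 < T) by apply Rpower_pos.
  assert (W <= Q * T) by (eapply Rle_trans; [exact HWt | scale]).
  apply Rle_trans with (tail_const * (Q * T) * 2).
  + apply Rmult_le_compat; [nra | lra | scale | lra].
  + replace (tail_const * (Q * T) * 2) with (2 * tail_const * Q * T) by ring.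
    replace (B * (1 - gam) * (M * T)) with (B * (1 - gam) * M * T) by ring.
    scale.
Qed.

Lemma trap_subset (A A' : R -> Prop) G XG x y :
  (forall t, A' t -> A t) -> trap A G XG x y -> trap A' G XG x y.
Proof. intros H [S E]; split; intros; [apply (S t0) | apply (E t0)]; auto. Qed.

(** At a junction the two pieces have the same height, so the order of momenta required by
    [trap_glue] is the order of slopes. *)
Lemma momentum_le (P1 dP1 P2 dP2 : R -> R) t :
  P1 t = P2 t -> dP1 t <= dP2 t -> momentum P1 dP1 t <= momentum P2 dP2 t.
Proof.
intros E H; unfold momentum; rewrite E.
pose proof (Rpower_pos t a1); assert (Rpower t a1 * dP1 t <= Rpower t a1 * dP2 t) by scale; lra.
Qed.

(* Height at which the wave levels off, low enough for the tail to be a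
   supersolution from there on. *)
Definition amplitude : R := Rmin (K0m / 4) (Rpower (B * (1 - gam) / (2 * tail_const)) (m / (m - p)) / 3).

Lemma amplitude_spec : 0 < amplitude /\ amplitude <= K0m / 4 /\
  2 * tail_const * Rpower (3 * amplitude) ((m - p) / m) <= B * (1 - gam).
Proof.
pose proof K0m_pos; pose proof tail_const_pos as HC; pose proof gam_bounds.
assert (HB : 0 < B * (1 - gam)) by nra.
assert (Hr : 0 < B * (1 - gam) / (2 * tail_const)) by pos.
pose proof (Rpower_pos (B * (1 - gam) / (2 * tail_const)) (m / (m - p))) as HR.
assert (Ha : 0 < amplitude) by (unfold amplitude; apply Rmin_glb_lt; lra).
split; [exact Ha | split; [apply Rmin_l |]].
assert (H3 : 3 * amplitude <= Rpower (B * (1 - gam) / (2 * tail_const)) (m / (m - p))).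
{ pose proof (Rmin_r (K0m / 4) (Rpower (B * (1 - gam) / (2 * tail_const)) (m / (m - p)) / 3)); fold amplitude in *; lra. }
apply Rpower_le_base with (a := (m - p) / m) in H3; [| lra | left; pos].
rewrite Rpower_mult in H3; replace (m / (m - p) * ((m - p) / m)) with 1 in H3 by (field; lra).
rewrite Rpower_1 in H3 by exact Hr.
apply Rmult_le_compat_l with (r := 2 * tail_const) in H3; [| lra].
eapply Rle_trans; [exact H3 |]; right; field; lra.
Qed.

Lemma matched_tail (P zt : R) :
  0 < P -> 0 < zt ->
  2 * tail_const * Rpower P ((m - p) / m) <= B * (1 - gam) -> 1 <= zt ->
  2 + 2 * tail_const * Rpower (2 / q) del / (B * (1 - gam)) <= q * zt * Rpower P (/ kap) ->
  exists M, 0 < M /\ sup_tail M zt = P /\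
    forall t, zt <= t -> exists ddP, is_derive (sup_tail M) t (d_sup_tail M t) /\
      is_derive (d_sup_tail M) t ddP /\ oper t (sup_tail M t) (d_sup_tail M t) ddP <= 0.
Proof.
intros HP Hz HPs Hz1 Hbig; pose proof q_pos as Hq; pose proof gam_bounds as Hg; pose proof kap_pos as Hk.
pose proof tail_const_pos as HC.
set (w := Rpower P (/ kap)) in *; assert (Hw : 0 < w) by apply Rpower_pos.
assert (HB : 0 < B * (1 - gam)) by nra.
set (N := 2 * tail_const * Rpower (2 / q) del / (B * (1 - gam))) in *.
assert (HN : 0 < N).
{ pose proof (Rpower_pos (2 / q) del); apply Rdiv_lt_0_compat; [nra | exact HB]. }
(* Solution of [sup_w] M zt = w, that is 1 + M zt^(-gam) = q zt w: the tail passes through height P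
   at zt. The assumed size of zt makes M at least N. *)
set (M := (q * zt * w - 1) * Rpower zt gam).
assert (HG1 : 1 <= Rpower zt gam).
{ rewrite <- (Rpower_O zt) by exact Hz; apply Rle_Rpower; lra. }
assert (HMN : N <= M) by (unfold M; nra).
assert (HM : 0 < M) by lra.
assert (Ed : decay M zt = q * zt * w - 1).
{ unfold decay, M; rewrite Rmult_assoc, <- Rpower_plus; replace (gam + - gam) with 0 by ring.
  rewrite Rpower_O by exact Hz; ring. }
assert (Ew : sup_w M zt = w) by (unfold sup_w; rewrite Ed; field; split; lra).
exists M; split; [exact HM | split].
- unfold sup_tail; rewrite Ew; unfold w; rewrite Rpower_mult, Rinv_l, Rpower_1; lra.
- intros t Ht; destruct (sup_tail_oper M t HM ltac:(lra)) as (ddP & D1 & D2 & HO).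
  exists ddP; split; [exact D1 | split; [exact D2 |]]; apply HO, (sup_tail_valid M zt t); try assumption.
  + rewrite Ew; unfold w; rewrite Rpower_mult; replace (/ kap * del) with ((m - p) / m); [exact HPs |].
    unfold kap, del; field; lra.
  + replace (2 * tail_const * Rpower (2 / q) del) with (B * (1 - gam) * N) by (unfold N; field; lra).
    scale.
Qed.
(** The constants are chosen in the order kp, La, z0, e2, e1, none of them depending on k0; only the
    slope k of the line and the crossing point zc do. The margin e1 above K0^m is therefore uniform
    in k0. *)
Lemma upper_barrier : exists K1, K0m < K1 /\ forall k0, 0 < k0 -> k0 <= K1 ->
  exists (G XG : R -> R) (zc zt e M c : R), 0 < zc /\ zc < zt /\ 0 < e /\ 0 < M /\
    (forall t, 0 < t -> continuous G t) /\
    (forall t, 0 < t -> t <= zc -> k0 <= G t /\ G t = k0 + c * t) /\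
    (forall t, zc <= t -> t <= zt -> e <= G t) /\
    (forall t, zt < t -> G t = sup_tail M t) /\
    (forall x y, solves_above G x y -> trap (fun t => 0 < t) G XG x y).
Proof.
pose proof K0m_pos as HK; pose proof q_pos as Hq; pose proof kap_pos as Hk; pose proof gam_bounds as Hg.
pose proof tail_const_pos as HC.
destruct amplitude_spec as (Hkp & HkpK & Hamp); set (kp := amplitude) in *.
set (De := K0m - kp); assert (HDe : 0 < De) by (unfold De; lra).
assert (Hm : 0 < 1 / m) by pos.
assert (HBb : 0 < B * b) by nra.
(* The first summand dominates the transport coefficient along the wave, whose height is at least
   kp; the second serves the comparison of exponentials; the third lets the drift surplus pay for
   the reaction. *)
set (La := B * (1 / m * Rpower kp (1 / m - 1)) + 2 + 4 * (B * b) / (a1 - 2)).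
assert (HLa1 : 0 < B * (1 / m * Rpower kp (1 / m - 1))).
{ pose proof (Rpower_pos kp (1 / m - 1)); repeat pos. }
assert (HLa2 : 0 < 4 * (B * b) / (a1 - 2)) by pos.
assert (HLa3 : 4 * (B * b) <= La * (a1 - 2)).
{ apply Rle_trans with (4 * (B * b) / (a1 - 2) * (a1 - 2)); [right; field; lra |].
  apply Rmult_le_compat_r; unfold La; lra. }
assert (HLa : 2 < La) by (unfold La; lra).
set (lam := 1 / m * Rpower (2 * K0m) (1 / m - 1)).
assert (Hlam : 0 < lam) by (pose proof (Rpower_pos (2 * K0m) (1 / m - 1)); pos).
(* The entries serve, in order, [wave_oper_sup], [line_oper_sup] on (0, 2 z0], and the bound e2 <=
   kp obtained from exp(-x) <= 1/x. *)
destruct (common_lower_bound (1 / 2 :: B * lam / (4 * (a1 + B * b)) :: kp * La / (4 * De) :: nil)) as (z0 & Hz0 & Hle).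
{ simpl; intros r Hr; decompose [or] Hr; subst; try tauto; pos. }
assert (Hz0a : z0 <= 1 / 2) by (apply Hle; simpl; tauto).
assert (Hz0b : 4 * (a1 + B * b) * z0 <= B * lam).
{ apply Rle_trans with (4 * (a1 + B * b) * (B * lam / (4 * (a1 + B * b)))); [| right; field; lra].
  apply Rmult_le_compat_l; [lra | apply Hle; simpl; tauto]. }
assert (Hz0c : 4 * De * z0 <= kp * La).
{ apply Rle_trans with (4 * De * (kp * La / (4 * De))); [| right; field; lra].
  apply Rmult_le_compat_l; [lra | apply Hle; simpl; tauto]. }
set (ps0 := exp (- (La / z0))); assert (Hps0 : 0 < ps0) by apply exp_pos.
set (e2 := 4 * De * ps0); assert (He2 : 0 < e2) by (unfold e2; nra).
assert (He2k : e2 <= kp).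
{ assert (HLz : 0 < La / z0) by pos.
  assert (Hp : ps0 <= z0 / La).
  { unfold ps0; rewrite exp_Ropp; replace (z0 / La) with (/ (La / z0)) by (field; lra).
    apply Rinv_le_contravar; [exact HLz |]; pose proof (exp_ineq1 (La / z0) ltac:(lra)); lra. }
  unfold e2; apply Rle_trans with (4 * De * (z0 / La)); [scale |].
  apply Rmult_le_reg_r with La; [lra |]; replace (4 * De * (z0 / La) * La) with (4 * De * z0) by (field; lra); exact Hz0c. }
(* At z0 the wave has height K0^m + 3 e2/4, while the line is at most K0^m + e1 + e2/2, that is K0^m
   + 5 e2/8; so the line still lies below. *)
set (e1 := e2 / 8).
exists (K0m + e1); split; [unfold e1; lra |]; intros k0 Hk0 Hk01.
(* At 2 z0 the line reaches K0^m + e1 + e2, above the supremum K0^m + e2 of the wave; the two cross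
   in between. *)
set (k := (K0m + e1 + e2 - k0) / (2 * z0)).
assert (Hkz : k * (2 * z0) = K0m + e1 + e2 - k0) by (unfold k; field; lra).
assert (Hke : e2 / (2 * z0) <= k) by (unfold k; apply Rmult_le_compat_r; [left; apply Rinv_0_lt_compat |]; lra).
assert (Hkpos : 0 < k) by (eapply Rlt_le_trans; [| exact Hke]; pos).
set (W := wave (K0m + e2) De La); set (Ln := fun t => k0 + k * t).
assert (HWd : forall t, 0 < t -> is_derive W t (d_wave De La t) /\ is_derive (d_wave De La) t (dd_wave De La t)).
{ intros t Ht; apply wave_derive, Ht. }
assert (HWlow : forall t, 0 < t -> kp <= W t).
{ intros t Ht; unfold W, wave; assert (exp (- (La / t)) <= 1).
  { rewrite <- exp_0; apply exp_le_mono; assert (0 < La / t) by pos; lra. }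
  unfold De in *; nra. }
assert (HWup : forall t, 0 < t -> W t < K0m + e2).
{ intros t Ht; unfold W, wave; pose proof (exp_pos (- (La / t))); nra. }
destruct (first_zero (fun t => W t - Ln t) z0 (2 * z0)) as (zc & Hzc & Hcross & _).
{ lra. }
{ intros t Ht; apply (continuous_Rminus W Ln).
  - exact (is_derive_cont W t _ (proj1 (HWd t ltac:(lra)))).
  - exact (is_derive_cont Ln t _ (proj1 (line_derive k0 k t))). }
{ unfold W, wave, Ln; fold ps0; unfold e1 in *; unfold e2 in *; nra. }
{ specialize (HWup (2 * z0) ltac:(lra)); unfold Ln; unfold e1 in *; lra. }
set (R1 := 2 + 2 * tail_const * Rpower (2 / q) del / (B * (1 - gam))).
set (w0 := Rpower kp (/ kap)); assert (Hw0 : 0 < w0) by apply Rpower_pos.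
(* The summands ensure, in order: zt lies beyond the crossing point; the wave has come down to 3 kp;
   at zt it is no steeper than the tail; the matched tail has a large enough M. *)
set (zt := 2 + De * La / kp + De * La / (kap * kp) + R1 / (q * w0)).
assert (HDL : 0 < De * La) by nra.
assert (HR1 : 0 < R1).
{ unfold R1; pose proof (Rpower_pos (2 / q) del).
  assert (0 < 2 * tail_const * Rpower (2 / q) del / (B * (1 - gam))) by pos; lra. }
assert (Hqw : 0 < q * w0) by pos.
assert (Hkk : 0 < kap * kp) by pos.
assert (Q1 : 0 < De * La / kp) by pos.
assert (Q2 : 0 < De * La / (kap * kp)) by pos.
assert (Q3 : 0 < R1 / (q * w0)) by pos.
assert (Hzt : 2 < zt) by (unfold zt; lra).
assert (Hzt1 : De * La / zt <= kp).
{ apply Rmult_le_reg_r with (zt / kp); [pos |].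
  replace (De * La / zt * (zt / kp)) with (De * La / kp) by (field; lra).
  replace (kp * (zt / kp)) with zt by (field; lra); unfold zt; lra. }
assert (Hzt2 : De * La / zt <= kap * kp).
{ apply Rmult_le_reg_r with (zt / (kap * kp)); [pos |].
  replace (De * La / zt * (zt / (kap * kp))) with (De * La / (kap * kp)) by (field; lra).
  replace (kap * kp * (zt / (kap * kp))) with zt by (field; lra); unfold zt; lra. }
assert (HW3 : W zt <= 3 * kp).
{ unfold W, wave; pose proof (exp_ineq1_le (- (La / zt))).
  assert (De * (1 + - (La / zt)) <= De * exp (- (La / zt))) by scale.
  replace (De * La / zt) with (De * (La / zt)) in Hzt1 by (field; lra); unfold De in *; lra. }
pose proof (HWlow zt ltac:(lra)) as HWzt.
destruct (matched_tail (W zt) zt) as (M & HM & HMz & HMt); [lra | lra | | lra | |].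
{ eapply Rle_trans; [| exact Hamp]; apply Rmult_le_compat_l; [lra |].
  apply Rpower_le_base; [lra | exact HW3 | left; pos]. }
{ fold R1; apply Rle_trans with (q * zt * w0).
  - apply Rle_trans with (R1 / (q * w0) * (q * w0)); [right; field; lra |].
    replace (q * zt * w0) with (zt * (q * w0)) by ring; apply Rmult_le_compat_r; unfold zt; lra.
  - apply Rmult_le_compat_l; [apply Rmult_le_pos; lra |].
    apply Rpower_le_base; [lra | exact HWzt | left; pos]. }
set (G := glue zc Ln (glue zt W (sup_tail M))).
set (XG := glue zc (momentum Ln (fun _ => k)) (glue zt (momentum W (d_wave De La)) (momentum (sup_tail M) (d_sup_tail M)))).
assert (EG1 : forall t, t <= zc -> G t = Ln t) by (intros t Ht; apply glue_left, Ht).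
assert (EI2 : forall t, t <= zt -> glue zt W (sup_tail M) t = W t) by (intros t Ht; apply glue_left, Ht).
assert (EI3 : forall t, zt <= t -> glue zt W (sup_tail M) t = sup_tail M t).
{ intros t Ht; apply glue_right_le; [symmetry; exact HMz | exact Ht]. }
assert (EG2 : forall t, zc <= t -> G t = glue zt W (sup_tail M) t).
{ intros t Ht; apply glue_right_le; [rewrite EI2 by lra; lra | exact Ht]. }
assert (HLnK : forall t, 0 < t -> t <= 2 * z0 -> oper t (Ln t) k 0 <= 0).
{ intros t Ht Ht2.
  refine (line_oper_sup k0 k e1 (2 * z0) t Hk0 Hkpos Hk01 _ Ht Ht2 _ _ _); fold lam;
    [unfold e1; lra | rewrite Hkz; unfold e1 in *; lra | lra |].
  apply Rle_trans with (e2 / (2 * z0) * lam); [| scale].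
    apply Rmult_le_reg_r with (2 * z0); [lra |].
    replace (e2 / (2 * z0) * lam * (2 * z0)) with (e2 * lam) by (field; lra).
    assert (Hbz : 4 * b * z0 <= lam).
    { apply Rmult_le_reg_l with B; [lra |]; eapply Rle_trans; [| exact Hz0b].
      assert (0 <= a1 * z0) by (apply Rmult_le_pos; lra); lra. }
    unfold e1; assert (e2 * (4 * b * z0) <= e2 * lam) by scale.
    assert (0 <= e2 * (b * z0)) by (apply Rmult_le_pos; [lra | apply Rmult_le_pos; lra]); lra. }
exists G, XG, zc, zt, kp, M, k; split; [lra | split; [lra | split; [lra | split; [exact HM |]]]].
split; [| split; [| split; [| split]]].
- intros t Ht; apply glue_continuous.
  + rewrite EI2 by lra; lra.
  + intros _; exact (is_derive_cont Ln t _ (proj1 (line_derive k0 k t))).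
  + intros Hct; apply glue_continuous; [symmetry; exact HMz | |].
    * intros _; exact (is_derive_cont W t _ (proj1 (HWd t Ht))).
    * intros Hzt'; destruct (HMt t Hzt') as (d & D1 & _); exact (is_derive_cont (sup_tail M) t _ D1).
- intros t Ht Htc; rewrite EG1 by assumption; split; [| reflexivity].
  unfold Ln; assert (0 <= k * t) by (apply Rmult_le_pos; lra); lra.
- intros t H1 H2; rewrite EG2, EI2 by assumption; apply HWlow; lra.
- intros t Ht; rewrite EG2, EI3 by lra; reflexivity.
- intros x y HS.
  apply trap_subset with (fun t => (0 < t <= zc) \/ ((zc <= t <= zt) \/ zt <= t)).
  { intros t Ht; destruct (Rle_lt_dec t zc); [left; lra |]; destruct (Rle_lt_dec t zt); right; [left | right]; lra. }
  assert (T1 : trap (fun t => 0 < t <= zc) Ln (momentum Ln (fun _ => k)) x y).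
  { apply (barrier_above _ G); [intros; lra | | | exact HS]; intros t Ht.
    - split; [lra | split; [| apply EG1; lra]].
      unfold Ln; assert (0 <= k * t) by (apply Rmult_le_pos; lra); lra.
    - exists 0; destruct (line_derive k0 k t) as [D1 D2]; split; [exact D1 | split; [exact D2 | apply HLnK; lra]]. }
  assert (T2 : trap (fun t => zc <= t <= zt) W (momentum W (d_wave De La)) x y).
  { apply (barrier_above _ G); [intros; lra | | | exact HS]; intros t Ht.
    - specialize (HWlow t ltac:(lra)); split; [lra | split; [lra | rewrite EG2 by lra; apply EI2; lra]].
    - destruct (HWd t ltac:(lra)) as [D1 D2]; exists (dd_wave De La t); split; [exact D1 | split; [exact D2 |]].
      refine (wave_oper_sup kp e2 La z0 t Hkp _ Hz0 _ _ eq_refl Hz0a _ _ HLa3); try lra; unfold La; lra. }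
  assert (T3 : trap (fun t => zt <= t) (sup_tail M) (momentum (sup_tail M) (d_sup_tail M)) x y).
  { apply (barrier_above _ G); [intros; lra | | exact HMt | exact HS]; intros t Ht.
    split; [lra | split; [apply Rpower_pos | rewrite EG2 by lra; apply EI3, Ht]]. }
  apply trap_glue; try (intros; lra); try assumption.
  + rewrite EI2 by lra; lra.
  + rewrite glue_left by lra; apply momentum_le; [lra |].
    unfold d_wave; assert (0 < De * La / (zc * zc) * exp (- (La / zc))); [| lra].
    apply Rmult_lt_0_compat; [pos | apply exp_pos].
  + apply trap_glue; try (intros; lra); try assumption.
    (* The tail falls with logarithmic slope at least kap in size from a height at least kp; the
       wave is almost level at zt. So the kink is concave. *)
    apply momentum_le; [lra |].
    unfold d_sup_tail, d_wave, sup_slope; rewrite HMz.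
    pose proof (frac_bounds M zt HM) as HF.
    assert (A1 : exp (- (La / zt)) <= 1).
    { rewrite <- exp_0; apply exp_le_mono; assert (0 < La / zt) by pos; lra. }
    assert (A2 : De * La / (zt * zt) * exp (- (La / zt)) <= kap * kp / zt).
    { apply Rle_trans with (De * La / (zt * zt) * 1).
      - apply Rmult_le_compat_l; [left; pos | exact A1].
      - replace (De * La / (zt * zt) * 1) with (De * La / zt / zt) by (field; lra).
        apply Rmult_le_compat_r; [left; pos | exact Hzt2]. }
    assert (A3 : kap * kp / zt <= kap * W zt * (1 + gam * frac M zt) / zt).
    { apply Rmult_le_compat_r; [left; pos |].
      assert (0 <= gam * frac M zt) by (apply Rmult_le_pos; lra).
      assert (kap * kp <= kap * W zt) by scale.
      assert (0 <= kap * W zt * (gam * frac M zt)) by (apply Rmult_le_pos; [apply Rmult_le_pos |]; lra); lra. }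
    replace (kap * W zt * - (1 + gam * frac M zt) / zt) with (- (kap * W zt * (1 + gam * frac M zt) / zt)) by (field; lra); lra.
Qed.

(** * Construction of the lower barrier *)

Lemma sub_w_mono M s t : 0 < M -> 0 < s -> s <= t -> sub_w M t <= sub_w M s.
Proof.
intros HM Hs Hst; pose proof (decay_pos M s HM); pose proof q_pos; pose proof gam_bounds as Hg.
unfold sub_w; apply Rinv_le_contravar.
{ pos. }
assert (E : forall r, 0 < r -> q * r * (1 + decay M r) = q * (r + M * Rpower r (1 - gam))).
{ intros r Hr; unfold decay; unfold Rminus; rewrite Rpower_plus, Rpower_1 by exact Hr; ring. }
rewrite !E by lra; apply Rmult_le_compat_l; [lra |]; apply Rplus_le_compat; [exact Hst |].
apply Rmult_le_compat_l; [lra |]; apply Rpower_le_base; lra.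
Qed.

Lemma sub_w_le M t : 0 < M -> 0 < t -> sub_w M t <= / (q * t).
Proof.
intros HM Ht; pose proof (decay_pos M t HM); pose proof q_pos.
assert (0 < q * t) by pos.
unfold sub_w; apply Rinv_le_contravar; [lra |]; assert (0 < q * t * decay M t) by pos; lra.
Qed.

(** For t <= 1, [decay] is at least M while w is at most its value at z; for t > 1, w <= 1/(q t) and
    t^(-del) <= t^(-gam). In both cases a large M suffices. *)
Lemma sub_tail_valid M z t :
  0 < M -> 0 < z -> z <= t ->
  tail_const * Rpower (sub_w M z) del <= B * (1 - gam) * M ->
  tail_const * Rpower (/ q) del <= B * (1 - gam) * M ->
  tail_const * Rpower (sub_w M t) del <= B * (1 - gam) * decay M t.
Proof.
intros HM Hz Hzt H1 H2; pose proof tail_const_pos; pose proof gam_bounds; pose proof del_pos; pose proof q_pos as Hq.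
assert (Ht : 0 < t) by lra; pose proof (sub_w_derive M t HM Ht) as [Hw _].
assert (HB : 0 < B * (1 - gam)) by nra.
destruct (Rle_lt_dec t 1) as [Hc | Hc].
- eapply Rle_trans; [apply Rmult_le_compat_l; [lra |]; apply Rpower_le_base; [exact Hw | apply sub_w_mono with (s := z); assumption | lra] |].
  eapply Rle_trans; [exact H1 |]; apply Rmult_le_compat_l; [lra |]; unfold decay.
  assert (1 <= Rpower t (- gam)); [| nra].
  replace 1 with (Rpower 1 (- gam)); [apply Rpower_neg_le_base; lra |].
  unfold Rpower; rewrite ln_1, Rmult_0_r; apply exp_0.
- pose proof (Rpower_le_base _ _ del Hw (sub_w_le M t HM Ht) ltac:(lra)) as HWt.
  assert (Hiq : 0 < / q) by pos; assert (Hit : 0 < / t) by pos.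
  rewrite Rinv_mult, <- Rpower_mult_distr in HWt by assumption.
  assert (Et : Rpower (/ t) del = Rpower t (- del)).
  { rewrite <- Rpower_m1 by exact Ht; rewrite Rpower_mult; f_equal; ring. }
  assert (Hle : Rpower t (- del) <= Rpower t (- gam)) by (apply Rle_Rpower; lra).
  rewrite Et in HWt; pose proof (Rpower_pos (/ q) del) as HQ; set (Q := Rpower (/ q) del) in *.
  unfold decay; set (T := Rpower t (- gam)) in *; assert (HT : 0 < T) by apply Rpower_pos.
  apply Rle_trans with (tail_const * (Q * T)).
  + apply Rmult_le_compat_l; [lra |]; eapply Rle_trans; [exact HWt | scale].
  + replace (tail_const * (Q * T)) with (tail_const * Q * T) by ring.
    replace (B * (1 - gam) * (M * T)) with (B * (1 - gam) * M * T) by ring.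
    scale.
Qed.

(** The parameters zA and e keep the barrier below the upper one: it never exceeds k0, and from zA
    on it stays under e. [NG] is the negative of G in glued form, since [trap_glue] yields a [glue]
    of negatives, which agrees with - G only pointwise. *)
Lemma lower_barrier k0 zA e : 0 < k0 -> 0 < zA -> 0 < e ->
  exists (G NG XG : R -> R) (zc M c : R), 0 < zc /\ 0 < M /\ 0 < c /\ zc <= zA /\
    (forall t, 0 < t -> continuous G t) /\ (forall t, 0 < t -> 0 < G t <= k0) /\
    (forall t, 0 < t -> t <= zc -> G t = k0 + - c * t) /\
    (forall t, zc <= t -> G t = sub_tail M t) /\
    (forall t, zA <= t -> G t <= e) /\
    (forall t, NG t = - G t) /\
    (forall x y, solves_below G x y -> trap (fun t => 0 < t) NG XG (fun t => - x t) (fun t => - y t)).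
Proof.
intros Hk0 HzA He.
pose proof q_pos as Hq; pose proof kap_pos as Hk; pose proof gam_bounds as Hg; pose proof tail_const_pos as HC.
assert (HB : 0 < B * (1 - gam)) by nra.
assert (Hm : 0 < 1 / m) by pos.
(* Height at the junction, chosen so that a line falling from k0 to k1 has there the logarithmic
   slope -kap of the pure power t^(-kap). The tail is slightly flatter, which makes the kink
   convex. *)
set (k1 := k0 / (1 + kap)); assert (Hk1 : 0 < k1) by pos.
set (w := Rpower k1 (/ kap)); assert (Hw : 0 < w) by apply Rpower_pos.
set (we := Rpower e (/ kap)); assert (Hwe : 0 < we) by apply Rpower_pos.
set (lam := 1 / m * Rpower k0 (1 / m - 1)).
assert (Hlam : 0 < lam) by (pose proof (Rpower_pos k0 (1 / m - 1)); pos).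
(* Y1, Y2, Y3 are lower bounds for M: the first two give the subsolution property before and after t
   = 1, the third makes the tail at zA at most e. *)
set (Y1 := tail_const * Rpower w del / (B * (1 - gam))).
set (Y2 := tail_const * Rpower (/ q) del / (B * (1 - gam))).
set (Y3 := / (q * Rpower zA (1 - gam) * we)).
assert (HY1 : 0 < Y1) by (apply Rdiv_lt_0_compat; [apply Rmult_lt_0_compat; [exact HC | apply Rpower_pos] | exact HB]).
assert (HY2 : 0 < Y2) by (apply Rdiv_lt_0_compat; [apply Rmult_lt_0_compat; [exact HC | apply Rpower_pos] | exact HB]).
assert (HY3 : 0 < Y3).
{ apply Rinv_0_lt_compat; pose proof (Rpower_pos zA (1 - gam)); pos. }
set (Rr := / (q * w)); assert (HRr : 0 < Rr) by (apply Rinv_0_lt_compat, Rmult_lt_0_compat; lra).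
set (X := 2 * (Y1 + Y2 + Y3) / Rr); assert (HX : 0 < X) by pos.
set (ta := kap / (1 + kap)); assert (Hta : 0 < ta) by pos.
pose proof (Rpower_pos k0 (p / m)) as Hkpm.
(* The first three entries make M large, the fourth places the junction before zA, and the last two
   are the conditions of [line_oper_sub], the final one because the slope ta k0 / zc grows as zc
   shrinks. *)
destruct (common_lower_bound (1 :: Rr / 2 :: Rpower X (-2) :: zA :: B * lam / (2 * a1) :: ta * k0 * lam / (2 * Rpower k0 (p / m)) :: nil))
  as (zc & Hzc & Hle).
{ simpl; intros r Hr; decompose [or] Hr; subst; try tauto; pos. }
assert (Z1 : zc <= 1) by (apply Hle; simpl; tauto).
assert (Z2 : zc <= Rr / 2) by (apply Hle; simpl; tauto).
assert (Z3 : zc <= Rpower X (-2)) by (apply Hle; simpl; tauto).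
assert (Z4 : zc <= zA) by (apply Hle; simpl; tauto).
assert (Z5 : zc <= B * lam / (2 * a1)) by (apply Hle; simpl; tauto).
assert (Z6 : zc <= ta * k0 * lam / (2 * Rpower k0 (p / m))) by (apply Hle; simpl; tauto).
set (k := ta * k0 / zc); assert (Hkp : 0 < k) by (apply Rdiv_lt_0_compat; [apply Rmult_lt_0_compat |]; lra).
assert (Hkz : k * zc = ta * k0) by (unfold k; field; lra).
assert (Hk1' : k0 - k * zc = k1) by (rewrite Hkz; unfold ta, k1; field; lra).
(* Solution of [sub_w] M zc = w, that is q zc (1 + M zc^(-gam)) = 1/w. *)
set (M := (Rr - zc) * Rpower zc (gam - 1)).
(* M tends to infinity as zc tends to 0. Since gam <= 1/2 and zc <= 1, zc^(gam-1) >= zc^(-1/2), and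
   this is at least X once zc <= X^(-2). *)
assert (HMbig : Y1 + Y2 + Y3 <= M).
{ assert (HXz : X <= Rpower zc (gam - 1)).
  { apply Rle_trans with (Rpower zc (- (1 / 2))).
    - replace X with (Rpower (Rpower X (-2)) (- (1 / 2))).
      + apply Rpower_neg_le_base; lra.
      + rewrite Rpower_mult; replace (-2 * - (1 / 2)) with 1 by lra; apply Rpower_1, HX.
    - destruct (Req_dec zc 1) as [-> | Hne].
      + right; unfold Rpower; rewrite ln_1, !Rmult_0_r; reflexivity.
      + unfold Rpower; apply exp_le_mono.
        assert (ln zc < 0) by (rewrite <- ln_1; apply ln_increasing; lra); nra. }
  apply Rle_trans with (Rr / 2 * X); [right; unfold X; field; lra |].
  apply Rmult_le_compat; lra. }
assert (HM : 0 < M) by lra.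
assert (Ed : decay M zc = Rr / zc - 1).
{ unfold decay, M; rewrite Rmult_assoc, <- Rpower_plus; replace (gam - 1 + - gam) with (-1) by ring.
  rewrite Rpower_m1 by exact Hzc; field; lra. }
assert (Ew : sub_w M zc = w) by (unfold sub_w; rewrite Ed; unfold Rr; field; repeat split; lra).
assert (Et : sub_tail M zc = k1).
{ unfold sub_tail; rewrite Ew; unfold w; rewrite Rpower_mult, Rinv_l, Rpower_1; lra. }
assert (HT : forall t, zc <= t -> exists ddP, is_derive (sub_tail M) t (d_sub_tail M t) /\
   is_derive (d_sub_tail M) t ddP /\ 0 <= oper t (sub_tail M t) (d_sub_tail M t) ddP).
{ intros t Ht; destruct (sub_tail_oper M t HM ltac:(lra)) as (ddP & D1 & D2 & HO).
  exists ddP; split; [exact D1 | split; [exact D2 |]]; apply HO, (sub_tail_valid M zc t HM Hzc Ht).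
  - rewrite Ew; replace (tail_const * Rpower w del) with (B * (1 - gam) * Y1) by (unfold Y1; field; lra).
    scale.
  - replace (tail_const * Rpower (/ q) del) with (B * (1 - gam) * Y2) by (unfold Y2; field; lra).
    scale. }
assert (Htmono : forall s t, 0 < s -> s <= t -> sub_tail M t <= sub_tail M s).
{ intros s t Hs Hst; apply Rpower_le_base; [apply sub_w_derive; lra | apply sub_w_mono; assumption | lra]. }
set (Ln := fun t => k0 + - k * t).
assert (HLn : forall t, 0 < t -> t <= zc -> k1 <= Ln t <= k0).
{ intros t Ht Htz; unfold Ln; assert (k * t <= k * zc) by scale.
  assert (0 <= k * t) by (apply Rmult_le_pos; lra); lra. }
assert (HLo : forall t, 0 < t -> t <= zc -> 0 <= oper t (Ln t) (- k) 0).
{ intros t Ht Htz; refine (line_oper_sub k0 k zc t Hk0 Hkp Ht Htz _ _ _); fold lam.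
  - specialize (HLn t Ht Htz); unfold Ln in HLn; lra.
  - apply Rle_trans with (2 * a1 * (B * lam / (2 * a1))); [scale | right; field; lra].
  - apply Rmult_le_reg_r with zc; [exact Hzc |]; replace (k * lam * zc) with (ta * k0 * lam) by (unfold k; field; lra).
    apply Rle_trans with (2 * Rpower k0 (p / m) * (ta * k0 * lam / (2 * Rpower k0 (p / m)))); [scale | right; field; lra]. }
set (G := glue zc Ln (sub_tail M)).
assert (EG1 : forall t, t <= zc -> G t = Ln t) by (intros t Ht; apply glue_left, Ht).
assert (EG2 : forall t, zc <= t -> G t = sub_tail M t).
{ intros t Ht; apply glue_right_le; [rewrite Et; unfold Ln; lra | exact Ht]. }
exists G, (glue zc (fun t => - Ln t) (fun t => - sub_tail M t)),
  (glue zc (fun t => - momentum Ln (fun _ => - k) t) (fun t => - momentum (sub_tail M) (d_sub_tail M) t)), zc, M, k.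
split; [exact Hzc | split; [exact HM | split; [exact Hkp | split; [exact Z4 |]]]].
split; [| split; [| split; [| split; [| split; [| split]]]]].
- intros t Ht; apply glue_continuous; [rewrite Et; unfold Ln; lra | |].
  + intros _; exact (is_derive_cont Ln t _ (proj1 (line_derive k0 (- k) t))).
  + intros Hct; destruct (HT t Hct) as (d & D1 & _); exact (is_derive_cont (sub_tail M) t _ D1).
- intros t Ht; destruct (Rle_lt_dec t zc) as [H | H].
  + rewrite EG1 by exact H; specialize (HLn t Ht H); lra.
  + rewrite EG2 by lra; split; [apply Rpower_pos |].
    apply Rle_trans with k1; [rewrite <- Et; apply Htmono; lra |]; specialize (HLn zc Hzc ltac:(lra)); lra.
- intros t Ht Htz; apply EG1, Htz.
- exact EG2.
- intros t Ht; rewrite EG2 by lra; apply Rle_trans with (sub_tail M zA); [apply Htmono; lra |].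
  unfold sub_tail; replace e with (Rpower we kap) by (unfold we; rewrite Rpower_mult, Rinv_l, Rpower_1; lra).
  apply Rpower_le_base; [apply sub_w_derive; lra | | lra].
  assert (Hpz : 0 < Rpower zA (1 - gam)) by apply Rpower_pos.
  unfold sub_w; rewrite <- (Rinv_inv we); apply Rinv_le_contravar; [apply Rinv_0_lt_compat, Hwe |].
  apply Rle_trans with (q * (Rpower zA (1 - gam)) * Y3); [right; unfold Y3; field; repeat split; lra |].
  replace (q * zA * (1 + decay M zA)) with (q * zA + q * Rpower zA (1 - gam) * M).
  + assert (0 < q * zA) by pos.
    assert (q * Rpower zA (1 - gam) * Y3 <= q * Rpower zA (1 - gam) * M); [| lra].
    apply Rmult_le_compat_l; [apply Rmult_le_pos |]; lra.
  + unfold decay, Rminus; rewrite Rpower_plus, Rpower_1 by lra; ring.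
- intros t; unfold G, glue; destruct (Rle_dec t zc); reflexivity.
- intros x y HS.
  apply trap_subset with (fun t => (0 < t <= zc) \/ zc <= t).
  { intros t Ht; destruct (Rle_lt_dec t zc); [left | right]; lra. }
  apply trap_glue; try (intros; lra).
  + rewrite Et; unfold Ln; lra.
  + apply Ropp_le_contravar, momentum_le; [rewrite Et; unfold Ln; lra |].
    unfold d_sub_tail, sub_slope; rewrite Et; pose proof (frac_bounds M zc HM) as HF.
    replace k with (kap * k1 / zc) by (unfold k, k1, ta; field; lra).
    replace (kap * k1 * - (1 - gam * frac M zc) / zc) with (- (kap * k1 / zc) + kap * k1 / zc * (gam * frac M zc)) by (field; lra).
    assert (0 <= kap * k1 / zc * (gam * frac M zc)); [| lra].
    apply Rmult_le_pos; [left; apply Rdiv_lt_0_compat; [apply Rmult_lt_0_compat |]; lra | apply Rmult_le_pos; lra].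
  + apply (barrier_below _ G); [intros; lra | | | exact HS]; intros t Ht.
    * specialize (HLn t ltac:(lra) ltac:(lra)); split; [lra | split; [lra | apply EG1; lra]].
    * exists 0; destruct (line_derive k0 (- k) t) as [D1 D2]; split; [exact D1 | split; [exact D2 | apply HLo; lra]].
  + apply (barrier_below _ G); [intros; lra | | exact HT | exact HS]; intros t Ht.
    split; [lra | split; [apply Rpower_pos | apply EG2, Ht]].
Qed.

(** * Existence of a solution between the two barriers *)

Lemma Rpower_lipschitz c lo hi : 0 < lo -> lo <= hi -> exists L, 0 < L /\
  forall x y, lo <= x <= hi -> lo <= y <= hi -> Rabs (Rpower x c - Rpower y c) <= L * Rabs (x - y).
Proof.
intros Hlo Hlh.
destruct (continuous_bounded (fun x => c * Rpower x (c - 1)) lo hi Hlh) as (L & HL & HB).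
{ intros t Ht; apply (continuous_Rmult (fun _ => c)); [apply continuous_const |].
  exact (is_derive_cont _ t _ (is_derive_Rpower_id t (c - 1) ltac:(lra))). }
exists L; split; [exact HL |].
assert (H : forall x y, lo <= x <= hi -> lo <= y <= hi -> x < y -> Rabs (Rpower y c - Rpower x c) <= L * Rabs (y - x)).
{ intros x y Hx Hy Hxy.
  destruct (mvt_closed (fun t => Rpower t c) (fun x => c * Rpower x (c - 1)) x y Hxy) as (z & Hz1 & Hz2).
  { intros t Ht; apply is_derive_Rpower_id; lra. }
  rewrite Hz2, Rabs_mult; apply Rmult_le_compat_r; [apply Rabs_pos | apply HB; lra]. }
intros x y Hx Hy; destruct (Rtotal_order x y) as [Hxy | [-> | Hxy]].
- rewrite Rabs_minus_sym, (Rabs_minus_sym x); apply H; assumption.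
- rewrite !Rminus_diag, Rabs_R0; lra.
- apply H; assumption.
Qed.

Lemma Rpower_continuous_at (x : R -> R) c t : 0 < x t -> continuous x t -> continuous (fun s => Rpower (x s) c) t.
Proof.
intros Hx Hc; apply (continuous_comp x (fun s => Rpower s c)); [exact Hc |].
exact (is_derive_cont _ _ _ (is_derive_Rpower_id (x t) c Hx)).
Qed.

Lemma Rpower_id_continuous c t : 0 < t -> continuous (fun s => Rpower s c) t.
Proof. intros Ht; exact (is_derive_cont _ _ _ (is_derive_Rpower_id t c Ht)). Qed.

Lemma inv_continuous t : 0 < t -> continuous (fun s => / s) t.
Proof. intros Ht; apply (is_derive_cont _ t (- / (t * t))); auto_derive; [lra | field; lra]. Qed.

Section Between.

Variables lo hi : R -> R.
Hypothesis lo_pos : forall t, 0 < t -> 0 < lo t.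
Hypothesis lohi : forall t, 0 < t -> lo t <= hi t.
Hypothesis lo_cont : forall t, 0 < t -> continuous lo t.
Hypothesis hi_cont : forall t, 0 < t -> continuous hi t.

Lemma between_range a b0 : 0 < a -> a <= b0 -> exists e H, 0 < e /\ e <= H /\
  forall t, a <= t <= b0 -> e <= lo t /\ hi t <= H.
Proof.
intros Ha Hab.
destruct (continuous_pos_lower lo a b0 Hab) as (e & He & Hl); [intros; apply lo_cont; lra | intros; apply lo_pos; lra |].
destruct (continuous_bounded hi a b0 Hab) as (H & HH & Hh); [intros; apply hi_cont; lra |].
exists e, H; split; [exact He | split].
- specialize (Hl a ltac:(lra)); specialize (Hh a ltac:(lra)); specialize (lohi a Ha).
  apply Rabs_le_between in Hh; lra.
- intros t Ht; specialize (Hh t Ht); apply Rabs_le_between in Hh; split; [apply Hl, Ht | lra].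
Qed.

Lemma Gam_continuous_between : continuous_between lo hi diff_Gam.
Proof.
intros x t Ht Hx Hb; unfold diff_Gam.
assert (Hxt : 0 < x t) by (specialize (Hb t Ht); specialize (lo_pos t Ht); lra).
apply (continuous_Rmult (fun s => B * Rpower (x s) (1 / m))).
- apply (continuous_Rmult (fun _ => B)); [apply continuous_const | apply Rpower_continuous_at; assumption].
- apply (is_derive_cont _ t (- (2 * / (t * t * t)))); auto_derive; [nra | field; lra].
Qed.

Lemma Psi_continuous_between : continuous_between lo hi diff_Psi.
Proof.
intros x t Ht Hx Hb; unfold diff_Psi.
assert (Hxt : 0 < x t) by (specialize (Hb t Ht); specialize (lo_pos t Ht); lra).
apply (continuous_Rmult (fun s => - B * Rpower s (a1 - 2))).
- apply (continuous_Rmult (fun _ => - B)); [apply continuous_const | apply Rpower_id_continuous, Ht].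
- apply (continuous_Rminus (fun s => (a1 - 2) * Rpower (x s) (1 / m) / s + b * x s)).
  + apply (continuous_Rplus (fun s => (a1 - 2) * Rpower (x s) (1 / m) / s)).
    * apply (continuous_Rmult (fun s => (a1 - 2) * Rpower (x s) (1 / m))); [| apply inv_continuous, Ht].
      apply (continuous_Rmult (fun _ => a1 - 2)); [apply continuous_const | apply Rpower_continuous_at; assumption].
    * apply (continuous_Rmult (fun _ => b)); [apply continuous_const | exact Hx].
  + apply Rpower_continuous_at; assumption.
Qed.

Lemma Gam_lipschitz_between : lipschitz_between lo hi diff_Gam.
Proof.
intros a b0 Ha Hab; destruct (between_range a b0 Ha Hab) as (e & H & He & HeH & Hr).
destruct (Rpower_lipschitz (1 / m) e H He HeH) as (L & HL & HLip).
assert (Hia : 0 < / (a * a)) by (apply Rinv_0_lt_compat; nra).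
exists (B * L * / (a * a)); split; [repeat pos |].
intros t x y Ht Hx Hy; destruct (Hr t Ht); specialize (HLip x y ltac:(lra) ltac:(lra)).
unfold diff_Gam.
replace (B * Rpower x (1 / m) / (t * t) - B * Rpower y (1 / m) / (t * t))
  with (/ (t * t) * (B * (Rpower x (1 / m) - Rpower y (1 / m)))) by (field; lra).
assert (Hit : 0 < / (t * t)) by (apply Rinv_0_lt_compat; nra).
assert (Hita : / (t * t) <= / (a * a)) by (apply Rinv_le_contravar; nra).
rewrite !Rabs_mult, (Rabs_pos_eq (/ (t * t))), (Rabs_pos_eq B) by lra.
replace (B * L * / (a * a) * Rabs (x - y)) with (/ (a * a) * (B * (L * Rabs (x - y)))) by ring.
apply Rmult_le_compat; [lra | apply Rmult_le_pos; [lra | apply Rabs_pos] | exact Hita | scale].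
Qed.

Lemma Psi_lipschitz_between : lipschitz_between lo hi diff_Psi.
Proof.
intros a b0 Ha Hab; destruct (between_range a b0 Ha Hab) as (e & H & He & HeH & Hr).
destruct (Rpower_lipschitz (1 / m) e H He HeH) as (L & HL & HLip).
destruct (Rpower_lipschitz (p / m) e H He HeH) as (L' & HL' & HLip').
destruct (continuous_bounded (fun s => Rpower s (a1 - 2)) a b0 Hab) as (T & HT & HTb);
  [intros; apply Rpower_id_continuous; lra |].
assert (Hia : 0 < / a) by pos.
set (K := (a1 - 2) * L * / a + b + L').
assert (HK : 0 < K) by (unfold K; assert (0 < (a1 - 2) * L * / a) by (repeat pos); lra).
exists (B * T * K); split; [repeat pos |].
intros t x y Ht Hx Hy; destruct (Hr t Ht); specialize (HLip x y ltac:(lra) ltac:(lra)).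
specialize (HLip' x y ltac:(lra) ltac:(lra)); specialize (HTb t Ht); unfold diff_Psi.
replace (- B * Rpower t (a1 - 2) * ((a1 - 2) * Rpower x (1 / m) / t + b * x - Rpower x (p / m)) -
   - B * Rpower t (a1 - 2) * ((a1 - 2) * Rpower y (1 / m) / t + b * y - Rpower y (p / m)))
  with (- (B * Rpower t (a1 - 2) * (((a1 - 2) * / t * (Rpower x (1 / m) - Rpower y (1 / m)) + b * (x - y)) + - (Rpower x (p / m) - Rpower y (p / m))))) by (field; lra).
assert (Hit : 0 < / t) by pos.
assert (Hita : / t <= / a) by (apply Rinv_le_contravar; lra).
rewrite Rabs_Ropp, !Rabs_mult, (Rabs_pos_eq B), (Rmult_assoc (B * T)) by lra.
apply Rmult_le_compat; [apply Rmult_le_pos; [lra | apply Rabs_pos] | apply Rabs_pos | scale |].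
eapply Rle_trans; [apply Rabs_triang |]; rewrite Rabs_Ropp.
eapply Rle_trans; [apply Rplus_le_compat_r, Rabs_triang |].
rewrite !Rabs_mult, (Rabs_pos_eq b), (Rabs_pos_eq (/ t)), (Rabs_pos_eq (a1 - 2)) by lra.
set (D := Rabs (x - y)) in *; set (U := Rabs (Rpower x (1 / m) - _)) in *.
assert (HU : (a1 - 2) * / t * U <= (a1 - 2) * / a * (L * D)).
{ apply Rmult_le_compat; [apply Rmult_le_pos; lra | apply Rabs_pos | scale | exact HLip]. }
unfold K; lra.
Qed.

(** Outside the strip [clip] returns the barrier itself, so the truncated system satisfies
    [solves_above] or [solves_below]. The second half of [trap] then gives the momentum inequality
    after a crossing, and the first half forbids a return. *)
Lemma solution_between_barriers :
  (forall x y, solves_above hi x y -> exists XG, trap (fun t => 0 < t) hi XG x y) ->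
  (forall x y, solves_below lo x y -> exists XG, trap (fun t => 0 < t) (fun t => - lo t) XG (fun t => - x t) (fun t => - y t)) ->
  exists x y, (forall t, 0 < t -> lo t <= x t <= hi t) /\
    forall t, 0 < t -> is_derive x t (diff_phi t * y t + diff_Gam t (x t)) /\ is_derive y t (diff_Psi t (x t)).
Proof.
intros Hhi Hlo.
assert (Hsc : forall x y, is_solution (trunc1 lo hi diff_phi diff_Gam) (trunc2 lo hi diff_Psi) x y ->
  forall t, 0 < t -> continuous x t).
{ intros x y HS t Ht; exact (is_derive_cont _ _ _ (proj1 (HS t Ht))). }
apply solution_between; try assumption.
- intros t Ht; apply Rpower_id_continuous, Ht.
- intros t _; apply diff_phi_pos.
- apply Gam_continuous_between.
- apply Psi_continuous_between.
- apply Gam_lipschitz_between.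
- apply Psi_lipschitz_between.
- intros x y HS t0 t1 t2 H0 H01 H12 Hx0 Hx1.
  destruct (Hhi x y) as [XG [St En]].
  { split; [apply (Hsc x y HS) |]; intros t Ht Hle; destruct (HS t Ht) as [D1 D2].
    unfold trunc1, trunc2 in D1, D2; rewrite clip_above in D1, D2 by (auto; lra); split; assumption. }
  apply (St t1 t2); [lra | lra | exact H12 | exact Hx1 | apply (En t0 t1); assumption || lra].
- intros x y HS t0 t1 t2 H0 H01 H12 Hx0 Hx1.
  destruct (Hlo x y) as [XG [St En]].
  { split; [apply (Hsc x y HS) |]; intros t Ht Hle; destruct (HS t Ht) as [D1 D2].
    unfold trunc1, trunc2 in D1, D2; rewrite clip_below in D1, D2 by (auto; lra); split; assumption. }
  apply Ropp_lt_cancel, (St t1 t2); [lra | lra | exact H12 | lra | apply (En t0 t1); lra].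
Qed.

End Between.

(** * Limits and regularity of the solution in the strip *)

Lemma sandwich_at_zero (u : R -> R) (k c d z : R) :
  0 < z -> 0 <= c -> 0 <= d -> (forall t, 0 < t -> t <= z -> k - d * t <= u t <= k + c * t) ->
  filterlim u (at_right 0) (locally k).
Proof.
intros Hz Hc Hd Hu; apply filterlim_locally; intros e.
assert (He : 0 < Rmin z (e / (c + d + 1))).
{ apply Rmin_glb_lt; [exact Hz | apply Rdiv_lt_0_compat; [apply cond_pos | lra]]. }
exists (mkposreal _ He); intros t Ht Ht0; change (Rabs (t - 0) < Rmin z (e / (c + d + 1))) in Ht.
rewrite Rminus_0_r, Rabs_pos_eq in Ht by lra.
assert (H1 : t < z) by (eapply Rlt_le_trans; [exact Ht | apply Rmin_l]).
assert (H2 : t < e / (c + d + 1)) by (eapply Rlt_le_trans; [exact Ht | apply Rmin_r]).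
apply (Rmult_lt_compat_r (c + d + 1)) in H2; [| lra].
replace (e / (c + d + 1) * (c + d + 1)) with (pos e) in H2 by (field; lra).
change (Rabs (u t - k) < e); specialize (Hu t Ht0 ltac:(lra)).
assert (0 <= c * t) by (apply Rmult_le_pos; lra); assert (0 <= d * t) by (apply Rmult_le_pos; lra).
apply Rabs_def1; nra.
Qed.

Lemma decay_vanishes M : 0 < M -> is_lim (decay M) p_infty 0.
Proof.
intros HM; pose proof gam_bounds as Hg.
apply is_lim_spec; intros e; simpl.
exists (Rpower (M / e) (/ gam)); intros t Ht.
pose proof (cond_pos e) as He.
assert (Hp : 0 < M / e) by pos.
pose proof (Rpower_pos (M / e) (/ gam)) as Hr.
rewrite Rminus_0_r, Rabs_pos_eq by (left; apply decay_pos, HM).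
assert (H : M / e < Rpower t gam).
{ replace (M / e) with (Rpower (Rpower (M / e) (/ gam)) gam).
  - apply Rlt_Rpower_l; lra.
  - rewrite Rpower_mult, Rinv_l, Rpower_1; lra. }
unfold decay; rewrite Rpower_Ropp.
apply Rmult_lt_reg_r with (Rpower t gam); [apply Rpower_pos |].
rewrite Rmult_assoc, Rinv_l by (pose proof (Rpower_pos t gam); lra).
apply (Rmult_lt_compat_l e) in H; [| exact He].
replace (e * (M / e)) with M in H by (field; lra); lra.
Qed.

Lemma tail_limits M : 0 < M ->
  is_lim (fun t => Rpower t kap * sup_tail M t) p_infty (Rpower (1 / q) kap) /\
  is_lim (fun t => Rpower t kap * sub_tail M t) p_infty (Rpower (1 / q) kap).
Proof.
intros HM; pose proof q_pos as Hq; pose proof (decay_vanishes M HM) as HD.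
assert (H1q : 0 < 1 / q) by pos.
assert (Hev : Rbar_locally' p_infty (fun t => 0 < t)) by (exists 0; intros; assumption).
assert (HP : forall v, is_lim v p_infty (1 / q) -> is_lim (fun t => Rpower (v t) kap) p_infty (Rpower (1 / q) kap)).
{ intros v Hv; apply (filterlim_comp _ _ _ v (fun s => Rpower s kap) _ (locally (1 / q))); [exact Hv |].
  apply Rpower_id_continuous, H1q. }
split.
- apply is_lim_ext_loc with (fun t => Rpower ((1 + decay M t) * / q) kap).
  + generalize Hev; apply filter_imp; intros t Ht; pose proof (decay_pos M t HM).
    unfold sup_tail; rewrite Rpower_mult_distr; [| exact Ht | apply sup_w_derive; assumption].
    f_equal; unfold sup_w; field; lra.
  + apply HP; replace (1 / q) with ((1 + 0) * / q) by (field; lra).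
    apply (is_lim_scal_r (fun t => 1 + decay M t) (/ q) p_infty (1 + 0)).
    apply (is_lim_plus' (fun _ => 1)); [apply is_lim_const | exact HD].
- apply is_lim_ext_loc with (fun t => Rpower (/ (1 + decay M t) * / q) kap).
  + generalize Hev; apply filter_imp; intros t Ht; pose proof (decay_pos M t HM).
    unfold sub_tail; rewrite Rpower_mult_distr; [| exact Ht | apply sub_w_derive; assumption].
    f_equal; unfold sub_w; field; lra.
  + apply HP; replace (1 / q) with (/ (1 + 0) * / q) by (field; lra).
    apply (is_lim_scal_r (fun t => / (1 + decay M t)) (/ q) p_infty (/ (1 + 0))).
    apply (is_lim_inv (fun t => 1 + decay M t) p_infty (1 + 0)).
    * apply (is_lim_plus' (fun _ => 1)); [apply is_lim_const | exact HD].
    * intros E; injection E; lra.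
Qed.

(** The first equation expresses x' through differentiable quantities, so x'' exists; computing the
    derivative of the momentum in two ways then returns the second-order equation. *)
Lemma solution_second_derivative (x y : R -> R) :
  (forall t, 0 < t -> 0 < x t) ->
  (forall t, 0 < t -> is_derive x t (diff_phi t * y t + diff_Gam t (x t)) /\ is_derive y t (diff_Psi t (x t))) ->
  exists dx ddx : R -> R, forall t, 0 < t -> is_derive x t (dx t) /\ is_derive dx t (ddx t) /\
    oper t (x t) (dx t) (ddx t) = 0 /\ y t = momentum x dx t.
Proof.
intros Hpos HS; set (dx := fun t => diff_phi t * y t + diff_Gam t (x t)).
assert (Hex : forall t, 0 < t -> ex_derive dx t).
{ intros t Ht; destruct (HS t Ht) as [D1 D2]; unfold dx, diff_phi, diff_Gam.
  pose proof (is_derive_Rpower_id t (- a1) Ht) as K1; pose proof (is_derive_Rpower_id (x t) (1 / m) (Hpos t Ht)) as K2.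
  assert (t * t <> 0) by nra.
  auto_derive; repeat split; try assumption; eexists; eassumption. }
assert (Hm : forall t, 0 < t -> y t = momentum x dx t).
{ intros t Ht; unfold momentum, dx, diff_phi, diff_Gam; rewrite Rpower_Ropp.
  pose proof (Rpower_pos t (a1 - 2)); rewrite (Rpower_minus_2 t a1 Ht); field; split; lra. }
exists dx, (Derive dx); intros t Ht; destruct (HS t Ht) as [D1 D2]; split; [exact D1 |].
assert (Dd : is_derive dx t (Derive dx t)) by (apply Derive_correct, Hex, Ht).
split; [exact Dd | split; [| apply Hm, Ht]].
destruct (momentum_system x dx t (Derive dx t) Ht (Hpos t Ht) D1 Dd) as [_ DM].
assert (DM' : is_derive (momentum x dx) t (diff_Psi t (x t))).
{ apply (is_derive_ext_pos y); [exact Ht | intros s Hs; symmetry; apply Hm, Hs | exact D2]. }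
pose proof (is_derive_unique _ _ _ DM) as E1; rewrite (is_derive_unique _ _ _ DM') in E1.
pose proof (Rpower_pos t (a1 - 2)).
apply Rmult_eq_reg_l with (Rpower t (a1 - 2)); lra.
Qed.

(* A mean value of [x'] over [t, 2t] is [O(1/t)]; the momentum varies by
   [O(t^(a1-2))] over that interval. *)
Lemma derivative_bound (x dx y : R -> R) H :
  0 < H -> (forall t, 0 < t -> t <= 2 -> 0 < x t <= H) ->
  (forall t, 0 < t -> is_derive x t (dx t) /\ is_derive y t (diff_Psi t (x t)) /\ y t = momentum x dx t) ->
  exists C, 0 < C /\ forall t, 0 < t -> t <= 1 -> Rabs (t * t * dx t) <= C.
Proof.
intros HH Hx HS.
set (g := Rpower H (1 / m)); assert (Hg : 0 < g) by apply Rpower_pos.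
set (r := Rpower H (p / m)); assert (Hr : 0 < r) by apply Rpower_pos.
assert (Hm : 0 < 1 / m) by pos.
set (C1 := B * ((a1 - 2) * g + 2 * (b * H + r))).
assert (HC1 : 0 < C1).
{ unfold C1; apply Rmult_lt_0_compat; [lra |]; assert (0 < (a1 - 2) * g) by pos.
  assert (0 < b * H) by pos; lra. }
set (C2 := 4 * H + B * g + C1); assert (HBg : 0 < B * g) by pos.
set (E := Rpower 2 (a1 - 2)); assert (HE : 0 < E) by apply Rpower_pos.
exists (E * C2 + B * g); split.
{ assert (0 < E * C2) by (apply Rmult_lt_0_compat; unfold C2; lra); lra. }
intros t Ht Ht1.
set (T := Rpower t (a1 - 2)); assert (HT : 0 < T) by apply Rpower_pos.
assert (HT2 : forall u, 0 < u -> u <= 2 * t -> Rpower u (a1 - 2) <= E * T).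
{ intros u Hu Hut; unfold E, T; rewrite Rpower_mult_distr by lra; apply Rpower_le_base; lra. }
assert (Hgu : forall u, 0 < u -> u <= 2 -> 0 < Rpower (x u) (1 / m) <= g /\ 0 < Rpower (x u) (p / m) <= r).
{ intros u Hu Hu2; destruct (Hx u Hu Hu2); pose proof p_over_m; repeat split; try apply Rpower_pos; apply Rpower_le_base; lra. }
assert (Hit : 0 < / t) by pos.
assert (HPsi : forall u, t <= u -> u <= 2 * t -> Rabs (diff_Psi u (x u)) <= E * T * (C1 * / t)).
{ intros u Hu Hu2; destruct (Hgu u ltac:(lra) ltac:(lra)) as [G1 G2]; destruct (Hx u ltac:(lra) ltac:(lra)) as [X1 X2].
  pose proof (HT2 u ltac:(lra) ltac:(lra)) as HTu; pose proof (Rpower_pos u (a1 - 2)) as HTp.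
  assert (Hiu : 0 < / u) by pos.
  assert (Hiut : / u <= / t) by (apply Rinv_le_contravar; lra).
  assert (Hi1 : 1 <= 2 * / t).
  { assert (1 <= / t) by (rewrite <- Rinv_1; apply Rinv_le_contravar; lra); lra. }
  unfold diff_Psi; set (gu := Rpower (x u) (1 / m)) in *; set (ru := Rpower (x u) (p / m)) in *.
  replace (- B * Rpower u (a1 - 2) * ((a1 - 2) * gu / u + b * x u - ru))
    with (- (Rpower u (a1 - 2) * (B * ((a1 - 2) * gu * / u + b * x u - ru)))) by (field; lra).
  rewrite Rabs_Ropp, Rabs_mult, (Rabs_pos_eq (Rpower u (a1 - 2))) by lra.
  apply Rmult_le_compat; [lra | apply Rabs_pos | exact HTu |].
  rewrite Rabs_mult, (Rabs_pos_eq B) by lra; unfold C1.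
  rewrite (Rmult_assoc B _ (/ t)); apply Rmult_le_compat_l; [lra |].
  assert (A1 : 0 <= (a1 - 2) * gu * / u <= (a1 - 2) * g * / t).
  { split; [apply Rmult_le_pos; [apply Rmult_le_pos |]; lra |].
    apply Rmult_le_compat; [apply Rmult_le_pos; lra | lra | scale | exact Hiut]. }
  assert (A2 : 0 <= b * x u <= b * H) by (split; [apply Rmult_le_pos; lra | scale]).
  assert (A3 : (b * H + r) * 1 <= (b * H + r) * (2 * / t)) by scale.
  apply Rabs_le; lra. }
destruct (mvt_closed x dx t (2 * t)) as (z & Hz1 & Hz2); [lra | intros s Hs; apply HS; lra |].
assert (Hyz : Rabs (y z) <= E * T * (4 * H + B * g)).
{ destruct (HS z ltac:(lra)) as (_ & _ & ->); unfold momentum.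
  rewrite (Rpower_minus_2 z a1) by lra; replace (Rpower z (a1 - 2) * (z * z) * dx z - B * Rpower z (a1 - 2) * Rpower (x z) (1 / m))
    with (Rpower z (a1 - 2) * (z * z * dx z - B * Rpower (x z) (1 / m))) by ring.
  pose proof (Rpower_pos z (a1 - 2)); rewrite Rabs_mult, (Rabs_pos_eq (Rpower z (a1 - 2))) by lra.
  apply Rmult_le_compat; [lra | apply Rabs_pos | apply HT2; lra |].
  destruct (Hgu z ltac:(lra) ltac:(lra)) as [[G1 G2] _].
  destruct (Hx t ltac:(lra) ltac:(lra)); destruct (Hx (2 * t) ltac:(lra) ltac:(lra)).
  assert (Hd : Rabs (t * dx z) <= H).
  { replace (t * dx z) with (x (2 * t) - x t) by lra; apply Rabs_le; lra. }
  assert (Hzz : Rabs (z * z * dx z) <= 4 * H).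
  { replace (z * z * dx z) with (z * z * / t * (t * dx z)) by (field; lra).
    rewrite Rabs_mult; apply Rmult_le_compat; [apply Rabs_pos | apply Rabs_pos | | exact Hd].
    rewrite Rabs_pos_eq by (apply Rmult_le_pos; nra).
    apply Rmult_le_reg_r with t; [exact Ht |]; rewrite Rmult_assoc, Rinv_l by lra; nra. }
  assert (B * Rpower (x z) (1 / m) <= B * g) by scale.
  assert (0 < B * Rpower (x z) (1 / m)) by pos.
  apply Rabs_le_between in Hzz; apply Rabs_le; lra. }
assert (Hyt : Rabs (y t) <= E * T * C2).
{ destruct (Req_dec t z) as [-> | Hne].
  - eapply Rle_trans; [exact Hyz |]; apply Rmult_le_compat_l; [apply Rmult_le_pos; lra | unfold C2; lra].
  - destruct (mvt_closed y (fun u => diff_Psi u (x u)) t z) as (u & Hu1 & Hu2); [lra | intros s Hs; apply HS; lra |].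
    replace (y t) with (y z + - (y z - y t)) by ring; eapply Rle_trans; [apply Rabs_triang |]; rewrite Rabs_Ropp, Hu2, Rabs_mult.
    assert (HC : Rabs (diff_Psi u (x u)) * Rabs (z - t) <= E * T * (C1 * / t) * t).
    { apply Rmult_le_compat; [apply Rabs_pos | apply Rabs_pos | apply HPsi; lra | rewrite Rabs_pos_eq; lra]. }
    replace (E * T * (C1 * / t) * t) with (E * T * C1) in HC by (field; lra); unfold C2; lra. }
destruct (HS t Ht) as (_ & _ & Ey); unfold momentum in Ey.
destruct (Hgu t ltac:(lra) ltac:(lra)) as [[G1 G2] _].
rewrite (Rpower_minus_2 t a1 Ht) in Ey; fold T in Ey.
replace (t * t * dx t) with (y t / T + B * Rpower (x t) (1 / m)) by (rewrite Ey; field; lra).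
eapply Rle_trans; [apply Rabs_triang |]; apply Rplus_le_compat.
- unfold Rdiv; rewrite Rabs_mult, (Rabs_pos_eq (/ T)) by (left; pos).
  apply Rle_trans with (E * T * C2 * / T); [apply Rmult_le_compat_r; [left; apply Rinv_0_lt_compat, HT | exact Hyt] |].
  right; field; lra.
- rewrite Rabs_pos_eq; [scale | apply Rmult_le_pos; lra].
Qed.

(** The last clause allows h' to grow like t^(-2) at 0. This weak bound is all that the regularity
    of f^m at the origin requires, because of the high power of xi in front of it. *)
Theorem connecting_solution : exists K1, K0m < K1 /\ forall k0, 0 < k0 -> k0 <= K1 ->
  exists h dh ddh : R -> R,
    (forall t, 0 < t -> 0 < h t /\ is_derive h t (dh t) /\ is_derive dh t (ddh t) /\
       oper t (h t) (dh t) (ddh t) = 0) /\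
    filterlim h (at_right 0) (locally k0) /\
    is_lim (fun t => Rpower t kap * h t) p_infty (Rpower (1 / q) kap) /\
    exists C, 0 < C /\ forall t, 0 < t -> t <= 1 -> Rabs (t * t * dh t) <= C.
Proof.
pose proof q_pos as Hq; pose proof kap_pos as Hk.
destruct upper_barrier as (K1 & HK1 & HU); exists K1; split; [exact HK1 |]; intros k0 Hk0 Hk01.
destruct (HU k0 Hk0 Hk01) as (hi & XU & zc & zt & e & M & c & Hzc & Hzt & He & HM & U1 & U2 & U3 & U4 & U5).
destruct (lower_barrier k0 zc e Hk0 Hzc He) as (lo & NG & XL & zl & M' & c' & Hzl & HM' & Hc' & Hzlc & L1 & L2 & L3 & L4 & L5 & L6 & L7).
(* On the initial line k0 separates the barriers, along the wave e does, and beyond zt the exact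
   decay 1/(q t) lies between [sub_w] and [sup_w] for any two constants M. *)
assert (Hlh : forall t, 0 < t -> lo t <= hi t).
{ intros t Ht; destruct (Rle_lt_dec t zc) as [H | H].
  - destruct (U2 t Ht H); destruct (L2 t Ht); lra.
  - destruct (Rle_lt_dec t zt) as [H' | H'].
    + apply Rle_trans with e; [apply L5; lra | apply U3; lra].
    + rewrite L4, U4 by lra; apply Rpower_le_base; [apply sub_w_derive; lra | | lra].
      eapply Rle_trans; [apply sub_w_le; lra |]; unfold sup_w.
      pose proof (decay_pos M t HM); rewrite <- (Rmult_1_l (/ (q * t))).
      apply Rmult_le_compat_r; [left; pos; lra | lra]. }
destruct (solution_between_barriers lo hi) as (x & y & Hxb & HS); try assumption.
{ intros t Ht; apply L2, Ht. }
{ intros x y HS; exists XU; apply U5, HS. }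
{ intros x y HS; exists XL; destruct (L7 x y HS) as [T1 T2]; split; intros t0 t1 H0 H1;
    [specialize (T1 t0 t1 H0 H1) | specialize (T2 t0 t1 H0 H1)]; rewrite <- !L6; assumption. }
assert (Hxp : forall t, 0 < t -> 0 < x t).
{ intros t Ht; specialize (Hxb t Ht); destruct (L2 t Ht); lra. }
destruct (solution_second_derivative x y Hxp HS) as (dx & ddx & HD).
exists x, dx, ddx; split; [| split; [| split]].
- intros t Ht; destruct (HD t Ht) as (D1 & D2 & D3 & _); split; [apply Hxp, Ht | split; [exact D1 | split; assumption]].
- assert (Hc : 0 <= c).
  { destruct (U2 zc Hzc (Rle_refl _)) as [A1 A2]; rewrite A2 in A1.
    apply Rmult_le_reg_r with zc; lra. }
  apply sandwich_at_zero with (c := c) (d := c') (z := zl); [lra | exact Hc | lra |].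
  intros t Ht Htz; specialize (Hxb t Ht); rewrite (L3 t Ht Htz) in Hxb.
  destruct (U2 t Ht ltac:(lra)) as [_ A2]; rewrite A2 in Hxb; lra.
- destruct (tail_limits M HM) as [A1 _]; destruct (tail_limits M' HM') as [_ A2].
  apply is_lim_le_le_loc with (f := fun t => Rpower t kap * sub_tail M' t) (g := fun t => Rpower t kap * sup_tail M t); try assumption.
  exists zt; intros t Ht; specialize (Hxb t ltac:(lra)); pose proof (Rpower_pos t kap).
  rewrite L4, U4 in Hxb by lra; split; scale.
- pose proof (Rmax_l zc 2) as Hm1; pose proof (Rmax_r zc 2) as Hm2.
  destruct (continuous_bounded hi zc (Rmax zc 2)) as (H & HH & Hb); [lra | intros t Ht; apply U1; lra |].
  destruct (U2 zc Hzc (Rle_refl _)) as [A1 A2].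
  apply (derivative_bound x dx y H HH).
  + intros t Ht Ht2; split; [apply Hxp, Ht |]; apply Rle_trans with (hi t); [apply Hxb, Ht |].
    destruct (Rle_lt_dec t zc) as [Htz | Htz].
    * specialize (Hb zc ltac:(lra)); apply Rabs_le_between in Hb; rewrite A2 in A1, Hb.
      destruct (U2 t Ht Htz) as [_ ->]; assert (0 <= c) by (apply Rmult_le_reg_r with zc; lra).
      assert (c * t <= c * zc) by scale; lra.
    * specialize (Hb t ltac:(lra)); apply Rabs_le_between in Hb; lra.
  + intros t Ht; destruct (HD t Ht) as (D1 & D2 & D3 & D4); split; [exact D1 | split; [apply HS, Ht | exact D4]].
Qed.
End Equation.

(** * Uniqueness of the maximum *)

Lemma within_halfline_locally (x : R) (P : R -> Prop) :
  0 < x -> within halfline (locally x) P -> locally x P.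
Proof.
intros Hx [d Hd].
assert (Hm : 0 < Rmin d x) by (apply Rmin_glb_lt; [apply cond_pos | exact Hx]).
exists (mkposreal _ Hm); intros y Hy; change (Rabs (y - x) < Rmin d x) in Hy.
apply Hd.
- change (Rabs (y - x) < d); eapply Rlt_le_trans; [exact Hy | apply Rmin_l].
- assert (Hy' : Rabs (y - x) < x) by (eapply Rlt_le_trans; [exact Hy | apply Rmin_r]).
  apply Rabs_def2 in Hy'; unfold halfline; lra.
Qed.

Lemma halfline_continuous (u : R -> R) (x : R) :
  0 < x -> continuous_on halfline u -> continuous u x.
Proof.
intros Hx Hu P HP; apply (within_halfline_locally x (fun y => P (u y)) Hx).
apply (Hu x); [unfold halfline; lra | exact HP].
Qed.

Lemma halfline_derive (F : R -> R) (x l : R) :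
  0 < x -> filterdiff F (within halfline (locally x)) (fun y => scal y l) -> is_derive F x l.
Proof.
intros Hx [Hl Hd]; split; [exact Hl |]; intros z Hz e.
assert (Hz' : is_filter_lim (within halfline (locally x)) z).
{ intros P HP; specialize (Hz P HP); destruct Hz as [d Hd']; exists d; intros y Hy _; apply Hd', Hy. }
apply (within_halfline_locally x _ Hx), (Hd z Hz' e).
Qed.

(** [filterdiff] quantifies over all limit points of its filter; x is the only one here. *)
Lemma halfline_limit_point (x z : R) :
  0 <= x -> is_filter_lim (within halfline (locally x)) z -> x = z.
Proof.
intros Hx Hz; apply Rminus_diag_uniq, Rabs_eq_0, Rle_antisym; [| apply Rabs_pos].
apply le_epsilon; intros r Hr.
destruct (Hz (fun y => Rabs (y - z) < r)) as [d Hd].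
{ exists (mkposreal _ Hr); intros y Hy; exact Hy. }
left; rewrite Rplus_0_l; apply Hd; [apply ball_center | exact Hx].
Qed.

Lemma is_derive_filterdiff_halfline (F : R -> R) (x l : R) :
  0 <= x -> is_derive F x l -> filterdiff F (within halfline (locally x)) (fun y => scal y l).
Proof.
intros Hx [Hl Hd]; split; [exact Hl |]; intros z Hz e.
apply halfline_limit_point in Hz; [subst z | exact Hx]; specialize (Hd x (fun P HP => HP) e); destruct Hd as [d Hd].
exists d; intros y Hy _; apply Hd, Hy.
Qed.

Section SingleMaximum.

Variables (N : nat) (m p sigma : R).
Hypotheses (HN : (1 <= N)%nat) (Hp : 1 < p) (Hpm : p < m) (Hs : 0 < sigma).

Let al := alpha m p sigma.
Let be := beta m p sigma.

Lemma alpha_beta_pos : 0 < al /\ 0 < be.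
Proof.
assert (0 < sigma * (m - 1) + 2 * (p - 1)).
{ assert (0 < sigma * (m - 1)) by pos; lra. }
split; apply Rdiv_lt_0_compat; lra.
Qed.

Variables (f : R -> R) (K : R).
Hypothesis K_pos : 0 < K.
Hypothesis Hprof : self_similar_profile N m p sigma f.
Hypothesis Hzero : behavior_at_zero m p sigma f K.
Hypothesis Hinf : behavior_at_infinity p sigma f.

Lemma profile_nonneg x : 0 <= x -> 0 <= f x.
Proof. apply Hprof. Qed.

Lemma profile_continuous x : 0 < x -> continuous f x.
Proof. intros Hx; apply halfline_continuous; [exact Hx | apply Hprof]. Qed.

Lemma profile_near_zero : exists d, 0 < d /\
  forall x, 0 < x -> x < d -> 0 < f x /\ f x <= 2 * K * Rpower x ((sigma + 2) / (m - p)).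
Proof.
destruct (at_right_eps _ _ (K / 2) Hzero ltac:(lra)) as (d & Hd0 & Hd).
exists d; split; [exact Hd0 |]; intros x Hx Hxd; specialize (Hd x Hx Hxd); apply Rabs_def2 in Hd.
rewrite Rpower_Ropp in Hd; pose proof (Rpower_pos x ((sigma + 2) / (m - p))) as HR.
set (r := Rpower x _) in *; assert (Hir : 0 < / r) by pos.
replace (f x) with (r * (/ r * f x)) by (field; lra); split.
- apply Rmult_lt_0_compat; lra.
- rewrite (Rmult_comm (2 * K)); scale.
Qed.

Lemma profile_derivatives x : 0 < x -> 0 < f x ->
  exists ddF, is_derive (fun x => nnpow (f x) m) x (Derive (fun x => nnpow (f x) m) x) /\
    is_derive (Derive (fun x => nnpow (f x) m)) x ddF /\
    is_derive f x (Derive f x) /\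
    ddF + (INR N - 1) / x * Derive (fun x => nnpow (f x) m) x + al * f x - be * x * Derive f x
      - Rpower x sigma * Rpower (f x) p = 0.
Proof.
intros Hx Hfx; destruct Hprof as (_ & _ & (dF & [HdF _] & _) & Hode).
destruct (Hode x Hx Hfx) as (E1 & E2 & E3).
exists (Derive_n (fun x => nnpow (f x) m) 2 x).
split; [| split; [| split; [apply Derive_correct, E1 | exact E3]]].
- apply Derive_correct; exists (dF x); apply halfline_derive; [exact Hx | apply HdF; lra].
- apply (Derive_correct (Derive (fun x => nnpow (f x) m))), E2.
Qed.

(* The flux [x^(N-1) (f^m)' - beta x^N f] decreases strictly where [f] is small
   and positive, and it vanishes at a zero of [f]; hence [f] would increase
   towards its first zero. *)
Lemma profile_positive x : 0 < x -> 0 < f x.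
Proof.
destruct alpha_beta_pos as [Hal Hbe].
intros Hx; destruct profile_near_zero as (d & Hd & Hnear).
apply Rnot_le_lt; intros Hfx.
set (a := Rmin (d / 2) x).
assert (Ha : 0 < a <= x /\ a < d).
{ unfold a; split; [split; [apply Rmin_glb_lt; lra | apply Rmin_r] |]; eapply Rle_lt_trans; [apply Rmin_l | lra]. }
destruct (first_zero f a x) as (z & Hz & Hfz & Hpos); [lra | | apply Hnear; lra | exact Hfx |].
{ intros t Ht; apply profile_continuous; lra. }
set (n := INR N - 1).
destruct Hprof as (_ & _ & (dF & [HdF HdFc] & _ & HdF0) & _).
set (F := fun x => nnpow (f x) m).
assert (HFd : forall t, 0 < t -> is_derive F t (dF t)) by (intros t Ht; apply halfline_derive; [exact Ht | apply HdF; lra]).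
set (Q := fun t => Rpower t n * dF t - be * t * Rpower t n * f t).
assert (HQz : Q z = 0) by (unfold Q; rewrite (HdF0 z ltac:(lra) Hfz), Hfz; ring).
set (bd := fun t => Rpower t sigma * Rpower (f t) (p - 1)).
assert (HQd : forall t, a <= t < z -> is_derive Q t (Rpower t n * f t * (- al - be * (n + 1) + bd t))).
{ intros t Ht; assert (Htp : 0 < t) by lra; specialize (Hpos t Ht).
  destruct (profile_derivatives t Htp Hpos) as (ddF & D1 & D2 & D3 & E).
  fold F in D1, D2, E.
  assert (D2' : is_derive dF t ddF).
  { apply (is_derive_ext_pos (Derive F)); [exact Htp | | exact D2].
    intros s Hsp; symmetry; apply is_derive_unique, HFd, Hsp. }
  rewrite (is_derive_unique _ _ _ (HFd t Htp)) in E.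
  pose proof (is_derive_Rpower_id t n Htp) as D4.
  unfold Q; auto_derive; [repeat split; eexists; eassumption |].
  rewrite (Derive_eq _ _ _ D4), (Derive_eq _ _ _ D2').
  set (f' := Derive f t) in *; change (Derive (fun x => f x) t) with f'.
  assert (E4 : Rpower t (n - 1) = Rpower t n / t).
  { unfold Rdiv; rewrite <- Rpower_m1 by exact Htp; rewrite <- Rpower_plus; f_equal. }
  assert (E5 : Rpower (f t) p = f t * Rpower (f t) (p - 1)).
  { rewrite <- (Rpower_1 (f t)) at 2 by exact Hpos; rewrite <- Rpower_plus; f_equal; ring. }
  rewrite E4; rewrite E5 in E; unfold bd.
  replace ddF with (be * t * f' + Rpower t sigma * (f t * Rpower (f t) (p - 1)) - al * f t - n / t * dF t) by (unfold n; lra).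
  field; lra. }
assert (Hsmall : exists e, 0 < e /\ a <= z - e /\ forall t, z - e < t < z -> bd t < al).
(* rho solves (z+1)^sigma rho^(p-1) = alpha, so f < rho to the left of z keeps the absorption below
   alpha. *)
{ set (rho := Rpower (al * Rpower (z + 1) (- sigma)) (/ (p - 1))).
  assert (Hrho : 0 < rho) by apply Rpower_pos.
  destruct (continuous_eps f z rho (profile_continuous z ltac:(lra)) Hrho) as (e0 & He00 & He0).
  set (e := Rmin e0 (z - a)).
  assert (He : 0 < e) by (apply Rmin_glb_lt; lra).
  assert (Hez : e <= z - a) by apply Rmin_r.
  assert (Hee : e <= e0) by apply Rmin_l.
  exists e; split; [exact He |]; split; [lra |].
  intros t Ht.
  specialize (He0 t ltac:(apply Rabs_def1; lra)); rewrite Hfz, Rminus_0_r in He0; apply Rabs_def2 in He0.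
  assert (Hat : a <= t < z) by lra.
  specialize (Hpos t Hat); unfold bd.
  assert (H1 : Rpower (f t) (p - 1) < Rpower rho (p - 1)) by (apply Rlt_Rpower_l; lra).
  unfold rho in H1; rewrite Rpower_mult, Rinv_l, Rpower_1 in H1; [| | lra];
    [| pose proof (Rpower_pos (z + 1) (- sigma)); pos].
  assert (H2 : Rpower t sigma <= Rpower (z + 1) sigma) by (apply Rle_Rpower_l; lra).
  rewrite Rpower_Ropp in H1; pose proof (Rpower_pos t sigma); pose proof (Rpower_pos (z + 1) sigma).
  pose proof (Rpower_pos (f t) (p - 1)).
  apply Rle_lt_trans with (Rpower (z + 1) sigma * Rpower (f t) (p - 1)); [scale |].
  apply (Rmult_lt_compat_l (Rpower (z + 1) sigma)) in H1; [| lra].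
  replace (Rpower (z + 1) sigma * (al * / Rpower (z + 1) sigma)) with al in H1 by (field; lra); exact H1. }
destruct Hsmall as (e & He & Hae & Hsm).
assert (Hn1 : 0 <= n).
{ unfold n; apply le_INR in HN; simpl in HN; lra. }
assert (HQc : forall t, 0 < t -> continuous Q t).
{ intros t Ht; unfold Q.
  assert (C1 : continuous (fun s => Rpower s n) t) by (apply Rpower_id_continuous; exact Ht).
  apply (continuous_Rminus (fun t => Rpower t n * dF t)).
  - apply (continuous_Rmult (fun s => Rpower s n)); [exact C1 | apply halfline_continuous; assumption].
  - apply (continuous_Rmult (fun s => be * s * Rpower s n)); [| apply profile_continuous, Ht].
    apply (continuous_Rmult (fun s => be * s)); [| exact C1].
    apply (continuous_Rmult (fun _ => be)); [apply continuous_const | apply continuous_id]. }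
assert (HQpos : forall t, z - e < t < z -> 0 <= Q t).
{ intros t Ht.
  assert (- Q t <= - Q z); [| lra].
  apply (derive_nonneg_le (fun t => - Q t) (fun t => - (Rpower t n * f t * (- al - be * (n + 1) + bd t))) t z); [lra | | |].
  - intros s Hs'; apply (is_derive_Ropp Q), HQd; lra.
  - intros s Hs'; apply (continuous_Ropp Q), HQc; lra.
  - intros s Hs'; specialize (Hsm s ltac:(lra)); specialize (Hpos s ltac:(lra)); pose proof (Rpower_pos s n).
    assert (0 < Rpower s n * f s) by pos.
    assert (0 <= be * (n + 1)) by (apply Rmult_le_pos; lra); nra. }
set (t1 := z - e / 2); assert (Ht1 : z - e < t1 < z) by (unfold t1; lra).
assert (HF : F t1 <= F z).
{ apply (derive_nonneg_le F dF t1 z); [lra | | |].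
  - intros s Hs'; apply HFd; lra.
  - intros s Hs'; exact (is_derive_cont _ _ _ (HFd s ltac:(lra))).
  - intros s Hs'; specialize (HQpos s ltac:(lra)); unfold Q in HQpos; specialize (Hpos s ltac:(lra)); pose proof (Rpower_pos s n).
    assert (0 < be * s * Rpower s n * f s) by pos.
    apply Rmult_le_reg_l with (Rpower s n); lra. }
(* The value 0 of [nnpow] at 0 matters: F z = 0 < F t1 contradicts the monotonicity of F, whereas
   [Rpower] 0 m would be 1. *)
unfold F, nnpow in HF; rewrite Hfz in HF; specialize (Hpos t1 ltac:(lra)).
destruct (Rlt_dec 0 (f t1)); [| lra]; destruct (Rlt_dec 0 0); [lra |].
pose proof (Rpower_pos (f t1) m); lra.
Qed.

(** * Extrema of a profile *)

Lemma quotient_near (u : R -> R) (x l e : R) :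
  is_derive u x l -> 0 < e -> exists d, 0 < d /\ forall h, h <> 0 -> Rabs h < d ->
    Rabs ((u (x + h) - u x) / h - l) < e.
Proof.
intros Hu He; apply is_derive_Reals in Hu; destruct (Hu e He) as [d Hd].
exists d; split; [apply cond_pos | exact Hd].
Qed.

Lemma extremum_slope (u : R -> R) (x l : R) :
  is_derive u x l -> locally x (fun y => u y <= u x) -> l = 0.
Proof.
intros Hu [r Hr]; pose proof (cond_pos r); apply is_derive_Reals in Hu.
rewrite <- (derive_pt_eq_0 u x l (exist _ l Hu) Hu).
apply deriv_maximum with (x - r) (x + r); [lra | lra |].
intros y H1 H2; apply Hr; change (Rabs (y - x) < r); apply Rabs_def1; lra.
Qed.

(** If dd were positive, du would be positive just to the right of x and u would exceed u x there.
    Strict growth comes from the second half of [x, x + h], because du vanishes at x itself. *)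
Lemma maximum_curvature (u du : R -> R) (x dd : R) :
  locally x (fun y => is_derive u y (du y)) -> is_derive du x dd -> du x = 0 ->
  locally x (fun y => u y <= u x) -> dd <= 0.
Proof.
intros [r1 H1] Hdd H0 [r2 H2]; apply Rnot_lt_le; intros Hpos.
destruct (quotient_near du x dd dd Hdd Hpos) as (d & Hd & Hq).
set (h := Rmin d (Rmin r1 r2) / 2).
assert (Hm : 0 < Rmin d (Rmin r1 r2)).
{ apply Rmin_glb_lt; [exact Hd | apply Rmin_glb_lt; apply cond_pos]. }
assert (L1 : Rmin d (Rmin r1 r2) <= d) by apply Rmin_l.
assert (L2 : Rmin d (Rmin r1 r2) <= r1) by (eapply Rle_trans; [apply Rmin_r | apply Rmin_l]).
assert (L3 : Rmin d (Rmin r1 r2) <= r2) by (eapply Rle_trans; [apply Rmin_r | apply Rmin_r]).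
assert (Hh : 0 < h) by (unfold h; lra).
assert (Hdu : forall y, x < y <= x + h -> 0 < du y).
{ intros y Hy; specialize (Hq (y - x) ltac:(lra) ltac:(rewrite Rabs_pos_eq; unfold h in *; lra)).
  replace (x + (y - x)) with y in Hq by ring; rewrite H0, Rminus_0_r in Hq; apply Rabs_def2 in Hq.
  replace (du y) with (du y / (y - x) * (y - x)) by (field; lra); apply Rmult_lt_0_compat; lra. }
assert (Hu : forall y, x <= y <= x + h -> is_derive u y (du y)).
{ intros y Hy; apply H1; change (Rabs (y - x) < r1); rewrite Rabs_pos_eq; unfold h in *; lra. }
assert (A1 : u x <= u (x + h / 2)).
{ apply (derive_nonneg_le u du x (x + h / 2)); [lra | | |].
  - intros t Ht; apply Hu; lra.
  - intros t Ht; assert (Ht' : x <= t <= x + h) by lra; exact (is_derive_cont u t _ (Hu t Ht')).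
  - intros t Ht; left; apply Hdu; lra. }
destruct (mvt_closed u du (x + h / 2) (x + h)) as (c & Hc1 & Hc2); [lra | intros t Ht; apply Hu; lra |].
assert (0 < du c) by (apply Hdu; lra).
assert (u (x + h) <= u x); [| nra].
apply H2; change (Rabs (x + h - x) < r2); rewrite Rabs_pos_eq; unfold h in *; lra.
Qed.

(** With sg = 1 for a maximum and -1 for a minimum. At an extremum f' and (f^m)' vanish, so the
    equation reads (f^m)'' = f (x^sigma f^(p-1) - alpha), and the sign of the left side is known. *)
Lemma profile_extremum sg x : sg = 1 \/ sg = -1 -> 0 < x -> locally x (fun y => sg * f y <= sg * f x) ->
  sg * (Rpower x sigma * Rpower (f x) (p - 1)) <= sg * al.
Proof.
intros Hsg Hx Hext; pose proof (profile_positive x Hx) as Hfx.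
destruct (profile_derivatives x Hx Hfx) as (ddF & D1 & D2 & D3 & E).
set (F := fun x => nnpow (f x) m) in *.
pose proof (locally_pos x Hx) as Hloc.
assert (Hf' : Derive f x = 0).
{ assert (sg * Derive f x = 0); [| destruct Hsg as [-> | ->]; lra].
  apply (extremum_slope (fun y => sg * f y) x); [apply (is_derive_scal f x sg), D3 | exact Hext]. }
assert (HextF : locally x (fun y => sg * F y <= sg * F x)).
{ generalize (filter_and _ _ Hloc Hext); apply filter_imp; intros y [Hy Hle].
  pose proof (profile_positive y Hy) as Hfy; unfold F, nnpow.
  destruct (Rlt_dec 0 (f y)); [| lra]; destruct (Rlt_dec 0 (f x)); [| lra].
  destruct Hsg as [-> | ->].
  - assert (Rpower (f y) m <= Rpower (f x) m) by (apply Rle_Rpower_l; lra); lra.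
  - assert (Rpower (f x) m <= Rpower (f y) m) by (apply Rle_Rpower_l; lra); lra. }
assert (HF' : Derive F x = 0).
{ assert (sg * Derive F x = 0); [| destruct Hsg as [-> | ->]; lra].
  apply (extremum_slope (fun y => sg * F y) x); [apply (is_derive_scal F x sg), D1 | exact HextF]. }
assert (HF'' : sg * ddF <= 0).
{ apply (maximum_curvature (fun y => sg * F y) (fun y => sg * Derive F y) x (sg * ddF)).
  - generalize Hloc; apply filter_imp; intros y Hy.
    destruct (profile_derivatives y Hy (profile_positive y Hy)) as (d' & D1' & _).
    apply (is_derive_scal F y sg), D1'.
  - apply (is_derive_scal (Derive F) x sg), D2.
  - rewrite HF'; ring.
  - exact HextF. }
rewrite Hf', HF' in E.
assert (E5 : Rpower (f x) p = f x * Rpower (f x) (p - 1)).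
{ rewrite <- (Rpower_1 (f x)) at 2 by exact Hfx; rewrite <- Rpower_plus; f_equal; ring. }
rewrite E5 in E.
apply Rmult_le_reg_l with (f x); [exact Hfx |].
replace ddF with (f x * (Rpower x sigma * Rpower (f x) (p - 1)) - f x * al) in HF'' by lra; lra.
Qed.

(** An interior minimum c of f on [x1, x2] would give alpha <= c^sigma f(c)^(p-1) < x2^sigma
    f(x2)^(p-1) <= alpha. The strict step comes from c < x2 alone, so plateaus are excluded as
    well. *)
Lemma no_two_maxima x1 x2 : 0 < x1 -> x1 < x2 ->
  locally x1 (fun y => f y <= f x1) -> locally x2 (fun y => f y <= f x2) -> False.
Proof.
intros Hx1 H12 M1 M2.
destruct (continuity_ab_min f x1 x2) as (c & Hmin & Hc); [lra | |].
{ intros t Ht; apply continuous_cpt, profile_continuous; lra. }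
(* If the minimum is attained at an endpoint, which is also a local maximum point, f is constant
   near it inside the interval, and a nearby interior point is a minimizer too. *)
assert (Hint : exists c, x1 < c < x2 /\ forall t, x1 <= t <= x2 -> f c <= f t).
{ destruct M1 as [r1 M1]; destruct M2 as [r2 M2].
  destruct (Req_dec c x1) as [E1 | N1].
  - set (h := Rmin r1 (x2 - x1) / 2).
    assert (Hm : 0 < Rmin r1 (x2 - x1)) by (apply Rmin_glb_lt; [apply cond_pos | lra]).
    pose proof (Rmin_l r1 (x2 - x1)); pose proof (Rmin_r r1 (x2 - x1)).
    exists (x1 + h); split; [unfold h; lra |]; intros t Ht.
    assert (f (x1 + h) <= f x1); [| specialize (Hmin t Ht); rewrite E1 in Hmin; lra].
    apply M1; change (Rabs (x1 + h - x1) < r1); rewrite Rabs_pos_eq; unfold h; lra.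
  - destruct (Req_dec c x2) as [E2 | N2].
    + set (h := Rmin r2 (x2 - x1) / 2).
      assert (Hm : 0 < Rmin r2 (x2 - x1)) by (apply Rmin_glb_lt; [apply cond_pos | lra]).
      pose proof (Rmin_l r2 (x2 - x1)); pose proof (Rmin_r r2 (x2 - x1)).
      exists (x2 - h); split; [unfold h; lra |]; intros t Ht.
      assert (f (x2 - h) <= f x2); [| specialize (Hmin t Ht); rewrite E2 in Hmin; lra].
      apply M2; change (Rabs (x2 - h - x2) < r2); rewrite Rabs_left1; unfold h; lra.
    + exists c; split; [lra | exact Hmin]. }
clear c Hmin Hc; destruct Hint as (c & Hc & Hmin).
assert (H2 : Rpower x2 sigma * Rpower (f x2) (p - 1) <= al).
{ pose proof (profile_extremum 1 x2 (or_introl eq_refl) ltac:(lra)) as H; rewrite !Rmult_1_l in H; apply H.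
  generalize M2; apply filter_imp; intros y Hy; lra. }
assert (H3 : al <= Rpower c sigma * Rpower (f c) (p - 1)).
{ pose proof (profile_extremum (-1) c (or_intror eq_refl) ltac:(lra)) as H.
  assert (Hl : locally c (fun y => -1 * f y <= -1 * f c)); [| specialize (H Hl); lra].
  assert (Hm : 0 < Rmin (c - x1) (x2 - c)) by (apply Rmin_glb_lt; lra).
  pose proof (Rmin_l (c - x1) (x2 - c)); pose proof (Rmin_r (c - x1) (x2 - c)).
  exists (mkposreal _ Hm); intros y Hy; change (Rabs (y - c) < Rmin (c - x1) (x2 - c)) in Hy; apply Rabs_def2 in Hy.
  specialize (Hmin y ltac:(lra)); lra. }
pose proof (profile_positive c ltac:(lra)) as Hfc.
assert (H4 : Rpower (f c) (p - 1) <= Rpower (f x2) (p - 1)) by (apply Rle_Rpower_l; [lra | split; [exact Hfc | apply Hmin; lra]]).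
assert (H5 : Rpower c sigma < Rpower x2 sigma) by (apply Rlt_Rpower_l; lra).
pose proof (Rpower_pos c sigma); pose proof (Rpower_pos (f c) (p - 1)).
assert (Rpower c sigma * Rpower (f c) (p - 1) < Rpower x2 sigma * Rpower (f x2) (p - 1)); [| lra].
apply Rlt_le_trans with (Rpower x2 sigma * Rpower (f c) (p - 1)); [apply Rmult_lt_compat_r; lra | scale].
Qed.

Lemma Rpower_small (a e : R) : 0 < a -> 0 < e -> exists d, 0 < d /\ forall x, 0 < x -> x < d -> Rpower x a < e.
Proof.
intros Ha He; exists (Rpower e (/ a)); split; [apply Rpower_pos |]; intros x Hx Hxd.
replace e with (Rpower (Rpower e (/ a)) a) by (rewrite Rpower_mult, Rinv_l, Rpower_1; lra).
apply Rlt_Rpower_l; lra.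
Qed.

Lemma profile_small_near_zero e : 0 < e -> exists d, 0 < d /\ forall x, 0 < x -> x < d -> f x < e.
Proof.
intros He; destruct profile_near_zero as (d & Hd & Hn).
destruct (Rpower_small ((sigma + 2) / (m - p)) (e / (2 * K))) as (d' & Hd' & Hs'); [pos | pos |].
exists (Rmin d d'); split; [apply Rmin_glb_lt; assumption |]; intros x Hx Hxd.
pose proof (Rmin_l d d'); pose proof (Rmin_r d d').
destruct (Hn x Hx ltac:(lra)) as [_ H1]; specialize (Hs' x Hx ltac:(lra)).
apply (Rmult_lt_compat_l (2 * K)) in Hs'; [| lra].
replace (2 * K * (e / (2 * K))) with e in Hs' by (field; lra); lra.
Qed.

Lemma profile_zero : f 0 = 0.
Proof.
apply Rle_antisym; [| apply profile_nonneg; lra].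
apply Rnot_lt_le; intros H0.
destruct (profile_small_near_zero (f 0 / 2) ltac:(lra)) as (d & Hd & Hsm).
destruct Hprof as (_ & Hc & _).
specialize (Hc 0 (Rle_refl 0)).
assert (H2 : 0 < f 0 / 2) by lra.
destruct (proj1 (filterlim_locally _ _) Hc (mkposreal _ H2)) as [d' Hd''].
set (x := Rmin d d' / 2); pose proof (Rmin_l d d'); pose proof (Rmin_r d d').
assert (Hm : 0 < Rmin d d') by (apply Rmin_glb_lt; [exact Hd | apply cond_pos]).
assert (Hx : 0 < x) by (unfold x; lra).
specialize (Hsm x Hx ltac:(unfold x; lra)); specialize (Hd'' x).
assert (Hb : ball 0 d' x) by (change (Rabs (x - 0) < d'); rewrite Rminus_0_r, Rabs_pos_eq; unfold x; lra).
specialize (Hd'' Hb ltac:(unfold halfline; lra)); change (Rabs (f x - f 0) < f 0 / 2) in Hd''.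
apply Rabs_def2 in Hd''; lra.
Qed.

Lemma profile_small_at_infinity e : 0 < e -> exists M, forall x, M < x -> f x < e.
Proof.
intros He; set (c := Rpower (1 / (p - 1)) (1 / (p - 1))); assert (Hc : 0 < c) by apply Rpower_pos.
apply is_lim_spec in Hinf; destruct (Hinf (mkposreal _ Hc)) as [M0 HM]; simpl in HM; fold c in HM.
set (s := sigma / (p - 1)) in *; assert (Hsp : 0 < s) by pos.
exists (Rmax (Rmax M0 0) (Rpower (2 * c / e) (/ s))); intros x Hx.
pose proof (Rmax_l (Rmax M0 0) (Rpower (2 * c / e) (/ s))); pose proof (Rmax_r (Rmax M0 0) (Rpower (2 * c / e) (/ s))).
pose proof (Rmax_l M0 0); pose proof (Rmax_r M0 0).
specialize (HM x ltac:(lra)); apply Rabs_def2 in HM.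
assert (Hce : 0 < 2 * c / e) by pos.
assert (HR : 2 * c / e < Rpower x s).
{ replace (2 * c / e) with (Rpower (Rpower (2 * c / e) (/ s)) s) by (rewrite Rpower_mult, Rinv_l, Rpower_1; lra).
  apply Rlt_Rpower_l; [exact Hsp | split; [apply Rpower_pos | lra]]. }
apply (Rmult_lt_compat_r e) in HR; [| exact He].
replace (2 * c / e * e) with (2 * c) in HR by (field; lra).
apply Rmult_lt_reg_l with (Rpower x s); [apply Rpower_pos | lra].
Qed.

Lemma profile_single_maximum : single_maximum_point f.
Proof.
pose proof (profile_positive 1 ltac:(lra)) as H1.
(* The value f 1 serves as reference: f is smaller than it near 0 and near infinity, so the global
   maximum is attained on a compact interval containing 1. *)
destruct (profile_small_near_zero (f 1) H1) as (d & Hd & Hsm).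
destruct (profile_small_at_infinity (f 1) H1) as (M & HM).
set (a := Rmin (d / 2) 1); set (b := Rmax M 1 + 1).
assert (Ha : 0 < a /\ a <= d / 2 /\ a <= 1) by (split; [apply Rmin_glb_lt; lra | split; [apply Rmin_l | apply Rmin_r]]).
assert (Hb : M < b /\ 1 < b) by (unfold b; pose proof (Rmax_l M 1); pose proof (Rmax_r M 1); lra).
destruct (continuity_ab_maj f a b) as (x0 & Hmax & Hx0); [lra | |].
{ intros t Ht; apply continuous_cpt, profile_continuous; lra. }
assert (Hall : forall x, 0 <= x -> f x <= f x0).
{ pose proof (Hmax 1 ltac:(lra)) as Hm1; intros x Hx.
  destruct (Req_dec x 0) as [-> | Hne]; [rewrite profile_zero; lra |].
  destruct (Rlt_le_dec x a); [specialize (Hsm x ltac:(lra) ltac:(lra)); lra |].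
  destruct (Rle_lt_dec x b); [apply Hmax; lra | specialize (HM x ltac:(lra)); lra]. }
exists x0; split; [lra | split; [exact Hall |]]; intros x1 [Hx1 Hl].
assert (Hp1 : 0 < x1).
{ destruct Hx1 as [H | <-]; [exact H |]; exfalso.
  destruct Hl as [r Hr]; set (x := r / 2); pose proof (cond_pos r).
  assert (Hle : f x <= f 0).
  { apply Hr; [change (Rabs (x - 0) < r); rewrite Rminus_0_r, Rabs_pos_eq; unfold x; lra | unfold halfline, x; lra]. }
  rewrite profile_zero in Hle; pose proof (profile_positive x ltac:(unfold x; lra)); lra. }
apply within_halfline_locally in Hl; [| exact Hp1].
assert (Hl0 : locally x0 (fun y => f y <= f x0)).
{ generalize (locally_pos x0 ltac:(lra)); apply filter_imp; intros y Hy; apply Hall; lra. }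
destruct (Rtotal_order x1 x0) as [H | [H | H]]; [exfalso | exact H | exfalso].
- apply (no_two_maxima x1 x0); assumption.
- apply (no_two_maxima x0 x1); try assumption; lra.
Qed.

End SingleMaximum.

(** * From the transformed equation to profiles *)

Section Profile.

Variables (N : nat) (m p sigma : R).
Hypotheses (HN : (1 <= N)%nat) (Hp : 1 < p) (Hpm : p < m) (Hs : 0 < sigma).

Let be := beta m p sigma.
Definition theta : R := (sigma + 2) / (m - p).
Let th := theta.
(** With D = x d/dx, x^2 times the radial Laplacian is D (D + N - 2). On x^(m th) h it acts on h as
    (D + m th)(D + m th + N - 2), and D = (1/be) z d/dz; [ode_a] and [ode_b] are read off after
    multiplication by be^2. *)
Definition ode_a : R := 1 + be * (2 * m * th + INR N - 2).
Definition ode_b : R := m * th * (m * th + INR N - 2).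

(** These relations make the substitution work: the value of (m - p) th gives diffusion and
    absorption the same power of x, the value of 1/be does the same for the drift, and alpha = be th
    removes the zeroth-order part of the drift. The bound m th > 2 makes f^m flat at the origin. *)
Lemma exponents : 0 < be /\ 0 < th /\ 2 < m * th /\ (m - p) * th = sigma + 2 /\
  / be = (m - 1) * th - 2 /\ alpha m p sigma = be * th /\ 1 <= INR N.
Proof.
destruct (alpha_beta_pos m p sigma Hp Hpm Hs) as [Hal Hbe].
assert (HD : 0 < sigma * (m - 1) + 2 * (p - 1)).
{ assert (0 < sigma * (m - 1)) by pos; lra. }
assert (Hth : 0 < th) by (apply Rdiv_lt_0_compat; lra).
assert (E : (m - p) * th = sigma + 2) by (unfold th, theta; field; lra).
split; [exact Hbe | split; [exact Hth | split; [| split; [exact E | split; [| split]]]]].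
- assert (0 < p * th) by pos; lra.
- unfold be, beta, th, theta; field; split; lra.
- unfold be, beta, alpha, th, theta; field; split; lra.
- apply le_INR in HN; exact HN.
Qed.

(** a > 2 follows from 1 = be / be and 2 m th + N - 2 > (m - 1) th - 2 = 1/be. *)
Lemma ode_coefficients : 2 < ode_a /\ 0 < be * be /\ 0 < ode_b.
Proof.
destruct exponents as (Hbe & Hth & Hmt & E1 & E2 & E3 & HN1).
split; [| split].
- assert (be * / be < be * (2 * m * th + INR N - 2)).
  { apply Rmult_lt_compat_l; [exact Hbe |]; rewrite E2; assert (0 < (m + 1) * th) by pos; lra. }
  rewrite Rinv_r in H by lra; unfold ode_a; lra.
- apply Rmult_lt_0_compat; exact Hbe.
- apply Rmult_lt_0_compat; lra.
Qed.

Lemma K0_power : K0 N m p sigma = Rpower (K0m ode_b m p) (1 / m).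
Proof.
destruct exponents as (Hbe & Hth & Hmt & E1 & E2 & E3 & HN1); destruct ode_coefficients as (_ & _ & Hb).
unfold K0, K0m; rewrite Rpower_mult.
replace (- (m / (m - p)) * (1 / m)) with (-1 * (1 / (m - p))) by (field; lra).
rewrite <- Rpower_mult, Rpower_m1 by exact Hb; f_equal.
unfold ode_b, th, theta in *.
assert (Hq : m * ((sigma + 2) / (m - p)) + INR N - 2 = (m * (INR N + sigma) - p * (INR N - 2)) / (m - p)) by (field; lra).
rewrite Hq in *; assert (Hp0 : 0 < (m * (INR N + sigma) - p * (INR N - 2)) / (m - p)) by lra.
apply (Rmult_lt_compat_r (m - p)) in Hp0; [| lra]; rewrite Rmult_0_l in Hp0.
replace ((m * (INR N + sigma) - p * (INR N - 2)) / (m - p) * (m - p)) with (m * (INR N + sigma) - p * (INR N - 2)) in Hp0 by (field; lra).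
field; repeat split; lra.
Qed.

Variables (h dh ddh : R -> R) (k0 : R).
Hypothesis k0_pos : 0 < k0.
Hypothesis Hh : forall t, 0 < t -> 0 < h t /\ is_derive h t (dh t) /\ is_derive dh t (ddh t) /\
  oper ode_a (be * be) ode_b m p t (h t) (dh t) (ddh t) = 0.
Hypothesis Hh0 : filterlim h (at_right 0) (locally k0).
Hypothesis Hhinf : is_lim (fun t => Rpower t (kap m p) * h t) p_infty (Rpower (1 / q p) (kap m p)).
Hypothesis Hdh : exists C, 0 < C /\ forall t, 0 < t -> t <= 1 -> Rabs (t * t * dh t) <= C.

Definition similarity (x : R) : R := Rpower x (/ be).
Let Z := similarity.

Definition profile (x : R) : R :=
  if Rlt_dec 0 x then Rpower x th * Rpower (h (Z x)) (1 / m) else 0.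
Let F x := nnpow (profile x) m.
(** The derivative of f^m by the chain rule, with its one-sided value 0 at the origin. *)
Definition profile_flux (x : R) : R :=
  if Rlt_dec 0 x then Rpower x (m * th - 1) * (m * th * h (Z x) + Z x * dh (Z x) / be) else 0.

Lemma Z_pos x : 0 < Z x. Proof. apply Rpower_pos. Qed.

Lemma Z_derive x : 0 < x -> is_derive Z x (/ be * (Z x / x)).
Proof.
intros Hx; replace (Z x / x) with (Rpower x (/ be - 1)); [apply is_derive_Rpower_id, Hx |].
unfold Rdiv; rewrite <- (Rpower_m1 x) by exact Hx; unfold Z, similarity; rewrite <- Rpower_plus; f_equal.
Qed.

Lemma profile_eq x : 0 < x -> profile x = Rpower x th * Rpower (h (Z x)) (1 / m).
Proof. intros Hx; unfold profile; destruct (Rlt_dec 0 x); [reflexivity | lra]. Qed.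

Lemma profile_pos x : 0 < x -> 0 < profile x.
Proof. intros Hx; rewrite profile_eq by exact Hx; apply Rmult_lt_0_compat; apply Rpower_pos. Qed.
Lemma profile_at_zero : profile 0 = 0.
Proof. unfold profile; destruct (Rlt_dec 0 0); [lra | reflexivity]. Qed.

Lemma F_eq x : 0 < x -> F x = Rpower x (m * th) * h (Z x).
Proof.
intros Hx; unfold F, nnpow; pose proof (profile_pos x Hx) as Hpx.
destruct (Rlt_dec 0 (profile x)); [| lra]; rewrite profile_eq by exact Hx.
rewrite <- Rpower_mult_distr by apply Rpower_pos; rewrite !Rpower_mult.
replace (1 / m * m) with 1 by (field; lra); rewrite Rpower_1 by apply Hh, Z_pos; f_equal; f_equal; ring.
Qed.

Lemma F_zero : F 0 = 0.
Proof. unfold F, nnpow; rewrite profile_at_zero; destruct (Rlt_dec 0 0); [lra | reflexivity]. Qed.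

Lemma profile_flux_eq x : 0 < x ->
  profile_flux x = Rpower x (m * th - 1) * (m * th * h (Z x) + Z x * dh (Z x) / be).
Proof. intros Hx; unfold profile_flux; destruct (Rlt_dec 0 x); [reflexivity | lra]. Qed.

Lemma Rpower_div x a : 0 < x -> Rpower x (a - 1) = Rpower x a / x.
Proof. intros Hx; unfold Rdiv; rewrite <- Rpower_m1 by exact Hx; rewrite <- Rpower_plus; f_equal. Qed.

Lemma F_derive x : 0 < x -> is_derive F x (profile_flux x).
Proof.
intros Hx; destruct exponents as (Hbe & _).
apply (is_derive_ext_pos (fun x => Rpower x (m * th) * h (Z x))); [exact Hx | exact F_eq |].
pose proof (is_derive_Rpower_id x (m * th) Hx) as D1; pose proof (Z_derive x Hx) as D2.
destruct (Hh (Z x) (Z_pos x)) as (_ & D3 & _).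
auto_derive; [repeat split; eexists; eassumption |].
rewrite (Derive_eq _ _ _ D1), (Derive_eq _ _ _ D2), (Derive_eq _ _ _ D3), profile_flux_eq, !(Rpower_div x) by exact Hx; field; lra.
Qed.

Definition flux_slope (x : R) : R :=
  Rpower x (m * th) / (x * x) *
  ((m * th - 1) * (m * th * h (Z x) + Z x * dh (Z x) / be) + m * th * Z x * dh (Z x) / be
   + Z x * dh (Z x) / (be * be) + Z x * Z x * ddh (Z x) / (be * be)).

Lemma flux_derive x : 0 < x -> is_derive profile_flux x (flux_slope x).
Proof.
intros Hx; destruct exponents as (Hbe & _).
apply (is_derive_ext_pos (fun x => Rpower x (m * th - 1) * (m * th * h (Z x) + Z x * dh (Z x) / be)));
  [exact Hx | exact profile_flux_eq |].
pose proof (is_derive_Rpower_id x (m * th - 1) Hx) as D1; pose proof (Z_derive x Hx) as D2.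
destruct (Hh (Z x) (Z_pos x)) as (_ & D3 & D4 & _).
auto_derive; [repeat split; eexists; eassumption |].
rewrite (Derive_eq _ _ _ D1), (Derive_eq _ _ _ D2), (Derive_eq _ _ _ D3), (Derive_eq _ _ _ D4), !(Rpower_div x) by exact Hx.
unfold flux_slope; field; split; lra.
Qed.

Lemma profile_derive x : 0 < x -> is_derive profile x
  (Rpower x th / x * (th * Rpower (h (Z x)) (1 / m) + Z x * (1 / m * Rpower (h (Z x)) (1 / m - 1) * dh (Z x)) / be)).
Proof.
intros Hx; destruct exponents as (Hbe & _).
apply (is_derive_ext_pos (fun x => Rpower x th * Rpower (h (Z x)) (1 / m))); [exact Hx | exact profile_eq |].
destruct (Hh (Z x) (Z_pos x)) as (Hhp & D3 & _).
pose proof (is_derive_Rpower_id x th Hx) as D1; pose proof (Z_derive x Hx) as D2.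
pose proof (is_derive_Rpower_id (h (Z x)) (1 / m) Hhp) as D4.
auto_derive; [repeat split; eexists; eassumption |].
rewrite (Derive_eq _ _ _ D1), (Derive_eq _ _ _ D2), (Derive_eq _ _ _ D3), (Derive_eq _ _ _ D4), (Rpower_div x) by exact Hx.
field; repeat split; lra.
Qed.

Lemma profile_ode x : 0 < x -> profile_ode_at N m p sigma profile x.
Proof.
intros Hx; destruct exponents as (Hbe & Hth & Hmt & E1 & E2 & E3 & HN1).
assert (HdF : forall y, 0 < y -> Derive F y = profile_flux y).
{ intros y Hy; apply is_derive_unique, F_derive, Hy. }
assert (HddF : is_derive (Derive F) x (flux_slope x)).
{ apply (is_derive_ext_pos profile_flux); [exact Hx | exact HdF | apply flux_derive, Hx]. }
unfold profile_ode_at; change (fun x => nnpow (profile x) m) with F.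
split; [eexists; apply profile_derive, Hx |].
split; [exists (flux_slope x); exact HddF |].
change (Derive_n F 2 x) with (Derive (Derive F) x).
rewrite (is_derive_unique _ _ _ HddF), (HdF x Hx), (is_derive_unique _ _ _ (profile_derive x Hx)), E3.
destruct (Hh (Z x) (Z_pos x)) as (Hhp & _ & _ & HO).
rewrite profile_flux_eq, (Rpower_div x (m * th)), profile_eq by exact Hx.
assert (Ep : Rpower (Rpower x th * Rpower (h (Z x)) (1 / m)) p = Rpower x (th * p) * Rpower (h (Z x)) (p / m)).
{ rewrite <- Rpower_mult_distr by apply Rpower_pos; rewrite !Rpower_mult; f_equal; f_equal; field; lra. }
rewrite Ep.
set (T := Rpower x (m * th)); set (g' := 1 / m * Rpower (h (Z x)) (1 / m - 1) * dh (Z x)).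
set (g := Rpower (h (Z x)) (1 / m)); set (gp := Rpower (h (Z x)) (p / m)).
(* Absorption and drift both carry the weight x^(m th - 2) of the diffusion term, so a common factor
   can be taken out. *)
assert (A1 : Rpower x sigma * Rpower x (th * p) = T / (x * x)).
{ rewrite <- Rpower_plus; replace (sigma + th * p) with (m * th - 1 - 1) by lra.
  rewrite !(Rpower_div x) by exact Hx; unfold T; field; lra. }
assert (A2 : Rpower x th * Z x = T / (x * x)).
{ unfold Z, similarity; rewrite <- Rpower_plus, E2; replace (th + ((m - 1) * th - 2)) with (m * th - 1 - 1) by ring.
  rewrite !(Rpower_div x) by exact Hx; unfold T; field; lra. }
unfold oper in HO; fold g' in HO; fold gp in HO; unfold flux_slope; fold T.
replace (Rpower x sigma * (Rpower x (th * p) * gp)) with (T / (x * x) * gp) by (rewrite <- A1; ring).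
match goal with |- ?a + ?b + ?c - ?d - ?e = 0 => replace (a + b + c - d - e) with (a + b + (c - d) - e) by ring end.
(* Since alpha = be th, the terms in g cancel and only the derivative of h^(1/m) is left of the
   drift. *)
replace (be * th * (Rpower x th * g) - beta m p sigma * x * (Rpower x th / x * (th * g + Z x * g' / be)))
  with (- (Rpower x th * Z x * g')) by (change (beta m p sigma) with be; field; split; lra).
rewrite A2.
transitivity (T / (x * x) / (be * be) * (Z x * Z x * ddh (Z x) + ode_a * Z x * dh (Z x) - be * be * g' + be * be * (ode_b * h (Z x) - gp))).
- unfold ode_a, ode_b; field; split; lra.
- rewrite HO; ring.
Qed.

(** * Limits of the profile and its regularity at the origin *)

Lemma Z_small e : 0 < e -> exists d, 0 < d /\ forall x, 0 < x -> x < d -> Z x < e.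
Proof.
intros He; destruct exponents as (Hbe & _).
apply Rpower_small; [apply Rinv_0_lt_compat, Hbe | exact He].
Qed.

Lemma similarity_at_zero : filterlim Z (at_right 0) (at_right 0).
Proof.
intros P [e HP]; destruct (Z_small e (cond_pos e)) as (d & Hd & Hs').
exists (mkposreal _ Hd); intros x Hx Hx0; change (Rabs (x - 0) < d) in Hx.
rewrite Rminus_0_r, Rabs_pos_eq in Hx by lra; apply HP; [| apply Z_pos].
change (Rabs (Z x - 0) < e); rewrite Rminus_0_r, Rabs_pos_eq by (left; apply Z_pos); apply Hs'; assumption.
Qed.

Lemma similarity_at_infinity : filterlim Z (Rbar_locally p_infty) (Rbar_locally p_infty).
Proof.
destruct exponents as (Hbe & _); assert (Hib : 0 < / be) by pos.
intros P [M HP]; exists (Rpower (Rmax M 1) be); intros x Hx; apply HP.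
pose proof (Rmax_l M 1); pose proof (Rmax_r M 1).
apply Rle_lt_trans with (Rmax M 1); [lra |].
replace (Rmax M 1) with (Rpower (Rpower (Rmax M 1) be) (/ be)) by (rewrite Rpower_mult, Rinv_r, Rpower_1; lra).
apply Rlt_Rpower_l; [exact Hib | split; [apply Rpower_pos | exact Hx]].
Qed.

Lemma profile_behavior_at_zero : behavior_at_zero m p sigma profile (Rpower k0 (1 / m)).
Proof.
unfold behavior_at_zero.
apply (filterlim_ext_loc (fun x => Rpower (h (Z x)) (1 / m))).
- exists (mkposreal _ Rlt_0_1); intros x _ Hx; rewrite profile_eq by exact Hx.
  rewrite <- Rmult_assoc, <- Rpower_plus; change ((sigma + 2) / (m - p)) with th.
  replace (- th + th) with 0 by ring; rewrite Rpower_O, Rmult_1_l by exact Hx; reflexivity.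
- apply (filterlim_comp _ _ _ (fun x => h (Z x)) (fun y => Rpower y (1 / m)) _ (locally k0)).
  + apply (filterlim_comp _ _ _ Z h _ (at_right 0)); [apply similarity_at_zero | exact Hh0].
  + apply Rpower_id_continuous, k0_pos.
Qed.

Lemma profile_behavior_at_infinity : behavior_at_infinity p sigma profile.
Proof.
destruct exponents as (Hbe & Hth & Hmt & E1 & E2 & E3 & HN1).
assert (Hq : 0 < q p) by (unfold q; lra).
assert (H1q : 0 < 1 / q p) by pos.
unfold behavior_at_infinity.
replace (Rpower (1 / (p - 1)) (1 / (p - 1))) with (Rpower (Rpower (1 / q p) (kap m p)) (1 / m)).
2: { rewrite Rpower_mult; unfold kap, q in *; f_equal; field; lra. }
apply is_lim_ext_loc with (fun x => Rpower (Rpower (Z x) (kap m p) * h (Z x)) (1 / m)).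
- exists 0; intros x Hx; rewrite profile_eq by exact Hx.
  rewrite <- Rpower_mult_distr by (try apply Rpower_pos; apply Hh, Z_pos).
  rewrite <- Rmult_assoc, <- Rpower_plus, Rpower_mult; f_equal.
  unfold Z, similarity; rewrite Rpower_mult, E2; f_equal.
  replace sigma with ((m - p) * th - 2) by lra; unfold kap, q; field; split; lra.
- apply (filterlim_comp _ _ _ (fun x => Rpower (Z x) (kap m p) * h (Z x)) (fun y => Rpower y (1 / m)) _
    (locally (Rpower (1 / q p) (kap m p)))).
  + apply (filterlim_comp _ _ _ Z (fun t => Rpower t (kap m p) * h t) _ (Rbar_locally p_infty));
      [apply similarity_at_infinity | exact Hhinf].
  + apply Rpower_id_continuous, Rpower_pos.
Qed.

(** By the bound on t^2 h' the bracket in the flux is O(1/Z), and the prefactor is x^(m th - 1) =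
    x^th x Z. The singular factor cancels and O(x^(th + 1)) remains, which is more than is
    claimed. *)
Lemma profile_bounds_near_zero : exists d C, 0 < d /\ d <= 1 /\ 0 < C /\
  forall x, 0 < x -> x < d -> h (Z x) <= C /\ Rabs (profile_flux x) <= C * x.
Proof.
destruct exponents as (Hbe & Hth & Hmt & E1 & E2 & E3 & HN1).
destruct (at_right_eps h k0 k0 Hh0 k0_pos) as (e & He0 & He).
destruct Hdh as (C & HC & Hb).
assert (Hm1 : 0 < Rmin e 1) by (apply Rmin_glb_lt; lra).
pose proof (Rmin_l e 1) as L1; pose proof (Rmin_r e 1) as L2.
destruct (Z_small _ Hm1) as (d & Hd & HZ).
pose proof (Rmin_l d 1) as L3; pose proof (Rmin_r d 1) as L4.
assert (Hib : 0 < / be) by pos.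
set (C' := m * th * (2 * k0) + C * / be).
assert (HC1 : 0 < m * th * (2 * k0)) by pos.
assert (HC2 : 0 < C * / be) by pos.
exists (Rmin d 1), (C' + 2 * k0); split; [apply Rmin_glb_lt; lra | split; [exact L4 | split; [unfold C'; lra |]]].
intros x Hx Hxd; specialize (HZ x Hx ltac:(lra)); pose proof (Z_pos x) as HZp.
specialize (He (Z x) HZp ltac:(lra)); apply Rabs_def2 in He.
split; [unfold C'; lra |]; specialize (Hb (Z x) HZp ltac:(lra)).
rewrite profile_flux_eq by exact Hx.
assert (HZx : Rpower x (m * th - 1) <= Rpower x th * x * Z x).
{ replace (Rpower x th * x * Z x) with (Rpower x (m * th - 1)); [lra |].
  rewrite <- (Rpower_1 x) at 3 by exact Hx; unfold Z, similarity; rewrite <- !Rpower_plus, E2; f_equal; lra. }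
assert (Hx1 : Rpower x th <= 1).
{ rewrite <- (Rpower_O x) by exact Hx; unfold Rpower; apply exp_le_mono.
  assert (ln x < 0) by (rewrite <- ln_1; apply ln_increasing; lra); nra. }
pose proof (Rpower_pos x th) as Hxt; pose proof (Rpower_pos x (m * th - 1)) as Hxm.
rewrite Rabs_mult, (Rabs_pos_eq (Rpower x (m * th - 1))) by lra.
apply Rle_trans with (Rpower x th * x * Z x * (C' * / Z x)).
- apply Rmult_le_compat; [lra | apply Rabs_pos | exact HZx |].
  eapply Rle_trans; [apply Rabs_triang |].
  assert (HiZ : 1 <= / Z x) by (rewrite <- Rinv_1; apply Rinv_le_contravar; lra).
  assert (T1 : Rabs (m * th * h (Z x)) <= m * th * (2 * k0) * / Z x).
  { assert (Hhp : 0 < h (Z x)) by (apply Hh, HZp).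
    rewrite Rabs_pos_eq by (apply Rmult_le_pos; lra).
    apply Rle_trans with (m * th * (2 * k0) * 1); [rewrite Rmult_1_r; scale | scale]. }
  assert (T2 : Rabs (Z x * dh (Z x) / be) <= C * / be * / Z x).
  { replace (Z x * dh (Z x) / be) with (Z x * Z x * dh (Z x) * (/ be * / Z x)) by (field; lra).
    assert (0 < / be * / Z x) by (apply Rmult_lt_0_compat; [lra | pos]).
    rewrite Rabs_mult, (Rabs_pos_eq (/ be * / Z x)) by lra.
    replace (C * / be * / Z x) with (C * (/ be * / Z x)) by ring; scale. }
  unfold C'; lra.
- replace (Rpower x th * x * Z x * (C' * / Z x)) with (Rpower x th * (C' * x)) by (field; lra).
  assert (HCx : 0 < C' * x) by (apply Rmult_lt_0_compat; [unfold C'; lra | lra]).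
  assert (0 < 2 * k0 * x) by pos; nra.
Qed.

Lemma halfline_limit_zero (u : R -> R) :
  u 0 = 0 -> (forall e, 0 < e -> exists d, 0 < d /\ forall x, 0 < x -> x < d -> Rabs (u x) < e) ->
  filterlim u (within halfline (locally 0)) (locally (u 0)).
Proof.
intros H0 Hu; apply filterlim_locally; intros e; destruct (Hu e (cond_pos e)) as (d & Hd & Hx).
exists (mkposreal _ Hd); intros x Hxd Hxp; change (Rabs (x - 0) < d) in Hxd; change (Rabs (u x - u 0) < e).
unfold halfline in Hxp; rewrite Rminus_0_r, Rabs_pos_eq in Hxd by lra; rewrite H0, Rminus_0_r.
destruct (Req_dec x 0) as [-> | Hne]; [rewrite H0, Rabs_R0; apply cond_pos | apply Hx; lra].
Qed.

Lemma halfline_continuity (u : R -> R) :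
  (forall x, 0 < x -> continuous u x) -> filterlim u (within halfline (locally 0)) (locally (u 0)) ->
  continuous_on halfline u.
Proof.
intros Hc H0 x Hx; unfold halfline in Hx; destruct (Req_dec x 0) as [-> | Hne]; [exact H0 |].
apply filterlim_within_ext with u; [reflexivity |].
eapply filterlim_filter_le_1; [apply filter_le_within |]; apply Hc; lra.
Qed.

Lemma profile_self_similar : self_similar_profile N m p sigma profile.
Proof.
destruct exponents as (Hbe & Hth & Hmt & E1 & E2 & E3 & HN1).
destruct profile_bounds_near_zero as (d & C & Hd & Hd1 & HC & Hb).
assert (Hm : 0 < 1 / m) by pos.
split; [| split; [| split]].
- intros x Hx; destruct (Req_dec x 0) as [-> | Hne]; [rewrite profile_at_zero; lra | left; apply profile_pos; lra].
- apply halfline_continuity.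
  + intros x Hx; exact (is_derive_cont _ _ _ (profile_derive x Hx)).
  + apply halfline_limit_zero; [apply profile_at_zero |]; intros e He.
    pose proof (Rpower_pos C (1 / m)) as HCm.
    destruct (Rpower_small th (e / Rpower C (1 / m)) Hth) as (d' & Hd' & Hs'); [pos |].
    exists (Rmin d d'); split; [apply Rmin_glb_lt; assumption |]; intros x Hx Hxd.
    pose proof (Rmin_l d d'); pose proof (Rmin_r d d').
    rewrite Rabs_pos_eq by (left; apply profile_pos, Hx); rewrite profile_eq by exact Hx.
    destruct (Hb x Hx ltac:(lra)) as [H1 _]; specialize (Hs' x Hx ltac:(lra)).
    assert (H2 : Rpower (h (Z x)) (1 / m) <= Rpower C (1 / m)).
    { apply Rle_Rpower_l; [lra | split; [apply Hh, Z_pos | exact H1]]. }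
    pose proof (Rpower_pos x th).
    apply Rle_lt_trans with (Rpower x th * Rpower C (1 / m)); [scale |].
    apply (Rmult_lt_compat_r (Rpower C (1 / m))) in Hs'; [| exact HCm].
    replace (e / Rpower C (1 / m) * Rpower C (1 / m)) with e in Hs' by (field; lra); exact Hs'.
- exists profile_flux.
  assert (HF0 : profile_flux 0 = 0) by (unfold profile_flux; destruct (Rlt_dec 0 0); [lra | reflexivity]).
  split; [split |].
  + intros x Hx; destruct (Req_dec x 0) as [-> | Hne].
    * rewrite HF0; split; [apply (is_linear_scal_l (K := R_AbsRing) (V := R_NormedModule)) |].
      intros z Hz e.
      apply halfline_limit_point in Hz; [| apply Rle_refl].
      subst z.
      (* The difference quotient of f^m at 0 is x^(m th - 1) h with h bounded, and the exponent is
         positive. *)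
      destruct (Rpower_small (m * th - 1) (e / C)) as (d' & Hd' & Hs'); [lra | apply Rdiv_lt_0_compat; [apply cond_pos | lra] |].
      assert (Hmin : 0 < Rmin d d') by (apply Rmin_glb_lt; assumption).
      pose proof (Rmin_l d d'); pose proof (Rmin_r d d').
      exists (mkposreal _ Hmin); intros y Hy Hyp; change (Rabs (y - 0) < Rmin d d') in Hy; unfold halfline in Hyp.
      change (Rabs (F y - F 0 - (y - 0) * 0) <= e * Rabs (y - 0)).
      rewrite F_zero, !Rminus_0_r, Rmult_0_r, Rminus_0_r in *.
      destruct (Req_dec y 0) as [-> | Hny]; [rewrite F_zero, Rabs_R0; lra |].
      assert (Hyp' : 0 < y) by lra; rewrite (Rabs_pos_eq y) in * by lra.
      destruct (Hb y Hyp' ltac:(lra)) as [H1 _]; specialize (Hs' y Hyp' ltac:(lra)).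
      rewrite F_eq by exact Hyp'; pose proof (Hh (Z y) (Z_pos y)) as [Hhp _].
      pose proof (Rpower_pos y (m * th)) as HR; rewrite Rabs_pos_eq by (apply Rmult_le_pos; lra).
      rewrite (Rpower_div y) in Hs' by exact Hyp'.
      apply (Rmult_lt_compat_r (C * y)) in Hs'; [| pos].
      replace (Rpower y (m * th) / y * (C * y)) with (Rpower y (m * th) * C) in Hs' by (field; lra).
      replace (e / C * (C * y)) with (e * y) in Hs' by (field; lra).
      apply Rle_trans with (Rpower y (m * th) * C); [scale | lra].
    * apply is_derive_filterdiff_halfline; [exact Hx | apply F_derive; lra].
  + apply halfline_continuity.
    * intros x Hx; exact (is_derive_cont _ _ _ (flux_derive x Hx)).
    * apply halfline_limit_zero; [exact HF0 |]; intros e He.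
      assert (HeC : 0 < e / C) by pos.
      exists (Rmin d (e / C)); split; [apply Rmin_glb_lt; assumption |]; intros x Hx Hxd.
      pose proof (Rmin_l d (e / C)); pose proof (Rmin_r d (e / C)).
      destruct (Hb x Hx ltac:(lra)) as [_ H1]; eapply Rle_lt_trans; [exact H1 |].
      assert (Hx' : x < e / C) by lra; apply (Rmult_lt_compat_l C) in Hx'; [| exact HC].
      replace (C * (e / C)) with e in Hx' by (field; lra); exact Hx'.
  + split; [exact HF0 |]; intros x Hx Hfx; destruct (Req_dec x 0) as [-> | Hne]; [exact HF0 |].
    pose proof (profile_pos x ltac:(lra)); lra.
- intros x Hx _; apply profile_ode, Hx.
Qed.

End Profile.
Theorem theorem1p3 :
  forall (N : nat) (m p sigma : R),
    (1 <= N)%nat -> 1 < p -> p < m -> 0 < sigma ->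
    (exists Kstar : Rbar,
       Rbar_lt 0 Kstar /\
       (forall K : R, 0 < K -> Rbar_lt K Kstar ->
          exists f : R -> R,
            self_similar_profile N m p sigma f /\
            behavior_at_zero m p sigma f K /\
            behavior_at_infinity p sigma f) /\
       Rbar_lt (K0 N m p sigma) Kstar) /\
    (forall (f : R -> R) (K : R),
       0 < K ->
       self_similar_profile N m p sigma f ->
       behavior_at_zero m p sigma f K ->
       behavior_at_infinity p sigma f ->
       single_maximum_point f).
Proof.
intros N m p sigma HN Hp Hpm Hs; split.
2: { intros f K HK Hprof H0 Hinf; exact (profile_single_maximum N m p sigma HN Hp Hpm Hs f K HK Hprof H0 Hinf). }
destruct (ode_coefficients N m p sigma HN Hp Hpm Hs) as (Ha & HB & Hb).
destruct (connecting_solution _ _ _ m p Ha HB Hb Hp Hpm) as (K1 & HK1 & Hsol).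
assert (Hm : 0 < 1 / m) by (apply Rdiv_lt_0_compat; lra).
assert (HK1p : 0 < K1) by (pose proof (K0m_pos (ode_b N m p sigma) m p); lra).
(* No optimal Kstar is sought: the height K1 reached by the upper barriers, brought back through K =
   h(0)^(1/m), already exceeds K0. *)
exists (Finite (Rpower K1 (1 / m))); split; [apply Rpower_pos | split].
- intros K HK HKlt; simpl in HKlt.
  assert (Hroot : Rpower (Rpower K m) (1 / m) = K).
  { rewrite Rpower_mult; replace (m * (1 / m)) with 1 by (field; lra); apply Rpower_1, HK. }
  assert (HKm : Rpower K m <= K1).
  { left; replace K1 with (Rpower (Rpower K1 (1 / m)) m).
    - apply Rlt_Rpower_l; lra.
    - rewrite Rpower_mult; replace (1 / m * m) with 1 by (field; lra); apply Rpower_1, HK1p. }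
  destruct (Hsol (Rpower K m) (Rpower_pos K m) HKm) as (h & dh & ddh & Hh & Hh0 & Hhinf & Hdh).
  exists (profile m p sigma h); split; [| split].
  + exact (profile_self_similar N m p sigma HN Hp Hpm Hs h dh ddh _ (Rpower_pos K m) Hh Hh0 Hdh).
  + rewrite <- Hroot.
    exact (profile_behavior_at_zero N m p sigma HN Hp Hpm Hs h _ (Rpower_pos K m) Hh0).
  + exact (profile_behavior_at_infinity N m p sigma HN Hp Hpm Hs h dh ddh Hh Hhinf).
- simpl; rewrite (K0_power N m p sigma HN Hp Hpm Hs).
  apply Rlt_Rpower_l; [exact Hm | split; [apply K0m_pos | exact HK1]].
Qed.
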